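(* Let $\mathcal{M}=\langle\Sigma,Q,Q_\forall,Q_\exists,q_0,\delta,F\rangle$ be an alternating Turing machine whose space on every input $\alpha$ is bounded by $2^{2^{|\alpha|}}$, and let $\alpha\in\Sigma^*$ with $n=|\alpha|$. One can construct, in time polynomial in $n$ and the size of $\mathcal{M}$, a finite turn-based open CGS $\mathcal{G}$ and an $\mathsf{ATL}^*$ state formula $\varphi$ over the set of agents $Ag=\{sys,env\}$ such that: $\mathcal{M}$ accepts $\alpha$ iff there is a strategy tree in $exec(\mathcal{G})$ that satisfies $\varphi$ iff $\mathcal{G}\not\models^r\neg\varphi$. Moreover, the size of $\mathcal{G}$ depends only on the size of $\mathcal{M}$.
   Context: An alternating Turing machine $\mathcal{M}=\langle\Sigma,Q,Q_\forall,Q_\exists,q_0,\delta,F\rangle$ has input alphabet $\Sigma$ (containing blank $\#$), states $Q=Q_\forall\cup Q_\exists$ (universal/existential), initial state $q_0$, accepting states $F\subseteq Q$, and $\delta:Q\times\Sigma\to(Q\times\Sigma\times\{L,R\})^2$. Configurations are words in $\Sigma^*(Q\times\Sigma)\Sigma^*$; from a configuration with state $q$ reading $\sigma$, with $\delta(q,\sigma)=\langle(q_l,\sigma_l,d_l),(q_r,\sigma_r,d_r)\rangle$, the left (resp. right) successor is obtained by applying the left (resp. right) triple (new state, written symbol, head move). A computation tree on input $\alpha$ is a finite tree labeled by configurations, rooted at the initial configuration for $\alpha$, where internal universal-configuration nodes have both successors as children and internal existential-configuration nodes have one of them as child; it is accepting if all leaves are labeled by accepting configurations (state in $F$). $\mathcal{M}$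 accepts $\alpha$ iff an accepting computation tree exists. Fix finite sets $AP$, $Ag$, $Ac$; a CGS is $\langle S,s_0,Lab,\tau\rangle$ with $Lab:S\to2^{AP}$, $\tau:S\times Ac^{Ag}\to S\cup\{\top\}$ (every state has a defined transition). An $A$-decision $d_A\in Ac^A$ is available at $s$ if $\tau(s,d_A\cup d')\in S$ for some $d'$. Agent $a$ controls $s$ if exactly one $(Ag\setminus\{a\})$-decision is available there, is passive if exactly one $\{a\}$-decision is available. Turn-based: every state controlled by an agent. Open CGS: special agent $env$, each state controlled by $env$ (environment state) or with $env$ passive (system state). Strategy trees $exec(\mathcal{G})$: obtained from the unwinding of $\mathcal{G}$ from $s_0$ by keeping all children at nodes whose last state is a system state and the children for some nonempty subset of successors at nodes whose last state is an environment state. $\mathsf{ATL}^*$ state formulas and their satisfaction are standard ($\langle\!\langle A\rangle\!\rangle\psi$: some strategy of $A$, mapping histories to available $A$-decisions, enforces $\psi$ on all consistent plays). $\mathcal{G}\models^r\psi$ iff every strategy tree of $\mathcal{G}$ satisfies $\psi$. *)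

(* Defs.v *)
From HB Require Import structures.
From mathcomp Require Import all_boot.

Set Implicit Arguments.
Unset Strict Implicit.
Unset Printing Implicit Defensive.

Inductive dir := L | R.

(* Q is partitioned into the universal states and the others, which are the
   existential states.  A letter of the input word may be the blank. *)
Record ATM := MkATM {
  sym : finType;
  blank : sym;
  st : finType;
  universal : {set st};
  start : st;
  delta : st -> sym -> (st * sym * dir) * (st * sym * dir);
  final : {set st} }.

Definition existential (M : ATM) : {set st M} := ~: universal M.

(* (eta, (q, s), eta') is the word eta . (q, s) . eta'. *)
Definition config (M : ATM) : Type := (seq (sym M) * (st M * sym M) * seq (sym M))%type.

Definition cstate (M : ATM) (C : config M) : st M := C.1.2.1.
Definition csym (M : ATM) (C : config M) : sym M := C.1.2.2.
Definition clen (M : ATM) (C : config M) : nat := size C.1.1 + 1 + size C.2.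

Definition init_config (M : ATM) (w : seq (sym M)) : config M :=
  ([::], (start M, head (blank M) w), behead w).

(* The tape is unbounded in both directions: when the head leaves the word, a
   blank is added on that side.  This is what the default values of [last] and
   [head] do for an empty word. *)
Definition apply_triple (M : ATM) (C : config M) (t : st M * sym M * dir) :
    config M :=
  let: (eta, _, eta') := C in
  let: (q, s, d) := t in
  match d with
  | L => (take (size eta).-1 eta, (q, last (blank M) eta), s :: eta')
  | R => (rcons eta s, (q, head (blank M) eta'), behead eta')
  end.

Definition succ_l (M : ATM) (C : config M) : config M :=
  apply_triple C (delta (cstate C) (csym C)).1.
Definition succ_r (M : ATM) (C : config M) : config M :=
  apply_triple C (delta (cstate C) (csym C)).2.

Inductive reachable (M : ATM) (C0 : config M) : config M -> Prop :=
| reach_refl : reachable C0 C0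
| reach_l C : reachable C0 C -> reachable C0 (succ_l C)
| reach_r C : reachable C0 C -> reachable C0 (succ_r C).

Definition space_bounded (M : ATM) (b : nat -> nat) : Prop :=
  forall (w : seq (sym M)) (C : config M),
    reachable (init_config w) C -> clen C <= b (size w).

Inductive ctree (M : ATM) :=
| CLeaf of config M
| CNode1 of config M & ctree M
| CNode2 of config M & ctree M & ctree M.

Definition croot (M : ATM) (t : ctree M) : config M :=
  match t with CLeaf C | CNode1 C _ | CNode2 C _ _ => C end.

Fixpoint computation (M : ATM) (t : ctree M) : Prop :=
  match t with
  | CLeaf _ => True
  | CNode1 C t1 =>
      [/\ cstate C \in existential M,
          croot t1 = succ_l C \/ croot t1 = succ_r C
        & computation t1]
  | CNode2 C t1 t2 =>
      [/\ cstate C \in universal M,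
          croot t1 = succ_l C, croot t2 = succ_r C, computation t1
        & computation t2]
  end.

Fixpoint accepting (M : ATM) (t : ctree M) : Prop :=
  match t with
  | CLeaf C => cstate C \in final M
  | CNode1 _ t1 => accepting t1
  | CNode2 _ t1 t2 => accepting t1 /\ accepting t2
  end.

Definition accepts (M : ATM) (w : seq (sym M)) : Prop :=
  exists t : ctree M, [/\ croot t = init_config w, computation t & accepting t].

Definition atm_size (M : ATM) : nat := #|sym M| + #|st M| + #|st M| * #|sym M|.

(* [trans s d = None] stands for the value top of the transition function. *)
Record CGS (AP Ag Ac : finType) (S : eqType) := MkCGS {
  s0 : S;
  lab : S -> {set AP};
  trans : S -> {ffun Ag -> Ac} -> option S;
  trans_total : forall s : S, exists d, isSome (trans s d) }.

Definition decision (Ag Ac : finType) (A : {set Ag}) : finType :=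
  {ffun {a : Ag | a \in A} -> Ac}.

Definition extends (Ag Ac : finType) (A : {set Ag})
    (d : {ffun Ag -> Ac}) (dA : decision Ac A) : bool :=
  [forall a : {a : Ag | a \in A}, d (val a) == dA a].

Section CGSNotions.
Context {AP Ag Ac : finType} {S : eqType}.
Implicit Types (G : CGS AP Ag Ac S) (s : S).

Definition available G (A : {set Ag}) s (dA : decision Ac A) : bool :=
  [exists d : {ffun Ag -> Ac}, extends d dA && isSome (trans G s d)].

Definition controls G (a : Ag) s : bool :=
  #|[set dA : decision Ac [set~ a] | available G s dA]| == 1.

Definition passive G (a : Ag) s : bool :=
  #|[set dA : decision Ac [set a] | available G s dA]| == 1.

Definition turn_based G : Prop := forall s, exists a, controls G a s.

Definition is_open (env : Ag) G : Prop :=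
  forall s, controls G env s || passive G env s.

Definition succ G : rel S :=
  fun s s' => [exists d : {ffun Ag -> Ac}, trans G s d == Some s'].

(* A history is a nonempty sequence [s :: v]. *)
Definition is_strategy G (A : {set Ag}) (f : seq S -> decision Ac A) : Prop :=
  forall s v, path (succ G) s v -> available G (last s v) (f (s :: v)).

Definition outcome G (A : {set Ag}) (f : seq S -> decision Ac A) s
    (pi : nat -> S) : Prop :=
  pi 0 = s /\
  forall i, exists d : {ffun Ag -> Ac},
    extends d (f (mkseq pi i.+1)) /\ trans G (pi i) d = Some (pi i.+1).

End CGSNotions.

(* States, bits of the state labels, and entries of the transition table (the
   entries equal to top included). *)
Definition cgs_size (AP Ag Ac S : finType) (G : CGS AP Ag Ac S) : nat :=
  #|S| + #|S| * #|AP| + #|S| * #|Ac| ^ #|Ag|.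

Inductive sform (AP Ag : finType) :=
| STrue
| SAtom of AP
| SNot of sform AP Ag
| SOr of sform AP Ag & sform AP Ag
| SCoal of {set Ag} & pform AP Ag
with pform (AP Ag : finType) :=
| PState of sform AP Ag
| PNot of pform AP Ag
| POr of pform AP Ag & pform AP Ag
| PNext of pform AP Ag
| PUntil of pform AP Ag & pform AP Ag.

Arguments STrue {AP Ag}.
Arguments SAtom {AP Ag}.

Fixpoint sat {AP Ag Ac : finType} {S : eqType} (G : CGS AP Ag Ac S) (s : S)
    (phi : sform AP Ag) {struct phi} : Prop :=
  match phi with
  | STrue => True
  | SAtom p => p \in lab G s
  | SNot phi1 => ~ sat G s phi1
  | SOr phi1 phi2 => sat G s phi1 \/ sat G s phi2
  | SCoal A psi =>
      exists f : seq S -> decision Ac A,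
        is_strategy G f /\ forall pi, outcome G f s pi -> psat G pi psi
  end
with psat {AP Ag Ac : finType} {S : eqType} (G : CGS AP Ag Ac S)
    (pi : nat -> S) (psi : pform AP Ag) {struct psi} : Prop :=
  match psi with
  | PState phi => sat G (pi 0) phi
  | PNot psi1 => ~ psat G pi psi1
  | POr psi1 psi2 => psat G pi psi1 \/ psat G pi psi2
  | PNext psi1 => psat G (fun i => pi i.+1) psi1
  | PUntil psi1 psi2 =>
      exists i, psat G (fun j => pi (i + j)) psi2 /\
        forall k, k < i -> psat G (fun j => pi (k + j)) psi1
  end.

Definition models {AP Ag Ac : finType} {S : eqType} (G : CGS AP Ag Ac S)
    (phi : sform AP Ag) : Prop := sat G (s0 G) phi.

Record openCGS (AP Ag Ac : finType) (env : Ag) (S : eqType) := MkOpenCGS {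
  ocgs :> CGS AP Ag Ac S;
  ocgsP : is_open env ocgs }.

(* A node of the unwinding from [s0 G] is the sequence [v] of the states that
   follow [s0 G]; its last state is [last (s0 G) v]. *)
Record strategy_tree (AP Ag Ac : finType) (env : Ag) (S : eqType)
    (G : openCGS AP Ac env S) := MkStrategyTree {
  node : pred (seq S);
  node_root : node [::];
  node_rcons : forall v s,
    node (rcons v s) -> node v /\ succ G (last (s0 G) v) s;
  node_sys : forall v s, node v -> passive G env (last (s0 G) v) ->
    succ G (last (s0 G) v) s -> node (rcons v s);
  node_env : forall v, node v -> controls G env (last (s0 G) v) ->
    exists2 s, succ G (last (s0 G) v) s & node (rcons v s) }.

Section StrategyTreeCGS.
Context {AP Ag Ac : finType} {env : Ag} {S : eqType}.
Context {G : openCGS AP Ac env S} (T : strategy_tree G).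

Definition tnode : eqType := {v : seq S | node T v}.

Definition tree_lab (x : tnode) : {set AP} := lab G (last (s0 G) (val x)).

Definition tree_trans (x : tnode) (d : {ffun Ag -> Ac}) : option tnode :=
  if trans G (last (s0 G) (val x)) d is Some s then insub (rcons (val x) s)
  else None.

Lemma tree_trans_total (x : tnode) : exists d, isSome (tree_trans x d).
Proof.
suff [s /existsP[d /eqP Hd] Hs] :
    exists2 s, succ G (last (s0 G) (val x)) s & node T (rcons (val x) s).
  by exists d; rewrite /tree_trans Hd insubT.
have /orP[Henv|Hsys] := ocgsP G (last (s0 G) (val x)).
  exact: node_env (valP x) Henv.
have [d] := trans_total G (last (s0 G) (val x)).
case Hd: (trans _ _ _) => [s|] // _.
have Hs : succ G (last (s0 G) (val x)) s by apply/existsP; exists d; rewrite Hd.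
by exists s => //; apply: node_sys (valP x) Hsys Hs.
Qed.

Definition tree_cgs : CGS AP Ag Ac tnode :=
  MkCGS (exist (node T) [::] (node_root T)) tree_lab tree_trans_total.

End StrategyTreeCGS.

Definition reactively_models {AP Ag Ac : finType} {env : Ag} {S : eqType}
    (G : openCGS AP Ac env S) (phi : sform AP Ag) : Prop :=
  forall T : strategy_tree G, models (tree_cgs T) phi.

Inductive agent := sys | env.

Definition agent_to_bool (a : agent) : bool := if a is sys then true else false.
Definition agent_of_bool (b : bool) : agent := if b then sys else env.
Lemma agent_to_boolK : cancel agent_to_bool agent_of_bool.
Proof. by case. Qed.

HB.instance Definition _ := Finite.copy agent (can_type agent_to_boolK).

(* The model of computation is Jones' WHILE language on binary trees.  Every
   evaluation of a subexpression is charged the size of its value, as if values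
   were copied and never shared; hence a program and a Turing machine simulate
   each other within polynomial time, also for the size of the output. *)

Inductive data := Nil | Cons of data & data.

Fixpoint dsize (t : data) : nat :=
  if t is Cons t1 t2 then (dsize t1 + dsize t2).+1 else 1.

Fixpoint deq (t u : data) : bool :=
  match t, u with
  | Nil, Nil => true
  | Cons t1 t2, Cons u1 u2 => deq t1 u1 && deq t2 u2
  | _, _ => false
  end.

Definition dbool (b : bool) : data := if b then Cons Nil Nil else Nil.
Definition dtrue (t : data) : bool := if t is Cons _ _ then true else false.
Definition dhd (t : data) : data := if t is Cons t1 _ then t1 else Nil.
Definition dtl (t : data) : data := if t is Cons _ t2 then t2 else Nil.

Inductive expr :=
| EVar of nat
| ENil
| ECons of expr & expr
| EHd of expr
| ETl of expr
| EEq of expr & expr.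

Inductive cmd :=
| Skip
| Assign of nat & expr
| Seq of cmd & cmd
| If of expr & cmd & cmd
| While of expr & cmd.

Definition store := nat -> data.

Definition upd (m : store) (x : nat) (t : data) : store :=
  fun y => if y == x then t else m y.

Fixpoint eval (m : store) (e : expr) : data :=
  match e with
  | EVar x => m x
  | ENil => Nil
  | ECons e1 e2 => Cons (eval m e1) (eval m e2)
  | EHd e1 => dhd (eval m e1)
  | ETl e1 => dtl (eval m e1)
  | EEq e1 e2 => dbool (deq (eval m e1) (eval m e2))
  end.

Fixpoint cost (m : store) (e : expr) : nat :=
  dsize (eval m e) +
  match e with
  | EVar _ | ENil => 0
  | EHd e1 | ETl e1 => cost m e1
  | ECons e1 e2 | EEq e1 e2 => cost m e1 + cost m e2
  end.

(* [run c m t m'] : from the store [m], [c] halts in the store [m'] after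
   [t] time units. *)
Inductive run : cmd -> store -> nat -> store -> Prop :=
| run_skip m : run Skip m 1 m
| run_assign m x e : run (Assign x e) m (cost m e) (upd m x (eval m e))
| run_seq m m' m'' c1 c2 t1 t2 :
    run c1 m t1 m' -> run c2 m' t2 m'' -> run (Seq c1 c2) m (t1 + t2) m''
| run_if m m' e c1 c2 t :
    run (if dtrue (eval m e) then c1 else c2) m t m' ->
    run (If e c1 c2) m (cost m e + t) m'
| run_while_false m e c :
    ~~ dtrue (eval m e) -> run (While e c) m (cost m e) m
| run_while_true m m' m'' e c t1 t2 :
    dtrue (eval m e) -> run c m t1 m' -> run (While e c) m' t2 m'' ->
    run (While e c) m (cost m e + t1 + t2) m''.

(* Variable 0 holds the input and then the output; the others start as Nil. *)
Definition computes (c : cmd) (x : data) (t : nat) (y : data) : Prop :=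
  exists m', run c (upd (fun=> Nil) 0 x) t m' /\ m' 0 = y.

(* In the encodings, numbers are in unary and functions are tables. *)

Definition enc_seq : seq data -> data := foldr Cons Nil.
Definition enc_nat (n : nat) : data := enc_seq (nseq n Nil).
Definition enc_fin (T : finType) (x : T) : data := enc_nat (enum_rank x).
Definition enc_opt (T : Type) (e : T -> data) (o : option T) : data :=
  if o is Some x then Cons Nil (e x) else Nil.
Definition enc_set (T : finType) (A : {set T}) : data :=
  enc_seq [seq dbool (x \in A) | x <- enum T].

Definition enc_dir (d : dir) : data := dbool (if d is R then true else false).

Definition enc_triple (M : ATM) (t : st M * sym M * dir) : data :=
  enc_seq [:: enc_fin t.1.1; enc_fin t.1.2; enc_dir t.2].

Definition enc_atm (M : ATM) : data :=
  enc_seq [:: enc_nat #|sym M|; enc_fin (blank M); enc_nat #|st M|;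
    enc_set (universal M); enc_fin (start M);
    enc_seq [seq enc_seq [seq Cons (enc_triple (delta q s).1)
                                   (enc_triple (delta q s).2)
                         | s <- enum (sym M)] | q <- enum (st M)];
    enc_set (final M)].

Definition enc_input (M : ATM) (w : seq (sym M)) : data :=
  Cons (enc_atm M) (enc_seq [seq enc_fin s | s <- w]).

Definition pair_decision (Ac : finType) (c e : Ac) : {ffun agent -> Ac} :=
  [ffun a => if a is sys then c else e].

Definition enc_cgs (AP Ac S : finType) (G : CGS AP agent Ac S) : data :=
  enc_seq [:: enc_nat #|AP|; enc_nat #|Ac|; enc_nat #|S|; enc_fin (s0 G);
    enc_seq [seq enc_set (lab G s) | s <- enum S];
    enc_seq [seq enc_seq [seq enc_seq
        [seq enc_opt (@enc_fin S) (trans G s (pair_decision c e))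
        | e <- enum Ac] | c <- enum Ac] | s <- enum S]].

Definition enc_coal (A : {set agent}) : data :=
  Cons (dbool (sys \in A)) (dbool (env \in A)).

Fixpoint enc_sform (AP : finType) (phi : sform AP agent) : data :=
  match phi with
  | STrue => Cons (enc_nat 0) Nil
  | SAtom p => Cons (enc_nat 1) (enc_fin p)
  | SNot phi1 => Cons (enc_nat 2) (enc_sform phi1)
  | SOr phi1 phi2 => Cons (enc_nat 3) (Cons (enc_sform phi1) (enc_sform phi2))
  | SCoal A psi => Cons (enc_nat 4) (Cons (enc_coal A) (enc_pform psi))
  end
with enc_pform (AP : finType) (psi : pform AP agent) : data :=
  match psi with
  | PState phi => Cons (enc_nat 0) (enc_sform phi)
  | PNot psi1 => Cons (enc_nat 1) (enc_pform psi1)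
  | POr psi1 psi2 => Cons (enc_nat 2) (Cons (enc_pform psi1) (enc_pform psi2))
  | PNext psi1 => Cons (enc_nat 3) (enc_pform psi1)
  | PUntil psi1 psi2 =>
      Cons (enc_nat 4) (Cons (enc_pform psi1) (enc_pform psi2))
  end.

Definition enc_output (AP Ac S : finType) (G : CGS AP agent Ac S)
    (phi : sform AP agent) : data := Cons (enc_cgs G) (enc_sform phi).

(* Main.v *)
Require Import Defs.
From HB Require Import structures.
From mathcomp Require Import all_boot.
From mathcomp Require Import zify.
From Stdlib Require Import Classical ClassicalEpsilon FunctionalExtensionality.
From Stdlib Require Import Wellfounded Relation_Operators.

(** A branch of a strategy tree spells a branch of a computation tree of [M].  A
    configuration is written as a row of cells; a cell consists of a letter (a
    tape symbol, possibly with a state) and of an address, which is a set of words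
    of [n + 2] bits.  Addresses need not be numbers: the formula only asks that if
    the cell [y'] of a row has its address included in that of the cell [x'] of the
    preceding row, then the cell [x] after [x'] and the cell [y] after [y'] are
    related in the same way and the letter of [y] is the one that the machine
    writes at [x].  Starting from the headers of the two rows, whose addresses are
    empty, this aligns the rows by induction.

    The exponentially long addresses are compared by a game.  From [x'], env runs
    through the tree and stops at a block [u] of some cell [y] of the next row,
    with the token [tX]; sys then names a word [v].  Sys wins if [v] belongs to
    [y'] and not to [x'], or if [u] belongs to [x] and the letter of [y] is
    correct: an LTL property of polynomial size, since [x'], [x], [y'], [y], [u] and
    [v] all lie on the play.  Conversely an accepting computation tree is written
    with the [2 ^ 2 ^ (n + 1)] addresses [{(t, F t)}], where [F] ranges over the
    boolean functions on words of [n + 1] bits; distinct ones are incomparable.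
    Twice the space bound many cells let the head wander on either side.

    The structure is constant: the machine only enters the formula.  The program
    is obtained from a class of polynomial-time functions on trees closed under
    folds whose step copies the accumulator once. *)

(** One play can only test membership of one named word, so the implication between two inclusions
    is played contrapositively: env exhibits a word [u] of [y]; sys either refutes the premise by a
    word [v] of [y'] missing from [x'], or stands by the conclusion for [u]. As [v] comes after the
    challenge, it may depend on both cells. The requirements on rows are one-sided. A row may be
    shorter than the preceding one and may drop the head; but a lost head never comes back, and a
    row followed by [tA] must show a final state. Two escapes have to be closed: a tree without
    challenges would make the coalition formulas vacuous, a tree full of them would leave no branch
    to constrain. Hence the existential requirements [pEX tX] after blocks and [pEXnX]. The
    computation tree is finite because every unchallenged branch must reach [tA]: the prefixes
    avoiding [tA] are well-founded under extension. As for [n + 2]: [2 ^ 2 ^ (n + 1)] is the square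
    of the space bound, hence at least twice it, and one further bit stores the value of [F]. *)

Set Implicit Arguments.
Unset Strict Implicit.
Unset Printing Implicit Defensive.

(** * Tokens and the game structure *)

(* [b0], [b1]: bits; [tB]: beginning of a block of bits; [tC]: beginning of a cell;
   [tL], [tR]: header of a row reached by the left, resp. right, successor (the
   first row has header [tL]); [tA]: acceptance; [tX]: challenge, after which sys
   outputs bits [z0], [z1]. *)
Inductive tok := b0 | b1 | tB | tC | tL | tR | tA | tX | z0 | z1.

Definition tok_code (t : tok) : bool * bool * bool * bool :=
  match t with
  | b0 => (false, false, false, false) | b1 => (false, false, false, true)
  | tB => (false, false, true, false) | tC => (false, false, true, true)
  | tL => (false, true, false, false) | tR => (false, true, false, true)
  | tA => (false, true, true, false) | tX => (false, true, true, true)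
  | z0 => (true, false, false, false) | z1 => (true, false, false, true)
  end.
Definition tok_decode (c : bool * bool * bool * bool) : tok :=
  match c with
  | (false, false, false, false) => b0 | (false, false, false, true) => b1
  | (false, false, true, false) => tB | (false, false, true, true) => tC
  | (false, true, false, false) => tL | (false, true, false, true) => tR
  | (false, true, true, false) => tA | (false, true, true, true) => tX
  | (true, _, _, false) => z0 | (true, _, _, true) => z1
  end.
Lemma tok_codeK : cancel tok_code tok_decode. Proof. by case. Qed.
HB.instance Definition _ := Finite.copy tok (can_type tok_codeK).

Definition zbit (t : tok) : bool := if t is (z0 | z1) then true else false.
Definition sysst (t : tok) : bool := if t is (tX | z0 | z1) then true else false.

(** The agent who does not move has the single legal action [b0], other joint actions being
    undefined: control and passivity are defined by counting available decisions. *)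
Definition tok_trans (s : tok) (d : {ffun agent -> tok}) : option tok :=
  if sysst s then
    if (d env == b0) && zbit (d sys) then Some (d sys) else None
  else if (d sys == b0) && ~~ zbit (d env) then Some (d env) else None.

(** [(a == sys) (+) sysst s] says that [a] is not the agent to move at [s]. *)
Definition act (s t : tok) : {ffun agent -> tok} :=
  [ffun a => if (a == sys) (+) sysst s then b0 else t].

Lemma tok_trans_act s t : sysst s = zbit t -> tok_trans s (act s t) = Some t.
Proof. by rewrite /tok_trans !ffunE; case: s; case: t. Qed.

Lemma tok_trans_total s : exists d, isSome (tok_trans s d).
Proof.
exists (act s (if sysst s then z0 else b0)).
by rewrite tok_trans_act //; case: (sysst s).
Qed.

Definition tok_cgs : CGS tok agent tok tok :=
  MkCGS tL (fun s => [set s]) tok_trans_total.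

Lemma tok_transE s d t : tok_trans s d = Some t ->
  sysst s = zbit t /\ (if sysst s then d env = b0 /\ d sys = t else d sys = b0 /\ d env = t).
Proof.
rewrite /tok_trans; case: (sysst s).
  by case: ifP => // /andP[/eqP -> H] [<-]; rewrite H.
by case: ifP => // /andP[/eqP -> /negbTE H] [<-]; rewrite H.
Qed.

Lemma tok_succE s t : succ tok_cgs s t = (sysst s == zbit t).
Proof.
apply/existsP/eqP => [[d /eqP /tok_transE[]] //|H].
by exists (act s t); rewrite /= tok_trans_act.
Qed.

Lemma in_setC1_sys (a : agent) : (a \in [set~ env]) = (a == sys).
Proof. by rewrite !inE; case: a. Qed.

Definition dec (A : {set agent}) (t : tok) : decision tok A := [ffun=> t].

Lemma avail_one (A : {set agent}) (a : agent) s (dA : decision tok A) (aA : a \in A) :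
    (forall b, b \in A -> b = a) ->
  available tok_cgs s dA = (if (a == sys) == sysst s then zbit (dA (exist _ a aA)) == sysst s
                             else dA (exist _ a aA) == b0).
Proof.
move=> Auniq; set x := exist _ a aA.
have xP (b : {a : agent | a \in A}) : b = x by apply: val_inj; apply: Auniq (valP b).
apply/existsP/idP => [[d /andP[/forallP /(_ x)/eqP /= <-]]|].
  rewrite /tok_trans; case: (a) => /=; case: (sysst s) => /=; case: ifP => // /andP[] //.
    by move=> _ ->.
  by move=> _ /negbTE ->.
case: ifP => [/eqP E zE|E /eqP dE].
- exists (act s (dA x)); rewrite /= tok_trans_act ?(eqP zE) ?andbT //.
  by apply/forallP => b; rewrite (xP b) ffunE /= E addbb.
- exists (act s (if sysst s then z0 else b0)); rewrite /= tok_trans_act ?andbT; last by case: (sysst s).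
  apply/forallP => b; rewrite (xP b) ffunE /= dE.
  by move: E; case: (a == sys); case: (sysst s).
Qed.

(** The idle agent has the single decision [b0], while the mover always has at least two. With [A]
    equal to [[set~ env]], that is [{sys}], this decides control by env; with [{env}], control by
    sys and passivity of env. *)
Lemma card_avail_one (A : {set agent}) (a : agent) s : a \in A ->
    (forall b, b \in A -> b = a) ->
  (#|[set dA : decision tok A | available tok_cgs s dA]| == 1) = ((a == sys) != sysst s).
Proof.
move=> aA Auniq; set x : {a | a \in A} := exist _ a aA.
have xP (b : {a : agent | a \in A}) : b = x by apply: val_inj; apply: Auniq (valP b).
have decx t : dec A t x = t by rewrite ffunE.
case E: ((a == sys) == sysst s) => /=.
  apply/negP => /cards1P[d0 H].
  pose t1 := if sysst s then z0 else tB; pose t2 := if sysst s then z1 else tC.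
  have D t : zbit t = sysst s -> dec A t = d0.
    move=> zt; apply/set1P; rewrite -H inE (avail_one s (dec A t) aA Auniq) E decx.
    by rewrite zt.
  have : t1 = t2.
    by rewrite -(decx t1) -(decx t2) !D // /t1 /t2; case: (sysst s).
  by rewrite /t1 /t2; case: (sysst s).
apply/cards1P; exists (dec A b0).
apply/setP => d; rewrite !inE (avail_one s d aA Auniq) E.
apply/eqP/eqP => [dx|->]; last by rewrite decx.
by apply/ffunP => b; rewrite (xP b) decx.
Qed.

Lemma tok_controls_env s : controls tok_cgs env s = ~~ sysst s.
Proof.
rewrite /controls (@card_avail_one _ sys); last 2 first.
- by rewrite !inE.
- by move=> b; rewrite in_setC1_sys => /eqP.
by case: (sysst s).
Qed.

Lemma tok_controls_sys s : controls tok_cgs sys s = sysst s.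
Proof.
rewrite /controls (@card_avail_one _ env); last 2 first.
- by rewrite !inE.
- by case; rewrite !inE.
by case: (sysst s).
Qed.

Lemma tok_passive_env s : passive tok_cgs env s = sysst s.
Proof.
rewrite /passive (@card_avail_one _ env); last 2 first.
- by rewrite !inE.
- by case; rewrite !inE.
by case: (sysst s).
Qed.

Lemma tok_open : is_open env tok_cgs.
Proof. by move=> s; rewrite tok_controls_env tok_passive_env; case: (sysst s). Qed.

Definition tok_ocgs := MkOpenCGS tok_open.

Lemma tok_turn_based : turn_based tok_ocgs.
Proof.
move=> s; case E: (sysst s).
  by exists sys; rewrite tok_controls_sys.
by exists env; rewrite tok_controls_env E.
Qed.

(** * The formula *)

Notation pf := (pform tok agent).
Notation sf := (sform tok agent).

Definition ptt : pf := PState STrue.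
Definition pff : pf := PNot ptt.
Definition pa (t : tok) : pf := PState (SAtom t).
Definition pand (a b : pf) : pf := PNot (POr (PNot a) (PNot b)).
Definition pimp (a b : pf) : pf := POr (PNot a) b.
Definition piff (a b : pf) : pf := pand (pimp a b) (pimp b a).
Definition pF (a : pf) : pf := PUntil ptt a.
Definition pG (a : pf) : pf := PNot (pF (PNot a)).
Definition pnext (j : nat) (a : pf) : pf := iter j (@PNext _ _) a.
Definition pands (m : nat) (f : nat -> pf) : pf :=
  foldr (fun j acc => pand (f j) acc) ptt (iota 0 m).
Definition pors (T : finType) (f : T -> pf) : pf :=
  foldr (fun x acc => POr (f x) acc) pff (enum T).

(* [pnx a]: [a] holds at the next special token; [phas a]: [a] holds at a block that
   comes before the next special token. *)
Definition phd : pf := POr (pa tL) (POr (pa tR) (pa tA)).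
Definition psp : pf := POr (pa tC) (POr (pa tX) phd).
Definition pnx (a : pf) : pf := PNext (PUntil (PNot psp) (pand psp a)).
Definition phas (a : pf) : pf := PNext (PUntil (PNot psp) (pand (pa tB) a)).

(* Codes are unary, hence prefix-free: a letter is [tC 0^s 1 0^h 1], where [s] is the
   rank of the symbol and [h] is 0 without head, 1 plus the rank of the state with. *)
Definition pun (j : nat) (a : pf) : pf :=
  iter j (fun b => PNext (pand (pa b0) b)) (PNext (pand (pa b1) a)).
Definition pskip (a : pf) : pf := PNext (PUntil (pa b0) (pand (pa b1) a)).
Definition psym (s : nat) : pf := pand (pa tC) (pun s ptt).
Definition phead (j : nat) : pf := pand (pa tC) (pskip (pun j ptt)).
Definition plet (s j : nat) : pf := pand (pa tC) (pun s (pun j ptt)).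

(* [a] holds at the last cell [y] before the challenge, resp. at the special token
   [y'] that precedes [y]. *)
Definition pY (a : pf) : pf := pF (pand (pand (pa tC) a) (pnx (pa tX))).
Definition pY' (a : pf) : pf := pF (pand (pand psp a) (pnx (pand (pa tC) (pnx (pa tX))))).

(* [pequ], [peqv]: the current block equals the block [u] that precedes the
   challenge, resp. the word [v] that sys outputs. *)
Definition plast (m : nat) : pf := pand (pa tB) (pnext m.+1 (pa tX)).
Definition pequ (m : nat) : pf :=
  pands m (fun j => piff (pnext j.+1 (pa b1))
                         (pF (pand (plast m) (pnext j.+1 (pa b1))))).
Definition peqv (m : nat) : pf :=
  pands m (fun j => piff (pnext j.+1 (pa b1))
                         (pF (pand (pa tX) (pnext j.+1 (pa z1))))).
Definition pmis (m : nat) : pf :=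
  pand (pY' (phas (peqv m))) (PNot (phas (peqv m))).
Definition pinx (m : nat) : pf := pnx (pand (pa tC) (phas (pequ m))).

Definition br (b : bool) : tok := if b then tR else tL.
(** The challenge has to come in the row just after the current one, and [b] is the direction by
    which that row was reached. *)
Definition prow (b : bool) : pf :=
  PNext (PUntil (PNot phd)
    (pand (pa (br b)) (PNext (PUntil (PNot phd) (pa tX))))).
(** A header has the empty address, which is included in every address; inclusion alone would
    therefore align the header of a row with all the cells of the preceding row. *)
Definition psame : pf :=
  POr (pand (pa tC) (pY' (pa tC))) (pand (PNot (pa tC)) (pY' (PNot (pa tC)))).

Section MachineFormulas.
Variable M : ATM.
Implicit Types (q : st M) (s : sym M).

Definition tri (b : bool) q s : st M * sym M * dir :=
  if b then (delta q s).2 else (delta q s).1.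
Definition rk (T : finType) (x : T) : nat := enum_rank x.

Definition pentry (b : bool) q s : pf :=
  pand (pnx (plet (rk s) (rk q).+1)) (pY (psym (rk (tri b q s).1.2))).
Definition psymok (b : bool) : pf :=
  POr (pors (fun s => pand (pnx (plet (rk s) 0)) (pY (psym (rk s)))))
      (pors (fun q => pors (fun s => pentry b q s))).
(** After a move to the right, the head comes from the left neighbour of [x], which is the current
    token; after a move to the left, from the right neighbour of [x], the second special token from
    here. *)
Definition phentry (b : bool) q s : pf :=
  pand (if (tri b q s).2 is R then plet (rk s) (rk q).+1
        else pnx (pnx (plet (rk s) (rk q).+1)))
       (pY (phead (rk (tri b q s).1.1).+1)).
Definition pheadok (b : bool) : pf :=
  POr (pY (phead 0)) (pors (fun q => pors (fun s => phentry b q s))).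
Definition pbody (m : nat) (b : bool) : pf :=
  pimp (pand (prow b) psame)
    (POr (pmis m) (pand (pinx m) (pand (psymok b) (pheadok b)))).

(** The empty coalition quantifies over all plays, so this is the existential path quantifier. *)
Definition pEX (t : tok) : pf :=
  PState (SNot (SCoal set0 (PNext (PNot (pa t))))).
Definition pEXnX : pf := PState (SNot (SCoal set0 (PNext (pa tX)))).

Definition pblank : pf :=
  pand (PNot phd) (pimp (pa tC) (plet (rk (blank M)) 0)).
Definition ptail : pf := PNext (PUntil pblank phd).
Definition pini (w : seq (sym M)) : pf :=
  foldr (fun s acc => pnx (pand (plet (rk s) 0) acc)) ptail w.
Definition pinit (w : seq (sym M)) : pf :=
  PNext (PUntil pblank
    (pand (plet (rk (head (blank M) w)) (rk (start M)).+1) (pini (behead w)))).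

Definition pblk (m : nat) : pf :=
  pimp (pa tB)
    (pand (pands m (fun j => pnext j.+1 (POr (pa b0) (pa b1)))) (pnext m (pEX tX))).
Definition prowhas (a : pf) : pf := PNext (PUntil (PNot phd) (pand (pa tC) a)).
Definition pstate (A : {set st M}) : pf :=
  pskip (pors (fun q => if q \in A then pun (rk q).+1 ptt else pff)).
Definition pfin : pf :=
  pimp (PNext (PUntil (PNot phd) (pa tA))) (prowhas (pstate (final M))).
(** The tree branches at the position just before the next header, so the until stops there; both
    directions must be offered unless the row is accepted. *)
Definition pbranch : pf :=
  PUntil (PNext (PNot phd))
    (pand (PNext phd) (POr (PNext (pa tA)) (pand (pEX tL) (pEX tR)))).
Definition puni : pf :=
  pimp (prowhas (pstate (universal M))) pbranch.
Definition plr : pf := POr (pa tL) (pa tR).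
Definition pcoal (m : nat) (b : bool) : pf := PState (SCoal [set sys] (pbody m b)).

(** A header is followed at once by a cell, so that its address is empty; every cell has a block, so
    that some challenge tests its letter. Existential states get no clause of their own: whatever
    direction the branch takes is a legitimate choice. *)
Definition pmain (m : nat) (w : seq (sym M)) : pf :=
  pand (pinit w)
  (pand (pF (pa tA))
  (pand (pG (pblk m))
  (pand (pG (pimp (pa tC) (phas ptt)))
  (pand (pG (pimp plr (pand (PNext (pa tC)) (pand pfin puni))))
        (pG (pimp (POr (pa tC) plr) (pand (pcoal m false) (pcoal m true)))))))).

Definition psys : pf := POr (pa tX) (POr (pa z0) (pa z1)).
(** Challenged plays are exempt from [pmain]; the first conjunct guarantees an unchallenged
    continuation from every position that precedes a challenge. *)
Definition pall (m : nat) (w : seq (sym M)) : pf :=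
  pand (pG (POr psys pEXnX)) (pimp (pG (PNot (pa tX))) (pmain m w)).
Definition sall (w : seq (sym M)) : sf := SCoal set0 (pall (size w).+2 w).

End MachineFormulas.

(** * Positions in a stream of tokens, and evaluation of path formulas at them *)

Definition hdb (t : tok) : bool := if t is (tL | tR | tA) then true else false.
Definition spb (t : tok) : bool :=
  if t is (tC | tX | tL | tR | tA) then true else false.
Definition bitb (t : tok) : bool := if t is (b0 | b1) then true else false.
Definition lrb (t : tok) : bool := if t is (tL | tR) then true else false.

Section Positions.
Variable r : nat -> tok.

Definition nx (a b : nat) : Prop :=
  [/\ a < b, spb (r b) & forall j, a < j < b -> ~~ spb (r j)].
Definition inC (a p : nat) : Prop :=
  [/\ a < p, r p = tB & forall j, a < j <= p -> ~~ spb (r j)].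
Definition unp (k j : nat) : Prop :=
  (forall i, i < j -> r (k + i.+1) = b0) /\ r (k + j.+1) = b1.
Definition symis c s := r c = tC /\ unp c s.
Definition headis c j := r c = tC /\ exists s, unp c s /\ unp (c + s.+1) j.
Definition letis c s j := [/\ r c = tC, unp c s & unp (c + s.+1) j].

Lemma nx_fun a b b' : nx a b -> nx a b' -> b = b'.
Proof.
move=> [ab sb nb] [ab' sb' nb']; apply/eqP; rewrite eqn_leq; apply/andP; split.
  by rewrite leqNgt; apply/negP => H; move: (nb b'); rewrite ab' H sb' => /(_ isT).
by rewrite leqNgt; apply/negP => H; move: (nb' b); rewrite ab H sb => /(_ isT).
Qed.

Lemma nx_inj a a' b : spb (r a) -> spb (r a') -> nx a b -> nx a' b -> a = a'.
Proof.
move=> sa sa' [ab sb nb] [ab' sb' nb']; case: (ltngtP a a') => // H.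
  by move: (nb a'); rewrite H ab' sa' => /(_ isT).
by move: (nb' a); rewrite H ab sa => /(_ isT).
Qed.

Lemma unp_fun k j j' : unp k j -> unp k j' -> j = j'.
Proof.
move=> [H1 H2] [H1' H2']; case: (ltngtP j j') => // H.
  by move: (H1' j H); rewrite H2.
by move: (H1 j' H); rewrite H2'.
Qed.

Lemma unp_bits k j i : unp k j -> i <= j -> bitb (r (k + i.+1)).
Proof.
move=> [H1 H2]; rewrite leq_eqVlt => /orP[/eqP ->|/H1 ->] //.
by rewrite H2.
Qed.

Lemma letisE c s j : letis c s j <-> symis c s /\ headis c j.
Proof.
split=> [[A B C]|[[A B] [_ [s' [C D]]]]]; first by split; split=> //; exists s.
by split=> //; rewrite (unp_fun B C).
Qed.

Lemma symis_fun c s s' : symis c s -> symis c s' -> s = s'.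
Proof. by move=> [_ A] [_ B]; apply: unp_fun A B. Qed.
Lemma headis_fun c s s' : headis c s -> headis c s' -> s = s'.
Proof.
move=> [_ [a [A A']]] [_ [b [B B']]]; move: A' B'.
by rewrite (unp_fun A B); apply: unp_fun.
Qed.

End Positions.

Section Eval.
Variable ss : nat -> sf -> Prop.

(** Evaluation at a position of one fixed play rather than on its suffixes, so that several
    positions can be related. State formulas are left to an abstract [ss], of which only the values
    on [STrue] and on atoms are used for formulas without coalitions. *)
Fixpoint ev (k : nat) (a : pf) : Prop :=
  match a with
  | PState f => ss k f
  | PNot a1 => ~ ev k a1
  | POr a1 a2 => ev k a1 \/ ev k a2
  | PNext a1 => ev k.+1 a1
  | PUntil a1 a2 =>
      exists i, ev (k + i) a2 /\ forall j, j < i -> ev (k + j) a1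
  end.

Variable r : nat -> tok.
Hypothesis ssT : forall k, ss k STrue.
Hypothesis ssA : forall k t, ss k (SAtom t) <-> r k = t.

Lemma ev_until k a b :
  ev k (PUntil a b) <->
  exists i, [/\ k <= i, ev i b & forall j, k <= j < i -> ev j a].
Proof.
split=> [[i [bi ai]]|[i [ki bi ai]]].
  exists (k + i); split=> //; first by lia.
  move=> j /andP[kj ji]; have := ai (j - k); rewrite subnKC //; apply; lia.
by exists (i - k); rewrite subnKC //; split=> // j ji; apply: ai; lia.
Qed.

Lemma ev_X k a : ev k (PNext a) <-> ev k.+1 a. Proof. by []. Qed.
Lemma ev_N k a : ev k (PNot a) <-> ~ ev k a. Proof. by []. Qed.
Lemma ev_or k a b : ev k (POr a b) <-> ev k a \/ ev k b. Proof. by []. Qed.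
Lemma ev_and k a b : ev k (pand a b) <-> ev k a /\ ev k b.
Proof. by rewrite /=; tauto. Qed.
Lemma ev_imp k a b : ev k (pimp a b) <-> (ev k a -> ev k b).
Proof. by rewrite /=; tauto. Qed.
Lemma ev_iff k a b : ev k (piff a b) <-> (ev k a <-> ev k b).
Proof. by rewrite /=; tauto. Qed.
Lemma ev_pa k t : ev k (pa t) <-> r k = t.
Proof. exact: ssA. Qed.

Lemma ev_F k a : ev k (pF a) <-> exists2 i, k <= i & ev i a.
Proof.
rewrite /pF ev_until; split=> [[i [ki ai _]]|[i ki ai]]; first by exists i.
by exists i; split=> // j _; apply: ssT.
Qed.

Lemma ev_G k a : ev k (pG a) <-> forall i, k <= i -> ev i a.
Proof.
have := ev_F k (PNot a); rewrite /pG -/ev => H.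
split=> [nF i ki|aG FF].
  by apply: NNPP => na; apply: nF; apply/H; exists i.
by have [i ki /=] := (proj1 H FF); apply; apply: aG.
Qed.

Lemma ev_next k j a : ev k (pnext j a) <-> ev (k + j) a.
Proof.
elim: j k => [|j IH] k; first by rewrite addn0.
by rewrite /= IH addSnnS.
Qed.

Lemma ev_ands k m f : ev k (pands m f) <-> forall j, j < m -> ev k (f j).
Proof.
have H l : ev k (foldr (fun j acc => pand (f j) acc) ptt l) <->
    forall j, j \in l -> ev k (f j).
  elim: l => [|x l IH]; first by split=> // _; apply: ssT.
  rewrite ev_and IH; split=> [[fx fl] j|H].
    by rewrite inE => /orP[/eqP ->|/fl].
  by split=> [|j jl]; apply: H; rewrite inE ?eqxx ?jl ?orbT.
rewrite H; split=> K j; first by move=> jm; apply: K; rewrite mem_iota.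
by rewrite mem_iota => /andP[_ jm]; apply: K.
Qed.

Lemma ev_ors k (T : finType) (f : T -> pf) : ev k (pors f) <-> exists x, ev k (f x).
Proof.
have H l : ev k (foldr (fun j acc => POr (f j) acc) pff l) <->
    exists2 j, j \in l & ev k (f j).
  elim: l => [|x l IH]; first by split=> [n|[j]]; [case: (n (ssT k)) | rewrite in_nil].
  rewrite [ev k _]/= IH; split=> [[fx|[y yl fy]]|[y]].
  - by exists x; rewrite ?mem_head.
  - by exists y; rewrite ?inE ?yl ?orbT.
  by rewrite inE => /orP[/eqP -> fx|yl fy]; [left | right; exists y].
rewrite H; split=> [[j _ fj]|[j fj]]; first by exists j.
by exists j => //; rewrite mem_enum.
Qed.

Lemma ev_hd k : ev k phd <-> hdb (r k).
Proof.
rewrite /phd -[ev k _]/(ev k (pa tL) \/ ev k (pa tR) \/ ev k (pa tA)) !ev_pa.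
by split=> [[->|[->|->]]|] //; case: (r k) => //; auto.
Qed.
Lemma ev_sp k : ev k psp <-> spb (r k).
Proof.
rewrite /psp -[ev k _]/(ev k (pa tC) \/ ev k (pa tX) \/ ev k phd) ev_hd !ev_pa.
by split=> [[->|[->|]]|] //; case: (r k) => //; auto.
Qed.

Lemma ev_pnx k a : ev k (pnx a) <-> exists2 b, nx r k b & ev b a.
Proof.
rewrite ev_X ev_until; split.
  move=> [i [ki]]; rewrite ev_and ev_sp => -[si ai] H.
  exists i => //; split=> // j jj.
  by have := H j jj; rewrite ev_N ev_sp => /negP.
move=> [b [kb sb nb] ab]; exists b; split=> //; first by apply/ev_and; rewrite ev_sp.
move=> j jj; rewrite ev_N ev_sp; by apply/negP; apply: nb.
Qed.

Lemma ev_phas k a : ev k (phas a) <-> exists2 p, inC r k p & ev p a.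
Proof.
rewrite ev_X ev_until; split.
  move=> [i [ki]]; rewrite ev_and ev_pa => -[si ai] H.
  exists i => //; split=> // j /andP[kj]; rewrite leq_eqVlt => /orP[/eqP ->|ji].
    by rewrite si.
  have := H j; rewrite kj ji ev_N ev_sp => /(_ isT).
  by move/negP.
move=> [p [kp sp np] ap]; exists p; split=> //; first by rewrite ev_and ev_pa.
move=> j jj.
rewrite ev_N ev_sp; apply/negP; apply: np; lia.
Qed.

Lemma ev_un k j a : ev k (pun j a) <-> unp r k j /\ ev (k + j.+1) a.
Proof.
elim: j k => [|j IH] k.
  rewrite ev_X ev_and ev_pa /unp addn1.
  by split=> [[A B]|[[A B] C]].
have E i : k.+1 + i = k + i.+1 by lia.
rewrite ev_X ev_and IH ev_pa /unp !E; split=> [[H0 [[H1 H2] H3]]|[[H1 H2] H3]].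
  split=> //; split=> //; case=> [|i] ij; first by rewrite addn1.
  by rewrite -E; apply: H1.
split; first by rewrite -[k.+1]addn1; apply: H1.
by split=> //; split=> // i ij; rewrite E; apply: H1.
Qed.

Lemma ev_skip k a : ev k (pskip a) <-> exists2 s, unp r k s & ev (k + s.+1) a.
Proof.
rewrite ev_X ev_until; split.
  move=> [i [ki]]; rewrite ev_and ev_pa => -[r1 ai] H.
  exists (i - k.+1); rewrite /unp -?addSnnS subnKC //.
  split=> // j jj; apply/ev_pa; apply: H; lia.
move=> [s [u0 u1] as_]; exists (k + s.+1); split; [lia | by rewrite ev_and ev_pa | ].
move=> j jj; apply/ev_pa; have -> : j = k + (j - k.+1).+1 by lia.
apply: u0; lia.
Qed.

Lemma ev_sym k s : ev k (psym s) <-> symis r k s.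
Proof.
rewrite ev_and ev_pa ev_un /symis; split=> [[A [B _]]|[A B]] //.
by split=> //; split=> //; apply: ssT.
Qed.
Lemma ev_let k s j : ev k (plet s j) <-> letis r k s j.
Proof.
rewrite ev_and ev_pa !ev_un /letis; split=> [[A [B [C _]]]|[A B C]] //.
by split=> //; split=> //; split=> //; apply: ssT.
Qed.
Lemma ev_head k j : ev k (phead j) <-> headis r k j.
Proof.
rewrite ev_and ev_pa ev_skip /headis; split=> [[A [s B]]|[A [s [B C]]]].
  by rewrite ev_un => -[C _]; split=> //; exists s.
by split=> //; exists s => //; rewrite ev_un; split=> //; apply: ssT.
Qed.

Lemma ev_pY k a : ev k (pY a) <->
  exists y z, [/\ k <= y, r y = tC, nx r y z, r z = tX & ev y a].
Proof.
rewrite ev_F; split=> [[y ky]|[y [z [ky Cy nyz Xz ay]]]].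
  by rewrite !ev_and ev_pa ev_pnx => -[[Cy ay] [z nz]]; rewrite ev_pa => rz; exists y, z.
by exists y => //; rewrite !ev_and ev_pa ev_pnx; split=> //; exists z => //; rewrite ev_pa.
Qed.

Lemma ev_pY' k a : ev k (pY' a) <->
  exists x y z, [/\ k <= x /\ spb (r x), nx r x y, r y = tC, nx r y z & r z = tX /\ ev x a].
Proof.
rewrite ev_F; split=> [[x kx]|[x [y [z [[kx sx] nxy Cy nyz [Xz ax]]]]]].
  rewrite !ev_and ev_sp ev_pnx => -[[sx ax] [y nxy]]; rewrite ev_and ev_pa ev_pnx => -[Cy [z nz]].
  by rewrite ev_pa => rz; exists x, y, z.
exists x => //; rewrite !ev_and ev_sp ev_pnx; split=> //; exists y => //.
by rewrite ev_and ev_pa ev_pnx; split=> //; exists z => //; rewrite ev_pa.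
Qed.

End Eval.

(** * Streams ended by a challenge *)

Definition veq (m : nat) (r : nat -> tok) (p p' : nat) : Prop :=
  forall j, j < m -> (r (p + j.+1) = b1 <-> r (p' + j.+1) = b1).

Definition blocky (m : nat) (r : nat -> tok) : Prop :=
  forall p, r p = tB -> forall j, j < m -> bitb (r (p + j.+1)).

Lemma nosp_block m r a p j : blocky m r -> inC r a p -> a < j <= p + m -> ~~ spb (r j).
Proof.
move=> blk [ap Bp np] jj; case: (leqP j p) => jp; first by apply: np; lia.
have := blk p Bp (j - p.+1); have -> : p + (j - p.+1).+1 = j by lia.
have L : j - p.+1 < m by lia.
by move/(_ L); case: (r j).
Qed.

(** Bits are not special tokens, so a block is complete before the next special token. *)
Lemma inC_le m r a p b : blocky m r -> inC r a p -> spb (r b) -> a < b -> p + m < b.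
Proof.
move=> blk ip sb ab; rewrite ltnNge; apply/negP => H.
by move: (nosp_block (j := b) blk ip); rewrite ab H sb => /(_ isT).
Qed.

Section Content.
Variables (M : ATM) (r : nat -> tok) (d : bool).

Definition symok (k y : nat) : Prop :=
  (exists (s : sym M) x, [/\ nx r k x, letis r x (rk s) 0 & symis r y (rk s)]) \/
  (exists (q : st M) (s : sym M) x,
     [/\ nx r k x, letis r x (rk s) (rk q).+1 & symis r y (rk (tri d q s).1.2)]).

Definition headok (k y : nat) : Prop :=
  headis r y 0 \/
  (exists (q : st M) (s : sym M),
     (if (tri d q s).2 is R then letis r k (rk s) (rk q).+1
      else exists x x', [/\ nx r k x, nx r x x' & letis r x' (rk s) (rk q).+1])
     /\ headis r y (rk (tri d q s).1.1).+1).
End Content.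

(** * The formula [pbody] on a challenged play [c], read off an unchallenged stream [r] with the
    same prefix *)

Section Divert.
Variables (M : ATM) (m : nat) (r c : nat -> tok) (e : nat).
Variable ss : nat -> sf -> Prop.
Hypothesis ssT : forall k, ss k STrue.
Hypothesis ssA : forall k t, ss k (SAtom t) <-> c k = t.
Hypothesis agr : forall i, i <= e -> c i = r i.
Hypothesis chal : c e.+1 = tX.
Hypothesis after : forall i, e.+1 < i -> zbit (c i).
Hypothesis main : forall i, ~~ sysst (r i).
Hypothesis blk : blocky m r.

Lemma c_sp i : spb (c i) -> i <= e.+1.
Proof. by move=> si; rewrite leqNgt; apply/negP => /after; case: (c i) si. Qed.

Lemma c_X i : c i = tX -> i = e.+1.
Proof.
move=> Xi; have := @c_sp i; rewrite Xi => /(_ isT); rewrite leq_eqVlt => /orP[/eqP //|ie].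
by have := main i; rewrite -agr // Xi.
Qed.

Lemma nx_agr a b : b <= e -> nx c a b <-> nx r a b.
Proof.
move=> be; split=> -[ab sb nb]; split=> //; rewrite ?agr // -?agr // => j jj.
  by rewrite -agr; [apply: nb | lia].
by rewrite agr; [apply: nb | lia].
Qed.

Lemma inC_agr a p : p <= e -> inC c a p <-> inC r a p.
Proof.
move=> be; split=> -[ab sb nb]; split=> //; rewrite ?agr // -?agr // => j jj.
  by rewrite -agr; [apply: nb | lia].
by rewrite agr; [apply: nb | lia].
Qed.

(** A unary code is made of bits, so it cannot run across the marker of a block. This bounds the
    extent of letters. *)
Lemma unp_lt a p j (r' : nat -> tok) : a < p -> r' p = tB -> unp r' a j -> a + j.+1 < p.
Proof.
move=> ap Bp' u; rewrite ltnNge; apply/negP => H.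
have : bitb (r' p); last by rewrite Bp'.
have -> : p = a + (p - a.+1).+1 by lia.
by apply: unp_bits u _; lia.
Qed.

Lemma unp_agr a p j : a < p -> p <= e -> r p = tB -> unp c a j <-> unp r a j.
Proof.
move=> ap pe Bp; split=> u.
  have := unp_lt ap _ u; rewrite agr // => /(_ Bp) H; move: u => [H1 H2].
  by split=> [i ij|]; rewrite -agr; [apply: H1 | lia | | lia].
have := unp_lt ap Bp u => H; move: u => [H1 H2].
by split=> [i ij|]; rewrite agr; [apply: H1 | lia | | lia].
Qed.

Variables (k h y' y p : nat) (d : bool).
Hypothesis sk : spb (r k).
Hypothesis kh : k < h.
Hypothesis nhd1 : forall j, k < j < h -> ~~ hdb (r j).
Hypothesis hd_h : r h = br d.
Hypothesis hy' : h <= y'.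
Hypothesis nhd2 : forall j, h < j <= e -> ~~ hdb (r j).
Hypothesis sy' : spb (r y').
Hypothesis nxy : nx r y' y.
Hypothesis Cy : r y = tC.
Hypothesis yp : inC r y p.
Hypothesis pe : p + m = e.

Lemma yp_lt : y < p /\ p <= e. Proof. by case: yp => ? _ _; lia. Qed.
Lemma y'y : y' < y. Proof. by case: nxy. Qed.

Lemma let_agr a s j : a <= y -> letis c a s j <-> letis r a s j.
Proof.
move=> ay; have [A B] := yp_lt; have Bp : r p = tB by case: yp.
have Bc : c p = tB by rewrite agr.
have H : a < p by lia.
split=> -[C U V]; have L := unp_lt H _ U.
  split; rewrite -?agr //; [lia|exact/(unp_agr _ H B Bp)|].
  by apply/(unp_agr _ (L Bc) B Bp).
split; rewrite ?agr //; [lia|exact/(unp_agr _ H B Bp)|].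
by apply/(unp_agr _ (L Bp) B Bp).
Qed.

Lemma sym_agr s : symis c y s <-> symis r y s.
Proof.
have [A B] := yp_lt; have Bp : r p = tB by case: yp.
by rewrite /symis agr ?(unp_agr _ A B Bp) //; lia.
Qed.

Lemma head_agr s : headis c y s <-> headis r y s.
Proof.
have [A B] := yp_lt; have Bp : r p = tB by case: yp.
have Bc : c p = tB by rewrite agr.
rewrite /headis agr; last lia.
split=> -[H [t [U V]]]; split=> //; exists t; have L := unp_lt A _ U.
  by split; [apply/(unp_agr _ A B Bp)|apply/(unp_agr _ (L Bc) B Bp)].
by split; [apply/(unp_agr _ A B Bp)|apply/(unp_agr _ (L Bp) B Bp)].
Qed.

Lemma nx_ye : nx c y e.+1.
Proof.
split; [have := yp_lt; lia| by rewrite chal|] => j jj.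
by rewrite agr; [apply: (nosp_block blk yp); lia | lia].
Qed.

Lemma yE y1 z1 : c y1 = tC -> nx c y1 z1 -> c z1 = tX -> y1 = y.
Proof.
move=> C1 N1 X1; move: N1; rewrite (c_X X1) => N1; apply: (nx_inj _ _ N1 nx_ye).
  by rewrite C1.
by rewrite agr ?Cy //; have := yp_lt; lia.
Qed.

Lemma ev_Y a : ev ss k (pY a) <-> ev ss y a.
Proof.
rewrite (ev_pY ssT ssA); split=> [[y1 [z1 [_ C1 N1 X1 H]]]|H].
  by rewrite -(yE C1 N1 X1).
exists y, e.+1; split=> //; [have := y'y; lia| |exact: nx_ye].
by rewrite agr //; have := yp_lt; lia.
Qed.

Lemma y'E x y1 z1 : k <= x -> nx c x y1 -> c y1 = tC -> nx c y1 z1 -> c z1 = tX ->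
  spb (c x) -> x = y'.
Proof.
move=> kx N0 C1 N1 X1 sx; move: N0; rewrite (yE C1 N1 X1) => N0.
apply: nx_inj sx _ N0 _; first by rewrite agr //; have := y'y; have := yp_lt; lia.
by apply/nx_agr => //; have := yp_lt; lia.
Qed.

Lemma spy'_le : spb (c y').
Proof. by rewrite agr //; have := y'y; have := yp_lt; lia. Qed.

Lemma ev_Y' a : ev ss k (pY' a) <-> ev ss y' a.
Proof.
rewrite (ev_pY' ssT ssA); split=> [[x [y1 [z1 [[kx sx] N0 C1 N1 [X1 H]]]]]|H].
  by rewrite -(y'E kx N0 C1 N1 X1 sx).
have ? := y'y; have ? := yp_lt; exists y', y, e.+1; split=> //.
- by rewrite spy'_le; split=> //; lia.
- by apply/nx_agr => //; lia.
- by rewrite agr //; lia.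
- exact: nx_ye.
Qed.

Lemma ev_row : ev ss k (prow d).
Proof.
have ? := y'y; have ? := yp_lt; apply/ev_X/ev_until.
exists h; split=> //.
- rewrite (ev_and ss) (ev_pa ssA) agr; last lia.
  split=> //; apply/ev_X/ev_until; exists e.+1; split; [lia|by rewrite (ev_pa ssA)|].
  move=> j jj; rewrite ev_N (ev_hd ssA); apply/negP.
  by rewrite agr; [apply: nhd2; lia|lia].
- move=> j jj; rewrite ev_N (ev_hd ssA); apply/negP.
  by rewrite agr; [apply: nhd1; lia|lia].
Qed.

Lemma ev_same : ev ss k psame <-> (r k = tC <-> r y' = tC).
Proof.
have ? := y'y; have ? := yp_lt.
rewrite ev_or !ev_and !ev_N !ev_Y' ev_N !(ev_pa ssA) !agr; [|lia..].
by split; [tauto|case: (classic (r k = tC)); tauto].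
Qed.

Definition vv p1 := forall j, j < m -> (r (p1 + j.+1) = b1 <-> c (e.+1 + j.+1) = z1).

Lemma ev_v p1 : p1 + m <= e -> ev ss p1 (peqv m) <-> vv p1.
Proof.
move=> H; rewrite /peqv (ev_ands ssT) /vv.
have E j : j < m -> ev ss p1 (piff (pnext j.+1 (pa b1)) (pF (pand (pa tX) (pnext j.+1 (pa z1))))) <->
   (r (p1 + j.+1) = b1 <-> c (e.+1 + j.+1) = z1).
  move=> jm; rewrite ev_iff ev_next (ev_pa ssA) agr; last lia.
  rewrite (ev_F ssT).
  suff -> : (exists2 i, p1 <= i & ev ss i (pand (pa tX) (pnext j.+1 (pa z1)))) <->
    c (e.+1 + j.+1) = z1 by [].
  split=> [[i _]|H1].
    by rewrite ev_and ev_next !(ev_pa ssA) => -[/c_X ->].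
  by exists e.+1; [lia|rewrite ev_and ev_next !(ev_pa ssA)].
by split=> K j jm; apply/(E j jm)/K.
Qed.

Lemma ev_u p1 : p1 <= p -> ev ss p1 (pequ m) <-> veq m r p1 p.
Proof.
move=> H; have [_ Bp _] := yp; rewrite /pequ (ev_ands ssT) /veq.
have E j : j < m -> ev ss p1 (piff (pnext j.+1 (pa b1)) (pF (pand (plast m) (pnext j.+1 (pa b1))))) <->
   (r (p1 + j.+1) = b1 <-> r (p + j.+1) = b1).
  move=> jm; rewrite ev_iff ev_next (ev_pa ssA) agr; last lia.
  rewrite (ev_F ssT).
  suff -> : (exists2 i, p1 <= i & ev ss i (pand (plast m) (pnext j.+1 (pa b1)))) <->
    r (p + j.+1) = b1 by [].
  split=> [[i _]|H1].
    rewrite !ev_and !ev_next !(ev_pa ssA) => -[[_ /c_X Xi]].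
    have -> : i = p by lia.
    by rewrite agr; last lia.
  exists p => //; rewrite !ev_and !ev_next !(ev_pa ssA) (@agr p); last lia.
  rewrite (@agr (p + j.+1)); last lia.
  by rewrite -chal; split=> //; split=> //; congr (c _); lia.
by split=> K j jm; apply/(E j jm)/K.
Qed.

Lemma ev_has_agr (P : nat -> Prop) a a1 b : spb (c b) -> a < b -> b <= e ->
    (forall p1, p1 + m <= e -> p1 < b -> ev ss p1 a1 <-> P p1) ->
  ev ss a (phas a1) <-> exists2 p1, inC r a p1 & P p1.
Proof.
move=> sb ab be H; have sb' : spb (r b) by rewrite -agr.
rewrite (ev_phas ssA); split=> -[p1 i1 e1].
  have lt1 : p1 < b.
    case: i1 => ap Bp np; rewrite ltnNge; apply/negP => bp.
    by move: (np b); rewrite ab bp sb => /(_ isT).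
  have i2 : inC r a p1 by apply/inC_agr => //; lia.
  by exists p1 => //; apply/H => //; have := inC_le blk i2 sb' ab; lia.
have := inC_le blk i1 sb' ab => L.
by exists p1; [apply/inC_agr => //; lia|apply/H => //; lia].
Qed.

Definition mism := (exists2 p1, inC r y' p1 & vv p1) /\ ~ (exists2 p1, inC r k p1 & vv p1).

Lemma spCy : spb (c y). Proof. by rewrite agr ?Cy //; have := yp_lt; lia. Qed.

Lemma ev_mis : ev ss k (pmis m) <-> mism.
Proof.
have ? := y'y; have [? ?] := yp_lt; rewrite /pmis ev_and ev_N ev_Y'.
rewrite (@ev_has_agr vv y' _ y spCy) //; first last.
- by move=> p1 ? _; apply: ev_v.
- lia.
rewrite (@ev_has_agr vv k _ h) //; first by rewrite agr ?hd_h //; [case: (d)|lia].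
- by lia.
- by move=> p1 ? _; apply: ev_v.
Qed.

Definition uinx := exists x, [/\ nx r k x, r x = tC & exists2 p1, inC r x p1 & veq m r p1 p].

Lemma nx_k x : nx c k x -> x <= h.
Proof.
move=> [kx sx nx]; rewrite leqNgt; apply/negP => H; move: (nx h); rewrite kh H => /(_ isT).
by have ? := y'y; have ? := yp_lt; rewrite agr ?hd_h; [case: (d)|lia].
Qed.

Lemma ev_inx : ev ss k (pinx m) <-> uinx.
Proof.
have ? := y'y; have [? ?] := yp_lt.
have K x : x < h -> ev ss x (phas (pequ m)) <-> exists2 p1, inC r x p1 & veq m r p1 p.
  move=> xh; apply: (@ev_has_agr _ x _ h) => //; [|lia|].
  - by rewrite agr ?hd_h; [case: (d)|lia].
  - by move=> p1 _ ph; apply: ev_u; lia.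
have hC x : x <= h -> r x = tC -> x < h.
  by rewrite leq_eqVlt => /orP[/eqP ->|//]; rewrite hd_h; case: (d).
rewrite (ev_pnx ssA); split=> [[x nkx]|[x [nkx Cx H]]].
  have xh := nx_k nkx.
  rewrite ev_and (ev_pa ssA) agr; last lia.
  move=> [Cx /K H]; exists x; split=> //; last by apply: H; apply: hC.
  by apply/nx_agr => //; lia.
have nkx' : nx c k x.
  apply/nx_agr => //; case: nkx => kx sx nnx.
  suff : x <= h by lia.
  rewrite leqNgt; apply/negP => hx; move: (nnx h); rewrite kh hx hd_h => /(_ isT).
  by case: (d).
have xh := nx_k nkx'; exists x => //.
rewrite ev_and (ev_pa ssA) agr; last lia.
by split=> //; apply/K => //; apply: hC.
Qed.

Lemma nx_le r' a b z : nx r' a b -> a < z -> spb (r' z) -> b <= z.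
Proof.
move=> [ab sb nb] az sz; rewrite leqNgt; apply/negP => zb.
by move: (nb z); rewrite az zb sz => /(_ isT).
Qed.

Lemma ev_symok : ev ss k (psymok M d) <-> symok M r d k y.
Proof.
have ? := y'y; have [? ?] := yp_lt.
have shc : spb (c h) by rewrite agr ?hd_h; [case: (d)|lia].
have shr : spb (r h) by rewrite hd_h; case: (d).
have E s j t : ev ss k (pand (pnx (plet s j)) (pY (psym t))) <->
   exists x, [/\ nx r k x, letis r x s j & symis r y t].
  rewrite ev_and ev_Y (ev_sym ssT ssA) sym_agr (ev_pnx ssA); split.
    move=> [[x nkx]]; rewrite (ev_let ssT ssA) => lx sy; exists x.
    have ? := nx_le nkx kh shc.
    by split=> //; [apply/nx_agr => //; lia| apply/let_agr => //; lia].
  move=> [x [nkx lx sy]]; have ? := nx_le nkx kh shr.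
  split=> //; exists x; first by apply/nx_agr => //; lia.
  by rewrite (ev_let ssT ssA) let_agr //; lia.
rewrite /psymok /symok ev_or !(ev_ors ssT); split.
  move=> [[s /E [x H]]|[q]]; first by left; exists s, x.
  by rewrite (ev_ors ssT) => -[s /E [x H]]; right; exists q, s, x.
move=> [[s [x H]]|[q [s [x H]]]]; first by left; exists s; apply/E; exists x.
by right; exists q; rewrite (ev_ors ssT); exists s; apply/E; exists x.
Qed.

Lemma ev_headok : ev ss k (pheadok M d) <-> headok M r d k y.
Proof.
have ? := y'y; have [? ?] := yp_lt.
have shc : spb (c h) by rewrite agr ?hd_h; [case: (d)|lia].
have shr : spb (r h) by rewrite hd_h; case: (d).
have syc : spb (c y) by exact: spCy.
have syr : spb (r y) by rewrite Cy.
have E q s : ev ss k (@phentry M d q s) <->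
   (if (tri d q s).2 is R then letis r k (rk s) (rk q).+1
      else exists x x', [/\ nx r k x, nx r x x' & letis r x' (rk s) (rk q).+1])
     /\ headis r y (rk (tri d q s).1.1).+1.
  rewrite /phentry ev_and ev_Y (ev_head ssT ssA) head_agr; case: (tri d q s).2; last first.
    by rewrite (ev_let ssT ssA) let_agr //; lia.
  suff -> : ev ss k (pnx (pnx (plet (rk s) (rk q).+1))) <->
     exists x x', [/\ nx r k x, nx r x x' & letis r x' (rk s) (rk q).+1] by [].
  rewrite (ev_pnx ssA); split.
    move=> [x nkx]; rewrite (ev_pnx ssA) => -[x' nxx']; rewrite (ev_let ssT ssA) => lx.
    have ? := nx_le nkx kh shc; have ? := @nx_le c x x' y nxx' ltac:(lia) syc.
    exists x, x'; split; [apply/nx_agr => //; lia|apply/nx_agr => //; lia|].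
    by apply/let_agr => //; lia.
  move=> [x [x' [nkx nxx' lx]]].
  have ? := nx_le nkx kh shr; have ? := @nx_le r x x' y nxx' ltac:(lia) syr.
  exists x; first by apply/nx_agr => //; lia.
  rewrite (ev_pnx ssA); exists x'; first by apply/nx_agr => //; lia.
  by rewrite (ev_let ssT ssA) let_agr.
rewrite /pheadok /headok ev_or ev_Y (ev_head ssT ssA) head_agr (ev_ors ssT); split.
  move=> [H|[q]]; first by left.
  by rewrite (ev_ors ssT) => -[s /E H]; right; exists q, s.
move=> [H|[q [s H]]]; first by left.
by right; exists q; rewrite (ev_ors ssT); exists s; apply/E.
Qed.

(** The guard [prow d] holds by the assumptions of the section; only [psame] survives, as the
    premise. *)
Lemma ev_body : ev ss k (pbody M m d) <->
  ((r k = tC <-> r y' = tC) -> mism \/ [/\ uinx, symok M r d k y & headok M r d k y]).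
Proof.
rewrite ev_imp ev_and ev_same ev_or ev_mis ev_and ev_inx ev_and ev_symok ev_headok.
have := ev_row; split.
  move=> A B; case: A => //; first by left.
  by move=> [? [? ?]]; right.
move=> A [_ B]; case: (A B); first by left.
by move=> [? ? ?]; right.
Qed.

End Divert.

(** * Branches of a strategy tree *)

(** Nodes of a strategy tree do not record the root state, hence the shift by one. *)
Definition pre (r : nat -> tok) (i : nat) : seq tok := mkseq (fun j => r j.+1) i.
Arguments pre : simpl never.

Lemma preS r i : pre r i.+1 = rcons (pre r i) (r i.+1).
Proof. exact: mkseqS. Qed.

Lemma last_pre r i : r 0 = tL -> last tL (pre r i) = r i.
Proof. by case: i => [->|i _] //; rewrite preS last_rcons. Qed.

Lemma eq_pre r r' i : (forall j, j <= i -> r j = r' j) -> pre r i = pre r' i.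
Proof.
move=> H; apply/eq_in_map => j; rewrite mem_iota => /andP[_ ji]; apply: H; lia.
Qed.

Lemma pre_eq r r' i j : r 0 = r' 0 -> pre r i = pre r' i -> j <= i -> r j = r' j.
Proof.
move=> H0 H; case: j => // j ji.
have := congr1 (fun s => nth tL s j) H.
by rewrite !nth_mkseq.
Qed.

Lemma size_pre r i : size (pre r i) = i. Proof. exact: size_mkseq. Qed.

Section Tree.
Variable T : strategy_tree tok_ocgs.
Notation GT := (tree_cgs T).

Definition branch (r : nat -> tok) : Prop :=
  r 0 = tL /\ forall i, node T (pre r i).

Definition tn (r : nat -> tok) (H : branch r) (i : nat) : tnode T :=
  exist _ (pre r i) (H.2 i).

Definition ssb (r : nat -> tok) (H : branch r) (k : nat) (f : sf) : Prop :=
  sat GT (tn H k) f.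

Lemma ssbT r (H : branch r) k : ssb H k STrue. Proof. by []. Qed.

Lemma ssbA r (H : branch r) k t : ssb H k (SAtom t) <-> r k = t.
Proof.
rewrite /ssb /= /tree_lab /= inE (last_pre _ H.1).
by split=> [/eqP|->].
Qed.

Lemma ev_psat r (H : branch r) a k :
  ev (ssb H) k a <-> psat GT (fun i => tn H (k + i)) a.
Proof.
elim: a k => [f|a IH|a IHa b IHb|a IH|a IHa b IHb] k.
- by rewrite /= addn0.
- by rewrite /= IH.
- by rewrite /= IHa IHb.
- rewrite /= IH; suff -> : (fun i => tn H (k.+1 + i)) = (fun i => tn H (k + i.+1)) by [].
  by apply: functional_extensionality => i; rewrite addSnnS.
have E i : (fun j => tn H (k + (i + j))) = (fun j => tn H (k + i + j)).
  by apply: functional_extensionality => j; rewrite addnA.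
split=> -[i [bi ai]]; exists i.
  by split=> [|j ji]; rewrite E; [apply/IHb | apply/IHa/ai].
by split=> [|j ji]; [apply/IHb; rewrite -E | apply/IHa; rewrite -E; apply: ai].
Qed.

Lemma tree_trans_act (x : tnode T) s : node T (rcons (val x) s) ->
  exists2 y, val y = rcons (val x) s &
    trans GT x (act (last tL (val x)) s) = Some y.
Proof.
move=> ns; have [_ su] := node_rcons ns.
move: su; rewrite tok_succE => /eqP zs.
exists (exist (fun v => node T v) _ ns) => //.
by rewrite /= /tree_trans /= tok_trans_act // insubT; congr Some; apply: val_inj.
Qed.

Lemma tree_transE (x y : tnode T) d : trans GT x d = Some y ->
  exists s, [/\ tok_trans (last tL (val x)) d = Some s, val y = rcons (val x) s &
    sysst (last tL (val x)) = zbit s].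
Proof.
rewrite /= /tree_trans /=; case E: (tok_trans _ d) => [s|] //.
case: insubP => // u _ vu [<-]; exists s; split=> //.
by have [] := tok_transE E.
Qed.

Lemma branch_succ r (H : branch r) k : sysst (r k) = zbit (r k.+1).
Proof.
have := H.2 k.+1; rewrite preS => /node_rcons[_].
by rewrite last_pre ?H.1 // tok_succE => /eqP.
Qed.

Lemma path_branch r (H : branch r) k (pi : nat -> tnode T) :
    pi 0 = tn H k ->
    (forall i, exists d, trans GT (pi i) d = Some (pi i.+1)) ->
  exists r' (H' : branch r'), (forall i, i <= k -> r' i = r i) /\
    forall i, pi i = tn H' (k + i).
Proof.
move=> p0 step.
pose r' i := if i <= k then r i else last tL (val (pi (i - k))).
have r0 : r' 0 = tL by rewrite /r' leq0n H.1.
have P i : val (pi i) = pre r' (k + i).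
  elim: i => [|i IH].
    by rewrite p0 addn0 /=; apply: eq_pre => j jk; rewrite /r' jk.
  have [d /tree_transE[s [_ E _]]] := step i.
  rewrite addnS preS -IH E; congr rcons.
  rewrite /r' leqNgt ltnS leq_addr /= subSn ?leq_addr // addKn E.
  by rewrite last_rcons.
have H' : branch r'.
  split=> // i; case: (leqP i k) => ik.
    rewrite (_ : pre r' i = pre r i) ?H.2 //; apply: eq_pre => j ji.
    by rewrite /r' (leq_trans ji ik).
  by have := valP (pi (i - k)); rewrite P subnKC ?(ltnW ik).
exists r', H'; split=> [i ik|i]; first by rewrite /r' ik.
by apply: val_inj; rewrite P.
Qed.

Lemma tree_total (x : tnode T) : exists s, node T (rcons (val x) s).
Proof.
have [d] := trans_total GT x; case E: (trans GT x d) => [y|] // _.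
by have [s [_ Ey _]] := tree_transE E; exists s; rewrite -Ey (valP y).
Qed.

(** Dependent choice, by iterating a chosen child. It serves to build unchallenged branches and, in
    contrapositive form, to prove well-foundedness. *)
Lemma extend (P : tnode T -> Prop) (x : tnode T) : P x ->
    (forall y, P y -> exists2 z, P z & exists s, val z = rcons (val y) s) ->
  exists r (H : branch r), pre r (size (val x)) = val x /\
    forall i, size (val x) <= i -> P (tn H i).
Proof.
move=> Px step.
have step' y : exists z, P y -> P z /\ exists s, val z = rcons (val y) s.
  case: (classic (P y)) => [/step[z Pz zs]|nP]; first by exists z.
  by exists y.
pose nxt y := proj1_sig (constructive_indefinite_description _ (step' y)).
have nxtP y : P y -> P (nxt y) /\ exists s, val (nxt y) = rcons (val y) s.
  exact: proj2_sig (constructive_indefinite_description _ (step' y)).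
pose pi i := iter i nxt x.
have piP i : P (pi i) by elim: i => // i IH; have [] := nxtP _ IH.
have piS i : exists s, val (pi i.+1) = rcons (val (pi i)) s by have [] := nxtP _ (piP i).
have sz i : size (val (pi i)) = size (val x) + i.
  elim: i => [|i IH]; first by rewrite addn0.
  by have [s ->] := piS i; rewrite size_rcons IH addnS.
pose r i := if i is j.+1 then
    if j < size (val x) then nth tL (val x) j else last tL (val (pi (i - size (val x))))
  else tL.
have px : pre r (size (val x)) = val x.
  apply: (@eq_from_nth _ tL); rewrite size_pre // => i ix.
  by rewrite nth_mkseq //= ix.
have P' i : val (pi i) = pre r (size (val x) + i).
  elim: i => [|i IH]; first by rewrite addn0 px.
  have [s E] := piS i; rewrite addnS preS -IH E; congr rcons => /=.
  rewrite ltnNge leq_addr /= -addnS addKn.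
  by rewrite E last_rcons.
have H : branch r.
  split=> // i; case: (leqP i (size (val x))) => ik; last first.
    by have := valP (pi (i - size (val x))); rewrite P' subnKC ?(ltnW ik).
  have := valP x; rewrite -{1}px -(subnKC ik); elim: (size (val x) - i) => [|n IH].
    by rewrite addn0.
  by rewrite addnS preS => /node_rcons[/IH].
exists r, H; split=> // i ki; rewrite (_ : tn H i = pi (i - size (val x))) //.
by apply: val_inj; rewrite P' subnKC.
Qed.

(** The empty coalition has a single decision, which every joint action extends: its strategy
    restricts nothing. *)
Lemma all_paths r (H : branch r) k a :
  sat GT (tn H k) (SCoal set0 a) <->
  forall r' (H' : branch r'), (forall i, i <= k -> r' i = r i) -> ev (ssb H') k a.
Proof.
split=> [[f [fS fO]] r' H' rr'|all].
  apply/ev_psat/fO; split=> [|i].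
    by apply: val_inj; rewrite addn0 /=; apply: eq_pre => j /rr'.
  have := H'.2 (k + i).+1; rewrite preS => ni.
  have [y Ey Ty] := @tree_trans_act (tn H' (k + i)) _ ni.
  exists (act (last tL (pre r' (k + i))) (r' (k + i).+1)); split.
    by apply/forallP => -[b bP]; exfalso; rewrite inE in bP.
  by rewrite Ty; congr Some; apply: val_inj; rewrite Ey addnS /= preS.
exists (fun=> dec set0 b0); split.
  move=> s v _; have [d Hd] := trans_total GT (last s v).
  apply/existsP; exists d; rewrite Hd andbT.
  by apply/forallP => -[b bP]; exfalso; rewrite inE in bP.
move=> pi [p0 step].
have [|r' [H' [rr' E]]] := @path_branch r H k pi p0.
  by move=> i; have [d [_ Hd]] := step i; exists d.
rewrite (_ : pi = fun i => tn H' (k + i)); first by apply/ev_psat/all.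
exact: functional_extensionality.
Qed.

Lemma mem_sys : sys \in [set sys]. Proof. by rewrite inE. Qed.

Lemma extends_sys (d : {ffun agent -> tok}) (dA : decision tok [set sys]) :
  extends d dA = (d sys == dA (exist _ sys mem_sys)).
Proof.
apply/forallP/idP => [/(_ (exist _ sys mem_sys))//|H b].
rewrite (_ : b = exist _ sys mem_sys) //; apply: val_inj => /=.
by case: b => b /=; rewrite inE => /eqP.
Qed.

Lemma path_mkseq (pi : nat -> tnode T) i :
  (forall j, j < i -> exists d, trans GT (pi j) d = Some (pi j.+1)) ->
  path (succ GT) (pi 0) (mkseq (fun j => pi j.+1) i) /\
  last (pi 0) (mkseq (fun j => pi j.+1) i) = pi i.
Proof.
elim: i => [|i IH] H //.
have [|p l] := IH; first by move=> j ji; apply: H; lia.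
rewrite mkseqS rcons_path last_rcons p l; split=> //.
have [d Hd] := H i (ltnSn _).
by apply/existsP; exists d; rewrite Hd.
Qed.

(* If env follows the branch [r'] up to position [e] while sys has no choice,
   then some play continues it according to the strategy of sys. *)
Lemma sys_elim r (H : branch r) k a r' (H' : branch r') e :
    sat GT (tn H k) (SCoal [set sys] a) ->
    (forall i, i <= k -> r' i = r i) -> k <= e ->
    (forall i, k <= i < e -> ~~ sysst (r' i)) ->
  exists c (Hc : branch c), (forall i, i <= e -> c i = r' i) /\ ev (ssb Hc) k a.
Proof.
move=> [f [fS fO]] rr' ke nsys.
(* The strategy reads whole histories, so the next node is chosen as a function of the history; on
   sequences that are not histories from [tn H k] any value will do. *)
pose good (h : seq (tnode T)) := exists pi : nat -> tnode T, exists i,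
  h = mkseq pi i.+1 /\ pi 0 = tn H k /\
  forall j, j < i -> exists d, trans GT (pi j) d = Some (pi j.+1).
pose fv h := f h (exist _ sys mem_sys).
have avail pi i : pi 0 = tn H k ->
  (forall j, j < i -> exists d, trans GT (pi j) d = Some (pi j.+1)) ->
  exists y, exists2 d, trans GT (pi i) d = Some y & d sys = fv (mkseq pi i.+1).
  move=> p0 st; have [pp pl] := path_mkseq st.
  have := fS _ _ pp; rewrite pl => /existsP[d /andP[]].
  rewrite extends_sys => /eqP dE; case E: (trans _ _ _) => [y|] // _.
  exists y, d => //; rewrite dE /fv; congr (f _ _).
  rewrite /mkseq /= -[RHS]/(pi 0 :: map pi (iota 1 i)) -[iota 1 i]/(iota (1 + 0) i) iotaDl.
  by rewrite -map_comp.
pose pi0 := tn H k.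
have choice (h : seq (tnode T)) : exists y, forall pi i, h = mkseq pi i.+1 -> pi 0 = tn H k ->
   (forall j, j < i -> exists d, trans GT (pi j) d = Some (pi j.+1)) ->
   (exists2 d, trans GT (pi i) d = Some y & d sys = fv h) /\
   (i < e - k -> pi i = tn H' (k + i) -> y = tn H' (k + i.+1)).
  case: (classic (good h)) => [[pi [i [hE [p0 st]]]]|ng]; last first.
    by exists pi0 => pi i hE p0 st; case: ng; exists pi, i.
  have uniq pi' i' : h = mkseq pi' i'.+1 -> i' = i /\ forall j, j <= i -> pi' j = pi j.
    rewrite hE => E; have := congr1 size E; rewrite !size_mkseq => -[Ei]; split=> // j ji.
    have := congr1 (fun s => nth pi0 s j) E; rewrite !nth_mkseq //; lia.
  have [y [d Hd dE]] := avail pi i p0 st.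
  case: (classic (i < e - k /\ pi i = tn H' (k + i))) => [[ie pE]|nE]; last first.
    exists y => pi' i' hE' _ _; have [Ei Ej] := uniq _ _ hE'.
    rewrite Ei !Ej // -hE in dE *; split; first by exists d.
    by move=> A B; case: nE.
  (* It is the turn of env: the action prescribed to sys can only be [b0], and env alone decides to
     stay on [r']. *)
  have ns : ~~ sysst (r' (k + i)) by apply: nsys; lia.
  exists (tn H' (k + i.+1)) => pi' i' hE' _ _; have [Ei Ej] := uniq _ _ hE'.
  rewrite Ei !Ej // pE; split=> //.
  have := H'.2 (k + i).+1; rewrite preS => ni.
  have [z Ez Tz] := @tree_trans_act (tn H' (k + i)) _ ni.
  rewrite -hE in dE.
  exists (act (last tL (pre r' (k + i))) (r' (k + i).+1)).
    by rewrite Tz; congr Some; apply: val_inj; rewrite Ez addnS /= preS.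
  rewrite -dE last_pre ?H'.1 // ffunE /= (negbTE ns).
  have [s [tE _ _]] := tree_transE Hd; have [_] := tok_transE tE.
  by rewrite pE /= last_pre ?H'.1 // (negbTE ns) => -[].
pose nxt h := proj1_sig (constructive_indefinite_description _ (choice h)).
have nxtP h := proj2_sig (constructive_indefinite_description _ (choice h)).
pose hist i := iter i (fun h => rcons h (nxt h)) [:: tn H k].
pose pi i := last pi0 (hist i).
have histE i : hist i = mkseq pi i.+1.
  elim: i => [|i IH] //; rewrite mkseqS -IH /hist /=; congr rcons.
  by rewrite /pi /= last_rcons.
have piS i : pi i.+1 = nxt (mkseq pi i.+1) by rewrite /pi /= last_rcons -histE.
have p0 : pi 0 = tn H k by [].
have st i : forall j, j < i -> exists d, trans GT (pi j) d = Some (pi j.+1).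
  elim: i => // i IH j; rewrite ltnS leq_eqVlt => /orP[/eqP ->|/IH//].
  have [[d Hd _] _] := nxtP _ pi i erefl p0 IH.
  by exists d; rewrite piS.
have out : outcome GT f (tn H k) pi.
  split=> // i; have [[d Hd dE] _] := nxtP _ pi i erefl p0 (st i).
  by exists d; rewrite extends_sys dE eqxx piS.
have fol i : i <= e - k -> pi i = tn H' (k + i).
  elim: i => [_|i IH ie].
    by rewrite p0; apply: val_inj; rewrite addn0 /=; apply: eq_pre => j /rr'.
  have [_ E] := nxtP _ pi i erefl p0 (st i); rewrite piS; apply: E; first by lia.
  by apply: IH; lia.
have [|c [Hc [cr cE]]] := @path_branch r H k pi p0; first by move=> i; apply: (st i.+1).
exists c, Hc; split; last first.
  apply/ev_psat; rewrite (_ : (fun i => _) = pi); first exact: fO.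
  by apply: functional_extensionality => i; rewrite cE.
move=> i ie; case: (leqP i k) => ik; first by rewrite cr // rr'.
have := fol (i - k); rewrite leq_sub2r // => /(_ isT); rewrite cE => /(congr1 val) /=.
rewrite subnKC ?(ltnW ik) // => E.
by apply: pre_eq E _; rewrite ?H'.1 ?Hc.1.
Qed.

(* After the challenge [tX] ending the node [v], sys outputs the bits [V v]. *)
Lemma sys_intro r (H : branch r) k a (V : seq tok -> nat -> bool) :
    ~~ sysst (r k) ->
    (forall c (Hc : branch c), (forall i, i <= k -> c i = r i) ->
      (forall e j, c e = tX -> k < e -> (forall i, i < e -> c i != tX) ->
         c (e + j.+1) = if V (pre c e) j then z1 else z0) ->
      ev (ssb Hc) k a) ->
  sat GT (tn H k) (SCoal [set sys] a).
Proof.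
move=> nsk all.
(* A first challenge at position [e] has index [e - 1] in the node, as the root is not recorded:
   [take] recovers [pre c e], and the subtraction counts the bits already output. *)
pose move_at (v : seq tok) : tok := if sysst (last tL v) then
   if V (take (index tX v).+1 v) (size v - (index tX v).+1) then z1 else z0 else b0.
exists (fun h => dec [set sys] (move_at (val (last (tn H k) h)))); split.
  move=> s v _; rewrite last_cons; set x := last s v.
  have ex : exists2 t, node T (rcons (val x) t) & sysst (last tL (val x)) -> t = move_at (val x).
    case E: (sysst (last tL (val x))); last by have [t Ht] := tree_total x; exists t.
    exists (move_at (val x)) => //; apply: (node_sys (valP x)); first by rewrite tok_passive_env.
    by rewrite tok_succE E /move_at E; case: ifP.
  have [t nt tE] := ex; have [y _ Ty] := tree_trans_act nt.
  apply/existsP; exists (act (last tL (val x)) t); rewrite Ty andbT extends_sys !ffunE /=.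
  case E: (sysst _) => /=; first by rewrite tE.
  by rewrite /move_at E.
move=> pi [p0 step].
have [|c [Hc [cr cE]]] := @path_branch r H k pi p0.
  by move=> i; have [d [_ Hd]] := step i; exists d.
rewrite (_ : pi = fun i => tn Hc (k + i)); last exact: functional_extensionality.
apply/ev_psat/all => // e j Xe ke first.
have S i : e <= i -> sysst (c i).
  move=> ei; rewrite -(subnKC ei); elim: (i - e) => [|n IH]; first by rewrite addn0 Xe.
  by rewrite addnS; move: IH; rewrite (branch_succ Hc); case: (c _.+1).
have [d [ext tr]] := step (e + j - k).
have [s [tE vE _]] := tree_transE tr; have [_] := tok_transE tE.
move: vE tE; rewrite !cE /=.
have -> : k + (e + j - k).+1 = (e + j).+1 by lia.
have -> : k + (e + j - k) = e + j by lia.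
rewrite preS => /rcons_inj[Es] tE; rewrite last_pre ?Hc.1 // S ?leq_addr // => -[_ ds].
rewrite addnS Es -ds; move: ext; rewrite extends_sys !ffunE => /eqP ->.
rewrite mkseqS last_rcons cE /=.
have -> : k + (e + j - k) = e + j by lia.
rewrite /move_at last_pre ?Hc.1 // S ?leq_addr // size_pre.
have e0 : 0 < e by lia.
have iX : index tX (pre c (e + j)) = e.-1.
  have sz : e.-1 < size (pre c (e + j)) by rewrite size_pre; lia.
  have nX : nth tL (pre c (e + j)) e.-1 = tX by rewrite nth_mkseq ?prednK //; lia.
  apply/eqP; rewrite eqn_leq; apply/andP; split.
    rewrite leqNgt; apply/negP => /(before_find tL); rewrite nX.
    by [].
  have hX : tX \in pre c (e + j) by rewrite -nX mem_nth.
  rewrite leqNgt; apply/negP => L; have := nth_index tL hX.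
  rewrite nth_mkseq; last by rewrite -index_mem size_pre in hX.
  by apply/eqP; apply: first; lia.
rewrite iX prednK //.
have -> : take e (pre c (e + j)) = pre c e.
  by rewrite /pre /mkseq -map_take take_iota; congr (map _ (iota _ _)); lia.
by have -> : e + j - e = j by lia.
Qed.

Lemma sat_pEX r (H : branch r) k t :
  ev (ssb H) k (pEX t) <-> exists r' (H' : branch r'), (forall i, i <= k -> r' i = r i) /\ r' k.+1 = t.
Proof.
rewrite -[ev _ _ _]/(~ sat GT (tn H k) (SCoal set0 (PNext (PNot (pa t))))); split=> [nall|[r' [H' [rr' E]]]].
  apply: NNPP => nex; apply: nall; apply/(all_paths H k) => r' H' rr'.
  rewrite ev_X ev_N (ev_pa (ssbA H')) => E; apply: nex; exists r', H'; split=> //.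
move/(all_paths H k)/(_ r' H' rr').
by rewrite ev_X ev_N (ev_pa (ssbA H')).
Qed.

Lemma sat_pEXnX r (H : branch r) k :
  ev (ssb H) k pEXnX <-> exists r' (H' : branch r'), (forall i, i <= k -> r' i = r i) /\ r' k.+1 <> tX.
Proof.
rewrite -[ev _ _ _]/(~ sat GT (tn H k) (SCoal set0 (PNext (pa tX)))); split=> [nall|[r' [H' [rr' E]]]].
  apply: NNPP => nex; apply: nall; apply/(all_paths H k) => r' H' rr'.
  rewrite ev_X (ev_pa (ssbA H')); apply: NNPP => E; apply: nex; exists r', H'; split=> //.
move/(all_paths H k)/(_ r' H' rr').
by rewrite ev_X (ev_pa (ssbA H')).
Qed.

End Tree.

(** * Rows of tape letters *)

Section Rows.
Variable M : ATM.
Implicit Types (C : config M) (q : st M) (s : sym M).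

Definition letter : Type := (sym M * option (st M))%type.
Implicit Types (l : letter) (rw : seq letter).

Definition succb (b : bool) C : config M :=
  apply_triple C (tri b (cstate C) (csym C)).

(* The local rule relating three adjacent letters of a row, or fewer at its
   ends, to the middle letter of the next row; the head may get lost. *)
Definition cont (d : bool) (a : option letter) (x : letter) (c : option letter) (y : letter) : Prop :=
  y.1 = (if x.2 is Some q then (tri d q x.1).1.2 else x.1) /\
  (y.2 = None \/ exists q s, (if (tri d q s).2 is R then a else c) = Some (s, Some q)
                             /\ y.2 = Some (tri d q s).1.1).

Fixpoint stepg (d : bool) (a : option letter) rw rw' : Prop :=
  match rw', rw with
  | [::], _ => True
  | _ :: _, [::] => False
  | y :: rw1', x :: rw1 => cont d a x (ohead rw1) y /\ stepg d (Some x) rw1 rw1'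
  end.

Definition l0 : letter := (blank M, None).

(* The symbol at position [i] of a row in which the head of [C] is at position [h]. *)
Definition tp C (h i : nat) : sym M :=
  if i < h then nth (blank M) (rev C.1.1) (h - i).-1
  else if i == h then csym C else nth (blank M) C.2 (i - h).-1.

Definition rowl C (h i : nat) : letter :=
  (tp C h i, if i == h then Some (cstate C) else None).

(** A row is a window on the tape whose origin does not move with the head; around the word of [C]
    it shows blanks. *)
Definition represents rw C : Prop :=
  exists2 h, h < size rw & forall i, i < size rw -> nth l0 rw i = rowl C h i.

Definition nohead rw : Prop := forall i, i < size rw -> (nth l0 rw i).2 = None.

Definition lnth rw i : option letter := if i < size rw then Some (nth l0 rw i) else None.

Lemma stepgP d a rw rw' : stepg d a rw rw' <->
  size rw' <= size rw /\
  forall i, i < size rw' -> cont d (if i is j.+1 then lnth rw j else a) (nth l0 rw i)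
                               (lnth rw i.+1) (nth l0 rw' i).
Proof.
elim: rw' a rw => [|y rw' IH] a [|x rw] //=; [by split..| |].
  by split=> // -[].
rewrite IH; split=> [[cx [sz H]]|[sz H]].
  split=> //; case=> [|i] ii /=.
    by case: (rw) cx.
  by case: i ii => [|i] ii; exact: H.
split; first by have := H 0 isT; case: (rw).
by split=> // -[|i] ii; [exact: (H 1 ii) | exact: (H i.+2 ii)].
Qed.

Lemma nth_rev_take (T : Type) (x : T) (e : seq T) i :
  nth x (rev (take (size e).-1 e)) i = nth x (rev e) i.+1.
Proof.
case/lastP: e => [|e y]; first by rewrite !nth_nil.
by rewrite size_rcons /= rev_rcons /= -cats1 take_size_cat.
Qed.

(** Positions are absolute: a step shifts the index of the head and changes one symbol. The
    condition [0 < h] keeps [h.-1] from being truncated. *)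
Lemma tp_succ C d h i (t := tri d (cstate C) (csym C)) (C' := succb d C) :
  (if t.2 is R then true else 0 < h) ->
  tp C' (if t.2 is R then h.+1 else h.-1) i = if i == h then t.1.2 else tp C h i.
Proof.
rewrite /C' /succb -/t /tp; case: C @t @C' => [[eta [q s]] eta'] t C'.
case: t => [[q' s'] [|]] /=; last first.
  move=> _; rewrite rev_rcons ltnS; case: (ltngtP i h) => ih.
  - rewrite subSn ?(ltnW ih) //=.
    by have -> : h - i = (h - i).-1.+1 by lia.
  - case: eqP => [->|ni]; first by rewrite /csym /= subSnn /= nth0.
    rewrite nth_behead; congr (nth _ _ _); lia.
  - by rewrite ih subSnn.
move=> h0; case: (ltngtP i h) => ih.
- case: ltngtP => ih'; [|lia|].
    by rewrite nth_rev_take; congr (nth _ _ _); lia.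
  rewrite ih' /csym /=; have -> : (h - h.-1).-1 = 0 by lia.
  by rewrite nth0; case/lastP: (eta) => [|e y] //; rewrite last_rcons rev_rcons.
- have -> : (i < h.-1) = false by lia.
  have -> : (i == h.-1) = false by lia.
  by have -> : (i - h.-1).-1 = (i - h).-1.+1 by lia.
- rewrite ih; have -> : (h < h.-1) = false by lia.
  have -> : (h == h.-1) = false by lia.
  by have -> : (h - h.-1).-1 = 0 by lia.
Qed.

Lemma cstate_succb C d : cstate (succb d C) = (tri d (cstate C) (csym C)).1.1.
Proof. by rewrite /succb; case: (tri _ _ _) => [[q s] [|]]; case: C => [[eta [q1 s1]] eta']. Qed.

(** The head of [rw] is unique, so at most one cell of [rw'] can receive it. The second case covers
    a head that leaves the row, falls beyond a shorter row, or is simply omitted. *)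
Lemma rel_step d rw rw' C : represents rw C -> stepg d None rw rw' ->
  represents rw' (succb d C) \/ nohead rw'.
Proof.
move=> [h hs E] /stepgP[sz H].
pose t := tri d (cstate C) (csym C).
have Hs i : i < size rw' -> (nth l0 rw' i).1 = if i == h then t.1.2 else tp C h i.
  move=> ii; have [-> _] := H i ii; rewrite E; last lia.
  by rewrite /rowl; case: eqP => //= ->; rewrite /tp ltnn eqxx.
have EL j q s : lnth rw j = Some (s, Some q) -> [/\ j = h, q = cstate C & s = csym C].
  rewrite /lnth; case: ifP => // js; rewrite E // /rowl; case: eqP => [-> [<- <-]|_ [_]] //.
  by rewrite /tp ltnn eqxx.
have Hh i : i < size rw' -> (nth l0 rw' i).2 = None \/
    [/\ (if t.2 is R then i = h.+1 else i.+1 = h) & (nth l0 rw' i).2 = Some t.1.1].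
  move=> ii; have [_ []] := H i ii; first by left.
  move=> [q [s [A B]]]; right; rewrite B; case D: (tri d q s).2 A.
    by move/EL => [<- ? ?]; subst q s; rewrite /t D.
  by case: (i) => // j /EL[<- ? ?]; subst q s; rewrite /t D.
have [|nn] := boolP (all (fun l => l.2 == None) rw').
  by move/all_nthP => K; right => i ii; apply/eqP/K.
left; have /hasP[l lr ln] : has (fun l => l.2 != None) rw' by rewrite has_predC.
pose i := index l rw'; have ii : i < size rw' by rewrite index_mem.
have il : nth l0 rw' i = l by rewrite nth_index.
have [K|[K1 K2]] := Hh i ii; first by rewrite -il K in ln.
have Ei : i = if t.2 is R then h.+1 else h.-1 by case: (t.2) K1 => //; lia.
exists i => // j jj; rewrite [nth _ _ _]surjective_pairing Hs // /rowl.
rewrite {1}Ei tp_succ; last by rewrite -/t; case: (t.2) K1 => //; lia.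
rewrite -/t cstate_succb -/t; congr pair; case: eqP => [->//|ji].
have [//|[L1 _]] := Hh j jj; case: ji; rewrite Ei.
by case: (t.2) L1 => //; lia.
Qed.

Lemma nohead_step d rw rw' : nohead rw -> stepg d None rw rw' -> nohead rw'.
Proof.
move=> nh /stepgP[sz H] i ii; have [_ []] := H i ii => // -[q [s [A _]]].
have L j : lnth rw j <> Some (s, Some q).
  by rewrite /lnth; case: ifP => // /nh; case: (nth _ _ _) => a b /= -> [].
case: (tri d q s).2 A => [/L//|]; case: (i) => // j /L //.
Qed.

Lemma step_row d C h n (t := tri d (cstate C) (csym C)) :
  h < n -> (if t.2 is R then h.+1 < n else 0 < h) ->
  stepg d None (mkseq (rowl C h) n)
    (mkseq (rowl (succb d C) (if t.2 is R then h.+1 else h.-1)) n).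
Proof.
move=> hn Ht; apply/stepgP; rewrite !size_mkseq; split=> // i ii.
have L j : lnth (mkseq (rowl C h) n) j = if j < n then Some (rowl C h j) else None.
  by rewrite /lnth size_mkseq; case: ifP => // jn; rewrite nth_mkseq.
rewrite !nth_mkseq //; split=> /=.
  rewrite tp_succ -/t; last by case: (t.2) Ht.
  by case: eqP => // ->; rewrite /tp ltnn eqxx.
case: eqP => [Ei|]; [right|by left].
exists (cstate C), (csym C); rewrite -/t cstate_succb -/t; split=> //.
have rh : rowl C h h = (csym C, Some (cstate C)) by rewrite /rowl /tp ltnn eqxx.
case: (t.2) Ei Ht => Ei Ht.
  have -> : i.+1 = h by lia.
  by rewrite L hn rh.
by rewrite Ei L hn rh.
Qed.

End Rows.

(** * Soundness *)

Section RowsOfStreams.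
Variables (M : ATM) (r : nat -> tok).

Definition lcode (o : option (st M)) : nat := if o is Some q then (rk q).+1 else 0.
Definition lett (c : nat) (l : letter M) : Prop := letis r c (rk l.1) (lcode l.2).

Lemma rk_inj (T : finType) (x y : T) : rk x = rk y -> x = y.
Proof. by move=> H; apply: enum_rank_inj; apply: ord_inj. Qed.

Lemma lcode_inj (o o' : option (st M)) : lcode o = lcode o' -> o = o'.
Proof. by case: o o' => [q|] [q'|] //= [/rk_inj ->]. Qed.

Lemma lett_fun c l l' : lett c l -> lett c l' -> l = l'.
Proof.
move=> /letisE[A B] /letisE[A' B']; case: l l' A B A' B' => [s o] [s' o'] /= A B A' B'.
by rewrite (rk_inj (symis_fun A A')) (lcode_inj (headis_fun B B')).
Qed.

(* [ps] are the positions of the cells of the row that starts at [a] (excluded)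
   and is followed by the header at [h]. *)
Fixpoint rowp (a : nat) (ps : seq nat) (h : nat) : Prop :=
  if ps is c :: ps' then [/\ nx r a c, r c = tC & rowp c ps' h]
  else nx r a h /\ hdb (r h).

Fixpoint lets (ps : seq nat) (rw : seq (letter M)) : Prop :=
  match ps, rw with
  | c :: ps', l :: rw' => lett c l /\ lets ps' rw'
  | [::], [::] => True
  | _, _ => False
  end.

Lemma rowp_lt a ps h : rowp a ps h -> a < h.
Proof.
elim: ps a => [|c ps IH] a /=; first by case; case.
by case=> -[ac _ _] _ /IH; apply: ltn_trans.
Qed.

Lemma rowp_hd a ps h : rowp a ps h -> hdb (r h).
Proof. by elim: ps a => [|c ps IH] a /=; [case|case=> _ _ /IH]. Qed.

Lemma rowp_nohd a ps h : rowp a ps h -> forall j, a < j < h -> ~~ hdb (r j).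
Proof.
elim: ps a => [|c ps IH] a /=.
  by move=> [[_ _ np] _] j /np; case: (r j).
move=> [[ac _ np] Cc /IH H] j jj; case: (ltngtP j c) => jc.
- by have := np j; case: (r j) => // ->//; lia.
- by apply: H; lia.
by rewrite jc Cc.
Qed.

Lemma rowp_ex a b : (forall i, r i <> tX) -> a < b -> hdb (r b) -> exists ps h, rowp a ps h.
Proof.
move=> nX; move En: (b - a) => n; elim/ltn_ind: n a b En => n IH a b En ab hb.
have ex : exists c, (a < c) && spb (r c) by exists b; rewrite ab; case: (r b) hb.
pose c := ex_minn ex; have [/andP[ac sc] cmin] : (a < c) && spb (r c) /\
    forall i, (a < i) && spb (r i) -> c <= i by rewrite /c; case: ex_minnP.
have nac : nx r a c.
  split=> // j /andP[aj jc]; apply/negP => sj; have := cmin j.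
  by rewrite aj sj => /(_ isT); lia.
case hc: (hdb (r c)); first by exists [::], c.
have Cc : r c = tC by have := nX c; case: (r c) sc hc.
have cb : c < b.
  have := cmin b; rewrite ab (_ : spb (r b)); last by case: (r b) hb.
  move=> /(_ isT); rewrite leq_eqVlt => /orP[/eqP E|//].
  by rewrite E hb in hc.
have [|ps [h H]] := IH (b - c) _ c b erefl cb hb; first by lia.
by exists (c :: ps), h.
Qed.

Lemma lets_nth ps rw : lets ps rw -> size ps = size rw /\
  forall i, i < size ps -> lett (nth 0 ps i) (nth (l0 M) rw i).
Proof.
elim: ps rw => [|c ps IH] [|l rw] //= [lc /IH[-> H]]; split=> //.
by case=> [|i] ii //; apply: H.
Qed.

Lemma rowp_mem a ps h c : rowp a ps h -> a < c < h -> r c = tC -> c \in ps.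
Proof.
elim: ps a => [|x ps IH] a /=; first by move=> [[_ _ np] _] /np H Cc; rewrite Cc in H.
move=> [[ax _ np] _ /IH H] jj Cc; rewrite inE; case: (ltngtP c x) => //= cx.
  by have := np c; rewrite Cc => /(_ _)/negP; case=> //; lia.
by apply: H => //; lia.
Qed.

Lemma rowp_nth a ps h i : rowp a ps h -> i < size ps ->
  a < nth 0 ps i < h /\ r (nth 0 ps i) = tC.
Proof.
elim: ps a i => [|x ps IH] a i //= [[ax _ np] Cx R]; case: i => [|i] /=.
  by move=> _; have := rowp_lt R; split=> //; lia.
by move=> /(IH _ _ R)[? ->]; split=> //; lia.
Qed.

End RowsOfStreams.

Lemma nx_eqs r r' a b : (forall i, i <= b -> r i = r' i) -> nx r a b -> nx r' a b.
Proof.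
move=> E [ab sb nb]; split=> //; first by rewrite -E.
by move=> j jj; rewrite -E; [apply: nb | lia].
Qed.

Lemma rowp_eqs r r' a ps h : (forall i, i < h -> r i = r' i) -> hdb (r' h) ->
  rowp r a ps h -> rowp r' a ps h.
Proof.
move=> E hh; elim: ps a => [|c ps IH] a /=.
  move=> [[ab sb nb] _]; split=> //; split=> //; first by case: (r' h) hh.
  by move=> j jj; rewrite -E; [apply: nb | lia].
move=> [N Cc R]; have ch := rowp_lt R; split; last exact: IH.
  by apply: nx_eqs N => i ic; apply: E; lia.
by rewrite -E.
Qed.

Lemma unp_eqs r r' k j : (forall i, i <= k + j.+1 -> r i = r' i) -> unp r k j -> unp r' k j.
Proof. by move=> E [A B]; split=> [i ij|]; rewrite -E //; [apply: A | lia]. Qed.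

(* A letter lies before the next block of its cell. *)
Lemma letis_eqs r r' c s j p : (forall i, i <= p -> r i = r' i) -> inC r c p ->
  letis r c s j -> letis r' c s j.
Proof.
move=> E [cp Bp _] [Cc A B]; have l1 := unp_lt cp Bp A; have l2 := unp_lt l1 Bp B.
split; first by rewrite -E; [|lia].
  by apply: unp_eqs A => i ii; apply: E; lia.
by apply: unp_eqs B => i ii; apply: E; lia.
Qed.

Section Soundness.
Variables (M : ATM) (m : nat) (w : seq (sym M)).
Variable T : strategy_tree tok_ocgs.
Hypothesis model : sat (tree_cgs T) (s0 (tree_cgs T)) (SCoal set0 (pall m w)).

Definition main (r : nat -> tok) : Prop := forall i, ~~ sysst (r i).

Lemma branch_all r (H : branch T r) : ev (ssb H) 0 (pall m w).
Proof.
have E : tn H 0 = s0 (tree_cgs T) by apply: val_inj.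
by apply: (proj1 (all_paths H 0 (pall m w))) => //; rewrite E.
Qed.

Lemma exnX r (H : branch T r) k : ~~ sysst (r k) ->
  exists r' (H' : branch T r'), (forall i, i <= k -> r' i = r i) /\ ~~ sysst (r' k.+1).
Proof.
move=> nk; have := @branch_all _ H; rewrite /pall ev_and => -[/(ev_G (ssbT H))/(_ k isT) A _].
move: A; rewrite ev_or => -[|/sat_pEXnX[r' [H' [E nX]]]].
  rewrite /psys !ev_or !(ev_pa (ssbA H)); case=> [K|[K|K]]; by rewrite K in nk.
exists r', H'; split=> //; have := branch_succ H' k; rewrite E // (negbTE nk).
by case: (r' k.+1) nX.
Qed.

(** Iterates the requirement [pEXnX] of the formula from the given prefix onwards. *)
Lemma ext_main r (H : branch T r) k : (forall i, i <= k -> ~~ sysst (r i)) ->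
  exists r' (H' : branch T r'), (forall i, i <= k -> r' i = r i) /\ main r'.
Proof.
move=> nk.
have [||r' [H' [E P]]] := @extend T (fun y => ~~ sysst (last tL (val y))) (tn H k).
- by rewrite /= last_pre ?H.1 // nk.
- move=> y ny.
  have [||r1 [H1 [E1 _]]] := @extend T (fun=> True) y => //.
    by move=> z _; have [s ns] := tree_total z; exists (exist (fun v => node T v) _ ns) => //; exists s.
  have ly : ~~ sysst (r1 (size (val y))) by rewrite -(last_pre _ H1.1) E1.
  have [r2 [H2 [E2 n2]]] := exnX H1 ly.
  exists (tn H2 (size (val y)).+1); first by rewrite -[val _]/(pre _ _) last_pre ?H2.1.
  by exists (r2 (size (val y)).+1); rewrite -[val (tn _ _)]/(pre _ _) preS; congr rcons; rewrite -[RHS]E1; apply: eq_pre.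
rewrite /= size_pre in E P.
have A i : i <= k -> r' i = r i by apply: pre_eq E; rewrite H'.1 H.1.
exists r', H'; split=> // i; case: (leqP i k) => ik; first by rewrite A // nk.
by have := P i (ltnW ik); rewrite last_pre ?H'.1.
Qed.

Section MainBranch.
Variables (r : nat -> tok) (H : branch T r).
Hypothesis mr : main r.

Lemma main_ev : ev (ssb H) 0 (pmain m w).
Proof.
have := @branch_all _ H; rewrite /pall ev_and ev_imp => -[_]; apply.
apply/(ev_G (ssbT H)) => i _; rewrite ev_N (ev_pa (ssbA H)) => K.
by have := mr i; rewrite K.
Qed.

Lemma mF : exists i, r i = tA.
Proof.
have := main_ev; rewrite /pmain ev_and => -[_]; rewrite ev_and (ev_F (ssbT H)) => -[[i _]].
by rewrite (ev_pa (ssbA H)); exists i.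
Qed.

Lemma mblk p : r p = tB -> (forall j, j < m -> bitb (r (p + j.+1))) /\
  exists r' (H' : branch T r'), (forall i, i <= p + m -> r' i = r i) /\ r' (p + m).+1 = tX.
Proof.
have := main_ev; rewrite /pmain ev_and => -[_]; rewrite ev_and => -[_].
rewrite ev_and (ev_G (ssbT H)) => -[/(_ p isT) + _].
rewrite /pblk ev_imp (ev_pa (ssbA H)) ev_and ev_next sat_pEX (ev_ands (ssbT H)).
move=> K /K[A B]; split=> // j jm; have := A j jm.
by rewrite ev_next ev_or !(ev_pa (ssbA H)); case: (r _) => // -[].
Qed.

Lemma mhas k : r k = tC -> exists p, inC r k p.
Proof.
have := main_ev; rewrite /pmain ev_and => -[_]; rewrite ev_and => -[_].
rewrite ev_and => -[_]; rewrite ev_and (ev_G (ssbT H)) => -[/(_ k isT) + _].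
by rewrite ev_imp (ev_pa (ssbA H)) (ev_phas (ssbA H)) => A /A[p ip _]; exists p.
Qed.

Lemma mcoal k : r k = tC \/ lrb (r k) -> forall d, sat (tree_cgs T) (tn H k) (SCoal [set sys] (pbody M m d)).
Proof.
have := main_ev; rewrite /pmain ev_and => -[_]; rewrite ev_and => -[_].
rewrite ev_and => -[_]; rewrite ev_and => -[_]; rewrite ev_and => -[_].
rewrite (ev_G (ssbT H)) => /(_ k isT); rewrite ev_imp ev_or /plr ev_or !(ev_pa (ssbA H)) ev_and.
move=> A B; have [|A0 A1] := A; last by case.
by case: B; [left|case: (r k) => //; right; [left|right]].
Qed.

Lemma ev_rowhas k a : ev (ssb H) k (prowhas a) <->
  exists c, [/\ k < c, r c = tC, forall j, k < j < c -> ~~ hdb (r j) & ev (ssb H) c a].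
Proof.
rewrite /prowhas ev_X ev_until; split=> -[c].
  move=> [kc]; rewrite ev_and (ev_pa (ssbA H)) => -[Cc ac] nh; exists c; split=> // j jj.
  by have := nh j jj; rewrite ev_N (ev_hd (ssbA H)) => /negP.
move=> [kc Cc nh ac]; exists c; split=> //; first by rewrite ev_and (ev_pa (ssbA H)).
by move=> j jj; rewrite ev_N (ev_hd (ssbA H)); apply/negP/nh.
Qed.

Lemma ev_pstate c (A : {set st M}) : r c = tC ->
  ev (ssb H) c (pstate A) <-> exists2 q, q \in A & headis r c (rk q).+1.
Proof.
move=> Cc; rewrite /pstate (ev_skip (ssbA H)); split.
  move=> [s us]; rewrite (ev_ors (ssbT H)) => -[q]; case: ifP => [qA|_]; last by move=> K; case: K; apply: ssbT.
  by rewrite (ev_un (ssbA H)) => -[uq _]; exists q => //; split=> //; exists s.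
move=> [q qA [_ [s [us uq]]]]; exists s => //; rewrite (ev_ors (ssbT H)); exists q.
by rewrite qA (ev_un (ssbA H)); split=> //; apply: ssbT.
Qed.

Lemma mlr k : lrb (r k) ->
  [/\ r k.+1 = tC, ev (ssb H) k (pfin M) & ev (ssb H) k (puni M)].
Proof.
have := main_ev; rewrite /pmain ev_and => -[_]; rewrite ev_and => -[_].
rewrite ev_and => -[_]; rewrite ev_and => -[_]; rewrite ev_and => -[+ _].
rewrite (ev_G (ssbT H)) => /(_ k isT); rewrite ev_imp /plr ev_or !(ev_pa (ssbA H)).
rewrite ev_and ev_X (ev_pa (ssbA H)) ev_and => K lk.
by case: K => [|? [? ?]]; first by case: (r k) lk => // _; [left|right].
Qed.

Lemma mfin h ps h' : lrb (r h) -> rowp r h ps h' -> r h' = tA ->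
  exists c q, [/\ c \in ps, q \in final M & headis r c (rk q).+1].
Proof.
move=> lh R Ah; have [_ + _] := mlr lh; rewrite /pfin ev_imp ev_rowhas; case.
  rewrite ev_X ev_until; exists h'; split; first exact: rowp_lt R.
    by rewrite (ev_pa (ssbA H)).
  by move=> j jj; rewrite ev_N (ev_hd (ssbA H)); apply/negP/(rowp_nohd R).
move=> c [hc Cc nh]; rewrite ev_pstate // => -[q qF hq]; exists c, q; split=> //.
apply: (rowp_mem R _ Cc); rewrite hc ltnNge; apply/negP => h'c.
case: (ltngtP h' c) h'c => // [h'c|E] _; last by rewrite -E Ah in Cc.
by move: (nh h'); rewrite h'c Ah (rowp_lt R) => /(_ isT).
Qed.

Lemma muni h ps h' c q : lrb (r h) -> rowp r h ps h' -> lrb (r h') ->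
    c \in ps -> q \in universal M -> headis r c (rk q).+1 ->
  forall b, exists r' (H' : branch T r'), (forall i, i < h' -> r' i = r i) /\ r' h' = br b.
Proof.
move=> lh R lh' cp qU hc; have hh' := rowp_lt R.
have ci : index c ps < size ps by rewrite index_mem.
have [hch Cc] := rowp_nth R ci; rewrite nth_index // in hch Cc.
have [_ _] := mlr lh; rewrite /puni ev_imp ev_rowhas => K.
have {K}/ev_until [i0 [hi]] : ev (ssb H) h pbranch.
  apply: K; exists c; split=> //; [lia| |by rewrite ev_pstate //; exists q].
  by move=> j jj; apply: (rowp_nohd R); lia.
rewrite ev_and ev_X (ev_hd (ssbA H)) => -[hdi br_i] nh.
have Ei : i0.+1 = h'.
  have {}nh j : h < j <= i0 -> ~~ hdb (r j).
    move=> jj; have := nh j.-1; rewrite ev_X ev_N (ev_hd (ssbA H)) prednK; last lia.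
    by move=> K; apply/negP; apply: K; lia.
  case: (ltngtP i0.+1 h') => // K.
    by have := rowp_nohd R (j := i0.+1); rewrite hdi => K'; have : false by apply: K'; lia.
  by have := nh h'; rewrite (rowp_hd R) => K'; have : false by apply: K'; lia.
move: br_i; rewrite ev_or ev_X (ev_pa (ssbA H)) Ei => -[A|]; first by rewrite A in lh'.
rewrite ev_and !sat_pEX Ei => -[[rl [Hl [El El']]] [rr [Hr [Er Er']]]] [].
  by exists rr, Hr; split=> // j jh; apply: Er; lia.
by exists rl, Hl; split=> // j jh; apply: El; lia.
Qed.

End MainBranch.
End Soundness.

(** * Alignment of consecutive rows, and extraction of a computation tree *)

Section AlignedRows.
Variables (M : ATM) (m : nat) (w : seq (sym M)).
Variable T : strategy_tree tok_ocgs.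
Hypothesis model : sat (tree_cgs T) (s0 (tree_cgs T)) (SCoal set0 (pall m w)).

Definition sub (r : nat -> tok) (b a : nat) : Prop :=
  forall p1, inC r b p1 -> exists2 p2, inC r a p2 & veq m r p1 p2.

(** Env follows [r] to the end of the block [p] and challenges there. Under [sub r b a] sys cannot
    win by a mismatch, since its word would be a block of [b] and hence of [a]; the other disjunct
    of [pbody] remains. *)
Lemma challenge r (H : branch T r) a ps h b y p d : main r ->
    r a = tC \/ lrb (r a) -> rowp r a ps h -> r h = br d ->
    h <= b -> spb (r b) -> nx r b y -> r y = tC ->
    (forall j, h < j <= b -> ~~ hdb (r j)) ->
    (r a = tC <-> r b = tC) -> sub r b a -> inC r y p ->
  [/\ uinx m r a p, symok M r d a y & headok M r d a y].
Proof.
move=> mr sa R rh hb sb N Cy nh same sba ip.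
have blk : blocky m r by move=> p1 /(mblk model H mr)[].
have [yp Bp _] := ip; have [_ [r' [H' [E X]]]] := mblk model H mr Bp.
have ah := rowp_lt R; have [bY _ nby] := N.
have sat_a := mcoal model H mr sa d.
have [|||c [Hc [cE]]] := @sys_elim T r H a _ r' H' (p + m).+1 sat_a.
- by move=> i ia; apply: E; lia.
- by lia.
- by move=> i ii; rewrite E; [apply: mr|lia].
have cX : c (p + m).+1 = tX by rewrite cE.
have agr i : i <= p + m -> c i = r i by move=> ii; rewrite cE ?E //; lia.
have after i : (p + m).+1 < i -> zbit (c i).
  move=> pi; rewrite -(subnKC pi); elim: (i - _) => [|n IH].
    by rewrite addn0 -(branch_succ Hc) cX.
  by rewrite addnS -(branch_succ Hc); case: (c _) IH.
have spa : spb (r a) by case: sa => [->//|]; case: (r a).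
have nh2 j : h < j <= p + m -> ~~ hdb (r j).
  move=> jj; case: (leqP j b) => jb; first by apply: nh; lia.
  case: (ltngtP j y) => jy; [ | |by rewrite jy Cy].
  - by have := nby j; case: (r j) => //= ->//; lia.
  by have := nosp_block (j := j) blk ip; case: (r j) => //= ->//; lia.
rewrite (@ev_body M m r c (p + m) _ (ssbT Hc) (ssbA Hc) agr cX after mr blk a h b y p d
  spa ah (rowp_nohd R) rh hb nh2 sb N Cy ip erefl) => /(_ same)[|//].
move=> [[p1 /sba[p2 i2 v12] v1] []]; exists p2 => // j jm.
by rewrite -(v1 j jm); split=> /(v12 j jm).
Qed.

(** Induction on the second row. Challenging all the blocks of [y] gives [sub r y x], the hypothesis
    for the next pair of cells; challenging one of them gives the letter of [y]. The option [al] is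
    the letter at [a], absent when [a] is a header. *)
Lemma align r (H : branch T r) d h' ps' a (al : option (letter M)) ps rw h b : main r ->
    r a = tC \/ lrb (r a) -> rowp r a ps h -> r h = br d ->
    h <= b -> spb (r b) -> rowp r b ps' h' ->
    (forall j, h < j <= b -> ~~ hdb (r j)) ->
    (r a = tC <-> r b = tC) -> sub r b a -> lets r ps rw ->
    (if al is Some l then lett r a l else r a <> tC) ->
  exists rw', lets r ps' rw' /\ stepg d al rw rw'.
Proof.
move=> mr; elim: ps' a al ps rw b => [|y ps' IH] a al ps rw b.
  by exists [::]; split=> //; case: (rw).
move=> sa R rh hb sb [N Cy R'] nh same sba L La.
have ch p : inC r y p -> _ := @challenge r H a ps h b y p d mr sa R rh hb sb N Cy nh same sba.
have ex : exists x ps1 l rw1, [/\ ps = x :: ps1, rw = l :: rw1 & nx r a x].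
  have [p /ch[[x [nax Cx _]] _ _]] := mhas model H mr Cy.
  case: ps R L {ch} => [|x' ps1] /=.
    move=> [nah hh]; move: hh; rewrite -(nx_fun nax nah) Cx //.
  by move=> [nax' _ _]; case: rw => // l rw1 _; exists x', ps1, l, rw1.
move: ex => [x [ps1 [l [rw1 [Eps Erw nax]]]]]; subst ps rw.
case: R ch => _ Cx R ch; case: L => Lx L.
have sxy : sub r y x.
  move=> p /ch[[x' [nax' _ [p2 ip2 v]]] _ _].
  by exists p2; [rewrite (nx_fun nax nax')|move=> j jm; rewrite (v j jm)].
have [p /ch[_ so ho]] := mhas model H mr Cy.
have [ly [Ly cy]] : exists ly, lett r y ly /\ cont d al l (ohead rw1) ly.
  have [s' [sy sE]] : exists s', symis r y (rk s') /\
      s' = if l.2 is Some q then (tri d q l.1).1.2 else l.1.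
    case: so => [[s [x' [nx' lx' sy]]]|[q [s [x' [nx' lx' sy]]]]].
      rewrite -(nx_fun nax nx') in lx'.
      have -> : l = (s, None) := @lett_fun M r x l (s, None) Lx lx'.
      by exists s.
    rewrite -(nx_fun nax nx') in lx'.
    have -> : l = (s, Some q) := @lett_fun M r x l (s, Some q) Lx lx'.
    by eexists; split; first exact: sy.
  have [o' [hy hE]] : exists o', headis r y (lcode o') /\
      (o' = None \/ exists q s, (if (tri d q s).2 is R then al else ohead rw1) = Some (s, Some q)
                             /\ o' = Some (tri d q s).1.1).
    case: ho => [hy|[q [s [C hy]]]]; first by exists None; split=> //; left.
    exists (Some (tri d q s).1.1); split=> //; right; exists q, s; split=> //.
    case: (tri d q s).2 C => [[x1 [x2 [n1 n2 lx2]]]|la].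
      move: n2; rewrite -(nx_fun nax n1) => n2.
      case: ps1 rw1 R L {IH} => [|x3 ps3] [|l3 rw3] //=.
        by move=> [n3 hd3]; case: lx2; rewrite (nx_fun n2 n3) => C; rewrite C in hd3.
      move=> [n3 _ _] [l3' _]; congr Some; apply: (@lett_fun M r x3 l3 (s, Some q)) l3' _.
      by rewrite (nx_fun n3 n2).
    case: al La => [la'|] La; first by congr Some; apply: (@lett_fun M r a la' (s, Some q)) La la.
    by case: la.
  exists (s', o'); split; last by split.
  by apply/letisE.
have [|||||rw' [L' S']] := IH x (Some l) ps1 rw1 y _ R rh _ _ R' _ _ sxy L Lx.
- by left.
- by case: N => ? _ _; lia.
- by rewrite Cy.
- move=> j jj; case: (leqP j b) => jb; first by apply: nh; lia.
  case: N => _ _ np; case: (ltngtP j y) => jy; [|lia|by rewrite jy Cy].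
  by have := np j; case: (r j) => //= ->//; lia.
- by split.
by exists (ly :: rw'); split=> /=.
Qed.

Lemma step_rows r (H : branch T r) d h ps h' (rw : seq (letter M)) ps' h'' : main r ->
    lrb (r h) -> rowp r h ps h' -> r h' = br d -> rowp r h' ps' h'' -> lets r ps rw ->
  exists rw', lets r ps' rw' /\ stepg d None rw rw'.
Proof.
move=> mr lh R rh R' L.
have sh : spb (r h') by rewrite rh; case: (d).
have nC : r h <> tC by move=> E; rewrite E in lh.
apply: (@align r H d h'' ps' h None ps rw h' h') => //; first by right.
- by move=> j jj; lia.
- by split=> // E; rewrite rh in E; case: (d) E.
(* The remaining goal [sub r h' h] is vacuous: the token after the header [h'] is a cell, so [h']
   has no block. *)
have lh' : lrb (r h') by rewrite rh; case: (d).
move=> p [hp Bp np]; have [Cn _ _] := mlr model H mr lh'.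
by move: (np h'.+1); rewrite Cn hp ltnSn => /(_ isT).
Qed.

Definition blankto (r : nat -> tok) (a i : nat) : Prop :=
  forall j, a < j < i -> ~~ hdb (r j) /\ (r j = tC -> lett r j (l0 M)).

Lemma lets_blank r a ps h : rowp r a ps h -> blankto r a h ->
  lets r ps (nseq (size ps) (l0 M)).
Proof.
elim: ps a => [|c ps IH] a //= [[ac _ _] Cc R] bl; have ch := rowp_lt R.
split; first by have [_] := bl c ltac:(lia); apply.
by apply: IH R _ => j jj; apply: bl; lia.
Qed.

Section Init.
Variables (r : nat -> tok) (H : branch T r).

Lemma ev_pblank k : ev (ssb H) k (pblank M) <->
  ~~ hdb (r k) /\ (r k = tC -> lett r k (l0 M)).
Proof.
rewrite /pblank ev_and ev_N (ev_hd (ssbA H)) ev_imp (ev_pa (ssbA H)) (ev_let (ssbT H) (ssbA H)).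
by split=> -[A B]; split=> //; apply/negP.
Qed.

Lemma lets_ini ws a ps h : ev (ssb H) a (pini ws) -> rowp r a ps h ->
  exists n, lets r ps ([seq (s, None) | s <- ws] ++ nseq n (l0 M)).
Proof.
elim: ws a ps => [|s ws IH] a ps.
  rewrite -[pini _]/(ptail M) /ptail ev_X ev_until => -[i [ai hi bl]] R.
  exists (size ps); apply: (lets_blank R).
  move: hi; rewrite (ev_hd (ssbA H)) => hi.
  have {}bl : blankto r a i by move=> j jj; apply/ev_pblank/bl; lia.
  suff -> : h = i by [].
  case: (ltngtP h i) => // hi'.
    by have [|] := bl h; [have := rowp_lt R; lia|rewrite (rowp_hd R)].
  by have := rowp_nohd R (j := i); rewrite hi => /(_ _)/negP; case=> //; lia.
rewrite -[pini _]/(pnx (pand (plet (rk s) 0) (pini ws))) (ev_pnx (ssbA H)).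
move=> [b nab]; rewrite ev_and (ev_let (ssbT H) (ssbA H)) => -[ls bl].
case: ps => [|c ps] /=; first by move=> [nah]; rewrite -(nx_fun nab nah); case: ls => ->.
move=> [nac Cc R]; rewrite (nx_fun nab nac) in bl ls.
by have [n L] := IH _ _ bl R; exists n; split.
Qed.

Lemma lets_init a i ps h s q ws : rowp r a ps h -> a < i -> blankto r a i ->
    lett r i (s, Some q) -> ev (ssb H) i (pini ws) ->
  exists n n', lets r ps (nseq n (l0 M) ++ (s, Some q) :: [seq (s, None) | s <- ws] ++ nseq n' (l0 M)).
Proof.
elim: ps a => [|c ps IH] a /=.
  move=> [[ah sh np] hh] ai bl li _; case: (ltngtP h i) => hi.
  - by have [|] := bl h; [lia|rewrite hh].
  - by case: li => C; have := np i; rewrite C => /(_ _)/negP; case=> //; lia.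
  by case: li => C; rewrite hi C in hh.
move=> [[ac sc np] Cc R] ai bl li ini; case: (ltngtP c i) => ci.
- have [|n [n' L]] := IH c R ci _ li ini; first by move=> j jj; apply: bl; lia.
  exists n.+1, n'; split=> //.
  by have [|_] := bl c; [lia|apply].
- by case: li => C; have := np i; rewrite C => /(_ _)/negP; case=> //; lia.
by rewrite -ci in li ini; have [n' L] := lets_ini ini R; exists 0, n'.
Qed.

Lemma row0 ps h : main r -> rowp r 0 ps h ->
  exists2 rw, @lets M r ps rw & represents rw (init_config w).
Proof.
move=> mr R; have := @main_ev M m w T model r H mr; rewrite /pmain ev_and => -[+ _].
rewrite /pinit ev_X ev_until => -[i [i0]].
rewrite ev_and (ev_let (ssbT H) (ssbA H)) => -[li ini] bl.
have [||n [n' L]] := lets_init R i0 _ (_ : lett r i (head (blank M) w, Some (start M))) ini => //.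
  by move=> j jj; apply/ev_pblank/bl; lia.
eexists; first exact: L.
exists n; first by rewrite size_cat size_nseq /=; lia.
move=> j jj; rewrite nth_cat size_nseq nth_nseq /rowl /tp.
case: (ltngtP j n) => jn; first by rewrite nth_nil.
  have -> : j - n = (j - n).-1.+1 by lia.
  rewrite /= nth_cat size_map nth_nseq.
  case: ltnP => ws; first by rewrite (nth_map (blank M)).
  by rewrite [nth _ _ _]nth_default //; case: ifP.
by rewrite jn subnn.
Qed.
End Init.

(** An infinite descending chain from an unchallenged prefix without [tA] would be an unchallenged
    branch avoiding [tA], against the requirement [pF (pa tA)]. *)
Definition R1 (v' v : seq tok) : Prop :=
  exists s, [/\ v' = rcons v s, node T v', ~~ sysst s & s <> tA].

Lemma acc_main r (H : branch T r) k : (forall i, i <= k -> ~~ sysst (r i) /\ r i <> tA) ->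
  Acc R1 (pre r k).
Proof.
move=> good; apply: NNPP => nacc.
pose P (y : tnode T) := [/\ ~ Acc R1 (val y), ~~ sysst (last tL (val y)) & last tL (val y) <> tA].
have [||r' [H' [E P']]] := @extend T P (tn H k).
- by have [] := good k (leqnn k); split=> //; rewrite -[val _]/(pre r k) last_pre ?H.1.
- move=> y [ny _ _]; apply: NNPP => nex; apply: ny; constructor => z [s [zE nz ns sA]].
  apply: NNPP => naz; apply: nex; exists (exist (fun v => node T v) z nz); last by exists s.
  by split=> //=; rewrite zE last_rcons.
rewrite -[val _]/(pre r k) size_pre in E P'.
have A i : i <= k -> r' i = r i by apply: pre_eq E; rewrite H'.1 H.1.
have G i : ~~ sysst (r' i) /\ r' i <> tA.
  case: (leqP i k) => ik; first by rewrite A //; apply: good.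
  by have [_] := P' i (ltnW ik); rewrite -[val _]/(pre r' i) last_pre ?H'.1.
have [|i] := mF model H'; first by move=> i; have [] := G i.
by have [] := G i.
Qed.

Lemma R1_trans r (H : branch T r) k h : k < h ->
  (forall i, k < i <= h -> ~~ sysst (r i) /\ r i <> tA) ->
  clos_trans _ R1 (pre r h) (pre r k).
Proof.
elim: h => // h IH; rewrite ltnS leq_eqVlt => /orP[/eqP ->|kh] good.
  apply: t_step; exists (r h.+1); have [|] := good h.+1; first by lia.
  by split=> //; [rewrite preS | apply: H.2].
apply: t_trans (IH kh _); last by move=> i ii; apply: good; lia.
apply: t_step; exists (r h.+1); have [|] := good h.+1; first by lia.
by split=> //; [rewrite preS | apply: H.2].
Qed.

Definition accc (C : config M) : Prop :=
  exists t : ctree M, [/\ croot t = C, computation t & accepting t].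

(** Every cell has a block, which lies before [h], and a letter ends before the blocks of its cell;
    so no letter depends on tokens from [h] on. *)
Lemma lets_eqs r r' (H : branch T r) a ps h (rw : seq (letter M)) : main r -> rowp r a ps h ->
  (forall i, i < h -> r i = r' i) -> lets r ps rw -> lets r' ps rw.
Proof.
move=> mr; elim: ps a rw => [|c ps IH] a [|l rw] //= [_ Cc R] E [lc L].
split; last exact: IH R E L.
have [p ip] := mhas model H mr Cc.
have blk : blocky m r by move=> p1 /(mblk model H mr)[].
have sh : spb (r h) by have := rowp_hd R; case: (r h).
have ph := inC_le blk ip sh (rowp_lt R).
by apply: letis_eqs ip lc => i ii; apply: E; lia.
Qed.

(** Well-founded induction on the node of the header. The two conclusions need each other: the
    presence of a head is carried backwards from the accepted row, and it excludes the bad case of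
    [rel_step] when the configuration is followed forwards. *)
Lemma sound_row v : Acc (clos_trans _ R1) v -> forall r (H : branch T r) k, v = pre r k ->
    main r -> (forall i, i <= k -> r i <> tA) -> lrb (r k) ->
  forall ps h (rw : seq (letter M)), rowp r k ps h -> lets r ps rw ->
  (forall C, represents rw C -> accc C) /\ ~ nohead rw.
Proof.
elim=> {}v _ IH r H k vE mr nA lk ps h rw R L.
have kh := rowp_lt R; have hh := rowp_hd R.
have [szE Ln] := lets_nth L.
(* Stated for every branch sharing the current row, since a universal configuration also needs a
   branch that departs from [r] at [h]. *)
have next r' (H' : branch T r') b : main r' -> (forall i, i < h -> r' i = r i) -> r' h = br b ->
  (forall C, represents rw C -> accc (succb b C)) /\ ~ nohead rw.
  move=> mr' E rh.
  have hh' : hdb (r' h) by rewrite rh; case: (b).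
  have R' : rowp r' k ps h by apply: rowp_eqs R => // i ii; rewrite E.
  have L' : lets r' ps rw by apply: (lets_eqs H mr R) L => i ii; rewrite E.
  have nA' i : i <= h -> r' i <> tA.
    rewrite leq_eqVlt => /orP[/eqP ->|ih]; first by rewrite rh; case: (b).
    rewrite E //; case: (leqP i k) => ik; first exact: nA.
    by have := rowp_nohd R (j := i); rewrite ik ih => /(_ isT); case: (r i).
  have [f Af] := mF model H' mr'.
  have hf : h < f by rewrite ltnNge; apply/negP => /nA'.
  have nX i : r' i <> tX by move=> K; have := mr' i; rewrite K.
  have [|ps' [h' R2]] := @rowp_ex r' h f nX hf; first by rewrite Af.
  have lk' : lrb (r' k) by rewrite E.
  have [rw' [L2 S]] := step_rows H' mr' lk' R' rh R2 L'.
  have [] := IH (pre r' h) _ r' H' h erefl mr' nA' _ ps' h' rw' R2 L2.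
  - rewrite vE (_ : pre r k = pre r' k); last by apply: eq_pre => j jk; rewrite E //; lia.
    by apply: R1_trans => // i ii; split=> //; apply: nA'; lia.
  - by rewrite rh; case: (b).
  move=> acc nn; split=> [C rC|nh]; last by apply: nn; apply: nohead_step nh S.
  by have [/acc|/nn] := rel_step rC S.
case hA : (r h == tA).
  have [c [q [cp qF hq]]] := mfin model H mr lk R (eqP hA).
  have ci : index c ps < size ps by rewrite index_mem.
  have Eq : (nth (l0 M) rw (index c ps)).2 = Some q.
    have := Ln _ ci; rewrite nth_index // => /letisE[_ hq'].
    by apply: (@lcode_inj M _ (Some q)); apply: headis_fun hq' hq.
  split=> [C [i ir rowE]|nh]; last by rewrite nh -?szE in Eq.
  exists (CLeaf C); split=> //=; move: Eq; rewrite rowE -?szE // /rowl /=.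
  by case: eqP => // _ [->].
have [b rh] : exists b, r h = br b.
  by case: (r h) hh hA => // _ _; [exists false|exists true].
have [acc nn] := next r H b mr (fun _ _ => erefl) rh.
split=> // C rC; case qU : (cstate C \in universal M); last first.
  have [t [tC tc ta]] := acc C rC; exists (CNode1 C t); split=> //=; split=> //.
    by rewrite inE qU.
  by rewrite tC; case: (b); [right|left].
have [i ir rowE] := rC.
have lh : lrb (r h) by rewrite rh; case: (b).
have hc : headis r (nth 0 ps i) (rk (cstate C)).+1.
  by have := Ln i; rewrite szE rowE // /rowl eqxx => /(_ ir)/letisE[].
have both b' : accc (succb b' C).
  have [|r1 [H1 [E1 h1]]] := muni model H mr lk R lh _ qU hc b'; first by rewrite mem_nth ?szE.
  have [|r2 [H2 [E2 m2]]] := @ext_main M m w T model r1 H1 h.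
    move=> j; rewrite leq_eqVlt => /orP[/eqP ->|jh]; first by rewrite h1; case: (b').
    by rewrite E1.
  have E3 j : j < h -> r2 j = r j by move=> jh; rewrite E2 ?E1 //; lia.
  have h2 : r2 h = br b' by rewrite E2.
  by have [+ _] := next r2 H2 b' m2 E3 h2; apply.
have [t1 [A1 B1 C1]] := both false; have [t2 [A2 B2 C2]] := both true.
by exists (CNode2 C t1 t2).
Qed.

Lemma soundness : accepts w.
Proof.
have [|r [H [E _]]] := @extend T (fun=> True) (exist (fun v => node T v) [::] (node_root T)) I.
  by move=> y _; have [s ns] := tree_total y; exists (exist (fun v => node T v) _ ns) => //; exists s.
have [|r' [H' [_ mr]]] := ext_main model H (k := 0).
  by move=> i; rewrite leqn0 => /eqP ->; rewrite H.1.
have [f Af] := mF model H' mr.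
have f0 : 0 < f by case: f Af => //; rewrite H'.1.
have nX i : r' i <> tX by move=> K; have := mr i; rewrite K.
have [|ps [h R]] := @rowp_ex r' 0 f nX f0; first by rewrite Af.
have [rw L rC] := row0 H' mr R.
have n0 i : i <= 0 -> r' i <> tA by rewrite leqn0 => /eqP ->; rewrite H'.1.
have A : Acc (clos_trans _ R1) (pre r' 0).
  by apply: Acc_clos_trans; apply: acc_main => // i /n0 nA; split.
have [|+ _] := sound_row A H' erefl mr n0 _ R L; first by rewrite H'.1.
by move/(_ _ rC).
Qed.

End AlignedRows.

(** * Completeness *)

Section Gen.
Variables (M : ATM) (m : nat) (addr : nat -> seq (seq bool)).

(** A computation tree with rows for configurations. A node with one child records the direction of
    the step, which the next header has to spell. *)
Inductive rtree :=
| RLeaf of seq (letter M)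
| RNode1 of seq (letter M) & bool & rtree
| RNode2 of seq (letter M) & rtree & rtree.

Definition rrow (t : rtree) : seq (letter M) :=
  match t with RLeaf rw | RNode1 rw _ _ | RNode2 rw _ _ => rw end.
Definition rchild (t : rtree) (b : bool) : option rtree :=
  match t with
  | RLeaf _ => None
  | RNode1 _ b' t1 => if b == b' then Some t1 else None
  | RNode2 _ t1 t2 => Some (if b then t2 else t1)
  end.
Definition rleaf (t : rtree) : bool := if t is RLeaf _ then true else false.

Definition btok (b : bool) : tok := if b then b1 else b0.

(* The flag of a token tells whether a challenge may follow it. *)
Fixpoint bitt (v : seq bool) : seq (tok * bool) :=
  if v is x :: v' then (btok x, nilp v') :: bitt v' else [::].
Definition blockt (v : seq bool) := (tB, false) :: bitt v.
Definition code (n : nat) : seq (tok * bool) := rcons (nseq n (b0, false)) (b1, false).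
Definition cellt (i : nat) (l : letter M) : seq (tok * bool) :=
  (tC, false) :: code (rk l.1) ++ code (lcode l.2) ++ flatten [seq blockt v | v <- addr i].
Fixpoint rowt (i : nat) (rw : seq (letter M)) : seq (tok * bool) :=
  if rw is l :: rw' then cellt i l ++ rowt i.+1 rw' else [::].

(** States of a generator whose runs are the nodes of the strategy tree. In [GM], the boolean is the
    flag of the last token and the list holds the rest of the current row. [GF] repeats [tA] for
    ever since plays are infinite; [GX] accepts all answers of sys. *)
Inductive gst := GM of bool & seq (tok * bool) & rtree | GF | GX.

Definition gstart (t : rtree) : gst := GM false (rowt 0 (rrow t)) t.

Definition gstep (g : gst) (k : tok) : option gst :=
  match g with
  | GM fl p t =>
      if sysst k then if fl && (k == tX) then Some GX else None
      else match p with
      | (k', fl') :: p' => if k == k' then Some (GM fl' p' t) else None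
      | [::] => match k with
                | tL => omap gstart (rchild t false)
                | tR => omap gstart (rchild t true)
                | tA => if rleaf t then Some GF else None
                | _ => None
                end
      end
  | GF => if k == tA then Some GF else None
  | GX => if zbit k then Some GX else None
  end.

Definition grun (t : rtree) (v : seq tok) : option gst :=
  foldl (fun o k => obind (gstep^~ k) o) (Some (gstart t)) v.

Lemma grun_rcons t v k : grun t (rcons v k) = obind (gstep^~ k) (grun t v).
Proof. by rewrite /grun -cats1 foldl_cat. Qed.

Definition gsys (g : gst) : bool := if g is GX then true else false.
Definition gok (g : gst) : bool :=
  if g is GM _ p _ then all (fun x => ~~ sysst x.1) p else true.

Lemma nsys_bitt v : all (fun x => ~~ sysst x.1) (bitt v).
Proof. by elim: v => //= -[] v ->. Qed.
Lemma nsys_code n : all (fun x => ~~ sysst x.1) (code n).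
Proof. by rewrite /code all_rcons all_nseq orbT. Qed.
Lemma nsys_rowt i rw : all (fun x => ~~ sysst x.1) (rowt i rw).
Proof.
elim: rw i => //= l rw IH i; rewrite !all_cat !nsys_code IH andbT /=.
by elim: (addr i) => //= v vs IHv; rewrite all_cat nsys_bitt.
Qed.

Lemma gstepP g k g' : gok g -> gstep g k = Some g' ->
  [/\ gok g', gsys g' = sysst k & gsys g = zbit k].
Proof.
have st t o : o = omap gstart t -> o = Some g' -> gok g' /\ gsys g' = false.
  by move=> ->; case: t => //= t [<-]; split=> //; apply: nsys_rowt.
case: g => [fl p t||] /=; last 2 first.
- by move=> _; case: k => //= -[<-].
- by move=> _; case: k => //= -[<-].
case: ifP => [sk _|nk ok].
  by case: fl => //=; case: k sk => //= _ [<-].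
have zk : zbit k = false by case: k nk.
rewrite zk; case: p ok => [|[k' fl'] p] /=; last first.
  by move=> /andP[_ ok]; case: ifP => // _ [<-].
move=> _; case: (k) => //.
- by move/(st (rchild t false) _ erefl) => [].
- by move/(st (rchild t true) _ erefl) => [].
by case: ifP => // _ [<-].
Qed.

Variable t0 : rtree.

Lemma grunP v g : grun t0 v = Some g -> gok g /\ gsys g = sysst (last tL v).
Proof.
elim/last_ind: v g => [|v k IH] g.
  by case=> <-; split=> //; apply: nsys_rowt.
rewrite grun_rcons last_rcons; case E: (grun t0 v) => [g1|] //= H.
by have [ok _] := IH _ E; have [? ? _] := gstepP ok H.
Qed.

(** A legal token that opens no challenge: it makes the tree total and supplies unchallenged
    extensions. *)
Definition gnext (g : gst) : tok :=
  match g with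
  | GM _ ((k, _) :: _) _ => k
  | GM _ [::] t => match t with RLeaf _ => tA | RNode1 _ b _ => br b | RNode2 _ _ _ => tL end
  | GF => tA
  | GX => z0
  end.

Lemma gnextP g : gok g -> isSome (gstep g (gnext g)) /\ sysst (gnext g) = gsys g.
Proof.
case: g => [fl [|[k fl'] p] t||] //=.
  by move=> _; case: t => //= rw [].
by move=> /andP[/negbTE nk _]; rewrite nk eqxx.
Qed.

Definition gnode (v : seq tok) : bool := isSome (grun t0 v).

Lemma gnode_rcons v k : gnode (rcons v k) -> gnode v /\ succ tok_ocgs (last tL v) k.
Proof.
rewrite /gnode grun_rcons; case E: (grun t0 v) => [g|] //= H; split=> //.
have [ok gs] := grunP E; case E': (gstep g k) H => [g'|] // _.
by have [_ _ gz] := gstepP ok E'; rewrite tok_succE -gs gz.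
Qed.

Lemma gnode_sys v k : gnode v -> passive tok_ocgs env (last tL v) ->
  succ tok_ocgs (last tL v) k -> gnode (rcons v k).
Proof.
rewrite /gnode tok_passive_env tok_succE grun_rcons; case E: (grun t0 v) => [g|] // _ sv.
have [_] := grunP E; rewrite sv; case: (g) => //= _ /eqP.
by case: (zbit k).
Qed.

Lemma gnode_next v : gnode v -> exists2 k, gnode (rcons v k) & sysst k = sysst (last tL v).
Proof.
rewrite /gnode; case E: (grun t0 v) => [g|] // _; have [ok gs] := grunP E.
have [A B] := gnextP ok; exists (gnext g); last by rewrite B.
by rewrite grun_rcons E.
Qed.

Lemma gnode_env v : gnode v -> controls tok_ocgs env (last tL v) ->
  exists2 k, succ tok_ocgs (last tL v) k & gnode (rcons v k).
Proof.
move=> /gnode_next[k nk _] _; exists k => //.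
by have [] := gnode_rcons nk.
Qed.

Definition gtree : strategy_tree tok_ocgs :=
  @MkStrategyTree _ _ _ _ _ tok_ocgs gnode isT gnode_rcons gnode_sys gnode_env.

Lemma gmain_ext r (H : branch gtree r) k : (forall i, i <= k -> ~~ sysst (r i)) ->
  exists r' (H' : branch gtree r'), (forall i, i <= k -> r' i = r i) /\ main r'.
Proof.
move=> nk.
have [||r' [H' [E P]]] := @extend gtree (fun y => ~~ sysst (last tL (val y))) (tn H k).
- by rewrite -[val _]/(pre r k) last_pre ?H.1 // nk.
- move=> y ny; have [s ns sE] := gnode_next (valP y : gnode (val y)).
  by exists (exist (fun v => node gtree v) _ ns); [rewrite /= last_rcons sE | exists s].
rewrite -[val _]/(pre r k) size_pre in E P.
have A i : i <= k -> r' i = r i by apply: pre_eq E; rewrite H'.1 H.1.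
exists r', H'; split=> // i; case: (leqP i k) => ik; first by rewrite A // nk.
by have := P i (ltnW ik); rewrite -[val _]/(pre r' i) last_pre ?H'.1.
Qed.

Section Follow.
Variables (r : nat -> tok) (H : branch gtree r).

Definition gs (k : nat) : gst := if grun t0 (pre r k) is Some g then g else GF.

Lemma gsE k : grun t0 (pre r k) = Some (gs k).
Proof. by have := H.2 k; rewrite /gs /= /gnode; case: (grun _ _). Qed.

Lemma gs0 : gs 0 = gstart t0. Proof. by []. Qed.

Lemma gsS k : gstep (gs k) (r k.+1) = Some (gs k.+1).
Proof. by have := gsE k.+1; rewrite preS grun_rcons gsE. Qed.

Definition gflag (k : nat) : bool := if gs k is GM true _ _ then true else false.

Lemma gflag_X k : r k.+1 = tX -> gflag k.
Proof.
by move=> X; have := gsS k; rewrite X /gflag; case: (gs k) => //= -[].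
Qed.

Hypothesis mr : main r.

Definition foll (k : nat) (p : seq (tok * bool)) : Prop :=
  forall j, j < size p -> (r (k + j.+1), gflag (k + j.+1)) = nth (tA, false) p j.

Lemma foll_cat k p1 p2 : foll k (p1 ++ p2) <-> foll k p1 /\ foll (k + size p1) p2.
Proof.
split=> [F|[F1 F2] j].
  split=> j jp; first by rewrite F ?nth_cat ?jp // size_cat; lia.
  rewrite -addnA addnS F ?nth_cat ?size_cat; last by lia.
  by rewrite ltnNge leq_addr /= addKn.
rewrite size_cat nth_cat => js; case: ltnP => jp; first exact: F1.
by rewrite -F2; last lia; congr (r _, gflag _); lia.
Qed.

Lemma foll_cons k x p : foll k (x :: p) <->
  [/\ r k.+1 = x.1, gflag k.+1 = x.2 & foll k.+1 p].
Proof.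
rewrite -cat1s foll_cat addn1; split=> [[F1 F2]|[A B F]].
  by have := F1 0 isT; rewrite addn1; case: x {F1} => a b [-> ->].
by split=> // -[|//] _; rewrite addn1 A B -surjective_pairing.
Qed.

Lemma gs_follow k fl p t : gs k = GM fl p t ->
  foll k p /\ exists fl', gs (k + size p) = GM fl' [::] t.
Proof.
elim: p k fl => [|[x f] p IH] k fl E; first by split=> //; exists fl; rewrite addn0.
have S := gsS k; rewrite E /= (negbTE (mr _)) in S.
case: eqP S => // rx [S]; have [F [fl' E']] := IH k.+1 f (esym S).
split; last by exists fl'; rewrite /= addnS -addSn.
by apply/foll_cons; split=> //; rewrite /gflag -S /=; case: (f).
Qed.

Definition hasw (p : nat) (v : seq bool) : Prop :=
  forall j, j < m -> r (p + j.+1) = btok (nth false v j).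

(** The last three clauses say that the blocks of the cell spell exactly the words of [addr i], and
    that challenges are offered exactly at the ends of blocks. *)
Definition cellat (a b i : nat) (l : letter M) : Prop :=
  [/\ a < b, r a = tC, lett r a l, (forall j, a < j <= b -> ~~ spb (r j)) &
      [/\ (forall p, a < p <= b -> r p = tB ->
             [/\ p + m <= b, gflag (p + m) & exists2 v, v \in addr i & hasw p v]),
          (forall v, v \in addr i -> exists p, [/\ a < p, p <= b, r p = tB & hasw p v]) &
          (forall j, a <= j <= b -> gflag j -> exists p, [/\ a < p, r p = tB & p + m = j])]].

Lemma foll_code k n : foll k (code n) -> unp r k n /\
  (forall j, k < j <= k + n.+1 -> bitb (r j) /\ ~~ gflag j).
Proof.
move=> F.
have F0 i : i < n -> (r (k + i.+1), gflag (k + i.+1)) = (b0, false).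
  by move=> ii; rewrite F /code ?size_rcons ?size_nseq ?nth_rcons ?size_nseq ?ii ?nth_nseq ?ii //; lia.
have F1 : (r (k + n.+1), gflag (k + n.+1)) = (b1, false).
  by rewrite F /code ?size_rcons ?size_nseq ?nth_rcons ?size_nseq ?ltnn ?eqxx.
split; first by split=> [i ii|]; [case: (F0 i ii) | case: F1].
move=> j jj; case: (ltngtP j (k + n.+1)) => jn; [|lia|by rewrite jn; case: F1 => -> ->].
have jn' : j - k.+1 < n by lia.
have := F0 _ jn'; have -> : k + (j - k.+1).+1 = j by lia.
by case=> -> ->.
Qed.

Lemma foll_bitt k v : foll k (bitt v) ->
  (forall j, j < size v -> r (k + j.+1) = btok (nth false v j)) /\
  (forall j, j < size v -> gflag (k + j.+1) = (j.+1 == size v)).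
Proof.
elim: v k => [|x v IH] k //= /foll_cons[A B /IH[C D]].
split=> -[|j] jv; rewrite ?addn1 ?A ?B //; first by rewrite -addSnnS; apply: C.
by rewrite -addSnnS D // eqSS.
Qed.

Lemma size_bitt v : size (bitt v) = size v.
Proof. by elim: v => //= x v ->. Qed.

Hypothesis m0 : 0 < m.

(** The flag of a block sits on its last bit, which exists as [0 < m]. *)
Lemma foll_blocks k vs (P := flatten [seq blockt v | v <- vs]) :
    (forall v, v \in vs -> size v = m) -> foll k P ->
  [/\ (forall j, k < j <= k + size P -> ~~ spb (r j)),
      (forall p, k < p <= k + size P -> r p = tB ->
        [/\ p + m <= k + size P, gflag (p + m) & exists2 v, v \in vs & hasw p v]),
      (forall v, v \in vs -> exists p, [/\ k < p, p <= k + size P, r p = tB & hasw p v]) &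
      (forall j, k < j <= k + size P -> gflag j -> exists p, [/\ k < p, r p = tB & p + m = j])].
Proof.
rewrite {}/P; elim: vs k => [|v vs IH] k sz.
  by move=> _; split=> //= j; lia.
rewrite -[flatten _]/(blockt v ++ flatten [seq blockt v | v <- vs]).
set P := flatten _ in IH *.
move=> /foll_cat[/foll_cons[rB fB /foll_bitt[Bv Fv]] F].
have szv : size v = m by apply: sz; rewrite mem_head.
have szb : size (blockt v) = m.+1 by rewrite /= size_bitt szv.
rewrite szb in F; rewrite szv in Bv Fv.
have [|I1 I2 I3 I4] := IH _ _ F; first by move=> u uv; apply: sz; rewrite inE uv orbT.
rewrite size_cat szb.
have bit j : k.+1 < j <= k + m.+1 -> exists2 i, i < m & j = k.+1 + i.+1.
  by move=> jj; exists (j - k.+2); lia.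
have hw : hasw k.+1 v by move=> j jm; apply: Bv.
split.
- move=> j jj; case: (ltngtP j k.+1) => jk; [lia| |by rewrite jk rB].
  case: (leqP j (k + m.+1)) => jm; last by apply: I1; lia.
  by have [|i im ->] := bit j; [lia|rewrite Bv //; case: (nth _ _ _)].
- move=> p pp Bp; case: (ltngtP p k.+1) => pk; [lia| |].
    case: (leqP p (k + m.+1)) => pm.
      by have [|i im E] := bit p; [lia|rewrite E Bv // in Bp; case: (nth _ _ _) Bp].
    have [|A B [u uv hu]] := I2 p _ Bp; first lia.
    by split=> //; [lia|exists u; rewrite ?inE ?uv ?orbT].
  rewrite pk; split; [lia| |by exists v; rewrite ?mem_head].
  by have := Fv m.-1; rewrite prednK // eqxx => ->.
- move=> u; rewrite inE => /orP[/eqP ->|/I3[p [p1 p2 p3 p4]]].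
    by exists k.+1; split=> //; lia.
  by exists p; split=> //; lia.
- move=> j jj fj; case: (ltngtP j k.+1) => jk; [lia| |by rewrite jk fB in fj].
  case: (leqP j (k + m.+1)) => jm; last first.
    by have [|p [p1 p2 p3]] := I4 j _ fj; [lia|exists p; split=> //; lia].
  have [|i im E] := bit j; first lia.
  move: fj; rewrite E Fv // => /eqP im'; exists k.+1; split=> //; lia.
Qed.

Hypothesis addr_size : forall i v, v \in addr i -> size v = m.

Lemma foll_cell k i l : addr i != [::] -> foll k (cellt i l) ->
  cellat k.+1 (k + size (cellt i l)) i l.
Proof.
move=> an /foll_cons[rC fC /foll_cat[/foll_code[u1 c1] /foll_cat[/foll_code[u2 c2] FB]]].
have szc n : size (code n) = n.+1 by rewrite size_rcons size_nseq.
rewrite !szc in FB u2 c2.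
have [B1 B2 B3 B4] := foll_blocks (@addr_size i) FB.
set s1 := (rk l.1).+1 in u2 c2 FB B1 B2 B3 B4; set s2 := (lcode l.2).+1 in c2 FB B1 B2 B3 B4.
set P := flatten _ in FB B1 B2 B3 B4; have c1' := c1 : forall j, k.+1 < j <= k.+1 + s1 -> _.
have -> : k + size (cellt i l) = k.+1 + s1 + s2 + size P.
  by rewrite /= !size_cat !szc -/s1 -/s2 -/P; lia.
have bits j : k.+1 < j <= k.+1 + s1 + s2 -> bitb (r j) /\ ~~ gflag j.
  by move=> jj; case: (leqP j (k.+1 + s1)) => js; [apply: c1'|apply: c2]; lia.
split=> //.
- by rewrite /s1; lia.
- move=> j jj; case: (leqP j (k.+1 + s1 + s2)) => js; last by apply: B1; lia.
  by have [|] := bits j; [lia|case: (r j)].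
split.
- move=> p pp Bp; apply: B2 => //; case: (leqP p (k.+1 + s1 + s2)) => ps; last lia.
  by have [|] := bits p; [lia|rewrite Bp].
- by move=> v /B3[p [p1 p2 p3 p4]]; exists p; split=> //; lia.
move=> j jj fj; case: (leqP j (k.+1 + s1 + s2)) => js; last first.
  by have [|p [p1 p2 p3]] := B4 j _ fj; [lia|exists p; split=> //; lia].
case: (ltngtP j k.+1) => jk; [lia| |by rewrite jk fC in fj].
by have [|_] := bits j; [lia|rewrite fj].
Qed.

(* [a] is the last position before the cells, [h] the first one after them. *)
Fixpoint cells (a : nat) (ps : seq nat) (rw : seq (letter M)) (i h : nat) : Prop :=
  match ps, rw with
  | [::], [::] => a.+1 = h
  | c :: ps', l :: rw' => c = a.+1 /\ exists2 b, cellat c b i l & cells b ps' rw' i.+1 h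
  | _, _ => False
  end.

Lemma foll_row k i rw : (forall j, j < i + size rw -> addr j != [::]) -> foll k (rowt i rw) ->
  exists ps, cells k ps rw i (k + size (rowt i rw)).+1.
Proof.
elim: rw k i => [|l rw IH] k i an; first by exists [::] => /=; rewrite addn0.
move=> /foll_cat[F1 F2].
have [|ps C] := IH _ _ _ F2; first by move=> j ji; apply: an => /=; lia.
exists (k.+1 :: ps) => /=; split=> //; exists (k + size (cellt i l)).
  by apply: foll_cell => //; apply: an => /=; lia.
by move: C; rewrite -addnA -size_cat.
Qed.

End Follow.
End Gen.

(** Counts the cells begun since the last header; sys recovers from it the indices of the cells that
    it compares. *)
Definition cnt (v : seq tok) : nat :=
  foldl (fun n t => if hdb t then 0 else if t == tC then n.+1 else n) 0 v.

Lemma cnt_pre r k : cnt (pre r k.+1) =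
  if hdb (r k.+1) then 0 else if r k.+1 == tC then (cnt (pre r k)).+1 else cnt (pre r k).
Proof. by rewrite preS /cnt -cats1 foldl_cat. Qed.

(** * Cells on a branch of the generated tree *)

Section Cells.
Variables (M : ATM) (m : nat) (addr : nat -> seq (seq bool)) (t0 : rtree M) (r : nat -> tok).
Notation cells := (@cells M m addr t0 r).
Notation cellat := (@cellat M m addr t0 r).

Lemma cells_size a ps rw i h : cells a ps rw i h -> size ps = size rw /\ a < h.
Proof.
elim: ps a rw i => [|c ps IH] a [|l rw] i //=; first by move=> <-.
by move=> [-> [b [ab _ _ _ _] /IH[-> bh]]]; split=> //; lia.
Qed.

Lemma cells_lets a ps rw i h : cells a ps rw i h -> lets r ps rw.
Proof.
elim: ps a rw i => [|c ps IH] a [|l rw] i //= [-> [b [_ _ lc _ _] /IH L]].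
by split.
Qed.

Lemma cells_rowp a0 a ps rw i h : cells a ps rw i h -> hdb (r h) ->
  a0 <= a -> (forall j, a0 < j <= a -> ~~ spb (r j)) -> rowp r a0 ps h.
Proof.
elim: ps a0 a rw i => [|c ps IH] a0 a [|l rw] i //=.
  move=> <- hh aa ns; split=> //; split; [lia|by case: (r _) hh|].
  by move=> j jj; apply: ns; lia.
move=> [-> [b [ab Cc _ nb _] C]] hh aa ns; split=> //.
  by split; [lia|rewrite Cc|move=> j jj; apply: ns; lia].
by apply: IH C hh _ _ => //; lia.
Qed.

Lemma cells_nth a ps rw i h j : cells a ps rw i h -> hdb (r h) -> j < size ps ->
  exists b, [/\ cellat (nth h ps j) b (i + j) (nth (l0 M) rw j), a < nth h ps j,
     b.+1 = nth h ps j.+1, b < h & nx r (nth h ps j) (nth h ps j.+1)].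
Proof.
move=> C hh; elim: ps a rw i j C => [|c ps IH] a [|l rw] i j //= [-> [b cc C]].
have [_ bh] := cells_size C; have [ab Cc _ nb _] := cc; case: j => [_|j js] /=.
  have nE : nth h ps 0 = b.+1 by case: ps rw C {IH} => [|x ps] [|y rw] //=; case.
  exists b; rewrite addn0 nE; split=> //; split; [lia| |by move=> x xx; apply: nb; lia].
  case: ps rw C {IH nE} => [|x ps] [|y rw] //=; first by move=> ->; case: (r h) hh.
  by move=> [xE [b' [_ Cx _ _ _] _]]; rewrite -xE Cx.
have [b' [c1 c2 c3 c4 c5]] := IH _ _ _ _ C js.
by exists b'; rewrite addnS -addSn; split=> //; lia.
Qed.

Lemma cells_cover a ps rw i h x : cells a ps rw i h -> a < x < h ->
  exists j b, [/\ j < size ps, cellat (nth h ps j) b (i + j) (nth (l0 M) rw j),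
     nth h ps j <= x <= b & b < h].
Proof.
elim: ps a rw i => [|c ps IH] a [|l rw] i //=; first by move=> <-; lia.
move=> [-> [b cc C]] xx; have [_ bh] := cells_size C.
case: (leqP x b) => xb; first by exists 0, b; rewrite addn0; split=> //=; lia.
have [|j [b' [c1 c2 c3 c4]]] := IH _ _ _ C; first by lia.
by exists j.+1, b'; rewrite addnS -addSn.
Qed.

Lemma cnt_cell a b i l : cellat a b i l -> forall j, a <= j <= b -> cnt (pre r j) = cnt (pre r a).
Proof.
move=> [ab _ _ nb _] j /andP[aj jb]; rewrite -(subnKC aj).
have: a + (j - a) <= b by lia.
elim: (j - a) => [|n IH]; first by rewrite addn0.
rewrite addnS => nb'; rewrite cnt_pre IH; last lia.
have: ~~ spb (r (a + n).+1) by apply: nb; lia.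
by case: (r _).
Qed.

Lemma cnt_cells a ps rw i h j n : cells a ps rw i h -> cnt (pre r a) = n -> j < size ps ->
  cnt (pre r (nth h ps j)) = (n + j).+1.
Proof.
elim: ps a rw i j n => [|c ps IH] a [|l rw] i j n //= [-> [b cc C]] cn.
have [ab Cc _ nb _] := cc.
have E : cnt (pre r a.+1) = n.+1 by rewrite cnt_pre Cc /= cn.
case: j => [_|j js] /=; first by rewrite addn0.
rewrite (IH _ _ _ _ n.+1 C) ?addnS ?addSn //.
by rewrite (cnt_cell cc) //; lia.
Qed.

Lemma cnt_hd h : hdb (r h) -> cnt (pre r h) = 0.
Proof. by case: h => // h hh; rewrite cnt_pre hh. Qed.

End Cells.

Lemma gs_agr (M : ATM) (addr : nat -> seq (seq bool)) (t0 : rtree M) r r' k :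
  (forall i, i <= k -> r i = r' i) -> gs addr t0 r k = gs addr t0 r' k.
Proof. by move=> E; rewrite /gs (@eq_pre r r' k). Qed.

(** * The winning strategy of sys in the generated tree *)

Section Verify.
Variables (M : ATM) (m N : nat) (addr : nat -> seq (seq bool)).
Hypothesis m0 : 0 < m.
Hypothesis addr_size : forall i v, v \in addr i -> size v = m.
Hypothesis addr_ne : forall i, i < N -> addr i != [::].
Hypothesis addr_sep : forall i j, i < N -> j < N -> i != j ->
  has (fun v => v \notin addr j) (addr i).

(** A row with a single child must show no universal state, since [puni] would then ask for the
    other direction too. *)
Fixpoint rvalid (t : rtree M) : Prop :=
  size (rrow t) = N /\
  match t with
  | RLeaf rw => exists i q, [/\ i < N, (nth (l0 M) rw i).2 = Some q & q \in final M]
  | RNode1 rw b t1 =>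
      [/\ forall i q, i < N -> (nth (l0 M) rw i).2 = Some q -> q \notin universal M,
          stepg b None rw (rrow t1) & rvalid t1]
  | RNode2 rw t1 t2 =>
      [/\ stepg false None rw (rrow t1), stepg true None rw (rrow t2), rvalid t1 & rvalid t2]
  end.

Lemma rvalid_size t : rvalid t -> size (rrow t) = N.
Proof. by case: t => [rw|rw b t|rw t1 t2] []. Qed.

Lemma rvalid_child t b t1 : rvalid t -> rchild t b = Some t1 ->
  rvalid t1 /\ stepg b None (rrow t) (rrow t1).
Proof.
case: t => [rw|rw b' t'|rw t' t''] //= [_].
  by move=> [_ S V]; case: eqP => // -> [<-].
by move=> [S1 S2 V1 V2] [<-]; case: b.
Qed.

Variable t0 : rtree M.
Hypothesis t0v : rvalid t0.
Notation T := (gtree addr t0).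
Notation gs := (gs addr t0).

Section MainBranch.
Variables (r : nat -> tok) (H : branch T r).
Hypothesis mr : main r.
Notation cells := (@cells M m addr t0 r).
Notation cellat := (@cellat M m addr t0 r).

Lemma row_at h t : gs r h = gstart addr t -> rvalid t ->
  exists ps h', [/\ cells h ps (rrow t) 0 h', hdb (r h'), (exists fl, gs r h'.-1 = GM fl [::] t) &
    (rleaf t /\ (r h' = tA /\ gs r h' = GF M)) \/
    exists b t1, [/\ rchild t b = Some t1, r h' = br b & gs r h' = gstart addr t1]].
Proof.
move=> E V; have sz := rvalid_size V.
have [F [fl E']] := gs_follow H mr E.
have [|ps C] := @foll_row M m addr t0 r m0 addr_size h 0 (rrow t) _ F.
  by move=> j; rewrite sz; apply: addr_ne.
set h' := _.+1 in C; exists ps, h'.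
have := gsS H (h + size (rowt addr 0 (rrow t))); rewrite E' -/h' /= (negbTE (mr h')).
case hE: (r h') => //=.
- case ch: (rchild t false) => [t1|] //= [<-]; split=> //; [by exists fl|right].
  by exists false, t1.
- case ch: (rchild t true) => [t1|] //= [<-]; split=> //; [by exists fl|right].
  by exists true, t1.
- by case lf: (rleaf t) => // -[<-]; split=> //; [exists fl|left].
Qed.

Lemma gs_GF h : r h = tA -> gs r h = GF M -> forall k, h <= k -> r k = tA.
Proof.
move=> Ah Gh k hk; rewrite -(subnKC hk).
suff : r (h + (k - h)) = tA /\ gs r (h + (k - h)) = GF M by case.
elim: (k - h) => [|n [IH1 IH2]]; first by rewrite addn0.
have := gsS H (h + n); rewrite IH2 addnS /=.
by case: eqP => // -> [<-].
Qed.

Definition inrow (k : nat) : Prop :=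
  exists h t ps h', [/\ h <= k < h', gs r h = gstart addr t, rvalid t, lrb (r h) &
    cells h ps (rrow t) 0 h' /\ hdb (r h')].

Lemma br_lr b : lrb (br b). Proof. by case: b. Qed.

Lemma cover h t : gs r h = gstart addr t -> rvalid t -> lrb (r h) ->
  (forall k, h <= k -> inrow k \/ r k = tA) /\ exists f, r f = tA.
Proof.
(* The measure is the number of inner nodes: the generator descends in a finite tree, hence reaches
   a leaf and then [tA]. *)
have [n] := ubnP ((fix sz t := match t with
   | RLeaf _ => 0 | RNode1 _ _ t1 => (sz t1).+1 | RNode2 _ t1 t2 => (sz t1 + sz t2).+1 end) t).
elim: n h t => // n IH h t tn E V lh; have [ps [h' [C hh' _ K]]] := row_at E V.
have [_ hlt] := cells_size C.
have inr k : h <= k < h' -> inrow k by move=> kk; exists h, t, ps, h'.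
case: K => [[_ [Ah Gh]]|[b [t1 [ch bh E1]]]].
  split; last by exists h'.
  move=> k hk; case: (ltnP k h') => kh; first by left; apply: inr; lia.
  by right; apply: gs_GF Ah Gh _ kh.
have [V1 _] := rvalid_child V ch.
have [||A B] := IH h' t1 _ E1 V1.
- move: tn ch; case: (t) => [rw|rw b' t'|rw t' t''] //=; first by case: eqP => // _ L [<-].
  by move=> L [<-]; case: (b); lia.
- by rewrite bh br_lr.
by split=> // k hk; case: (ltnP k h') => kh; [left; apply: inr; lia | apply: A].
Qed.

Hypothesis r0 : r 0 = tL.
Lemma cover0 : (forall k, inrow k \/ r k = tA) /\ exists f, r f = tA.
Proof.
have [|A B] := cover (gs0 addr t0 r) t0v; first by rewrite r0.
by split=> // k; apply: A.
Qed.

Lemma B_in_cell p : r p = tB -> exists a b i l, [/\ cellat a b i l, a < p <= b & i < N].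
Proof.
move=> Bp; have [cov _] := cover0; have [|A] := cov p; last by rewrite A in Bp.
move=> [h [t [ps [h' [hp E V lh [C hh]]]]]].
have hp' : h < p < h'.
  case/andP: hp; rewrite leq_eqVlt => /orP[/eqP e|-> -> //].
  by rewrite e Bp in lh.
have [j [b [js cc pb bh]]] := cells_cover C hp'.
have [_ Cc _ _ _] := cc; exists (nth h' ps j), b, (0 + j), (nth (l0 M) (rrow t) j); split=> //.
  rewrite ltn_neqAle; case: eqP => /= [e|_]; last by case/andP: pb => -> ->.
  by rewrite e Bp in Cc.
by rewrite -(rvalid_size V); have [<- _] := cells_size C.
Qed.

Lemma g_blocky : blocky m r.
Proof.
move=> p Bp j jm; have [a [b [i [l [cc pb _]]]]] := B_in_cell Bp.
have [_ _ _ _ [c1 _ _]] := cc; have [_ _ [v va hv]] := c1 p pb Bp.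
by rewrite hv // /btok; case: nth.
Qed.

Lemma g_flag p : r p = tB -> gflag addr t0 r (p + m).
Proof.
move=> Bp; have [a [b [i [l [cc pb _]]]]] := B_in_cell Bp.
by have [_ _ _ _ [c1 _ _]] := cc; have [] := c1 p pb Bp.
Qed.

Lemma X_child k : gflag addr t0 r k ->
  exists r' (H' : branch T r'), (forall i, i <= k -> r' i = r i) /\ r' k.+1 = tX.
Proof.
rewrite /gflag => fk; have nX : node T (rcons (pre r k) tX).
  by rewrite /= /gnode grun_rcons (gsE H) /=; case: (gs r k) fk => //= -[].
have [||r' [H' [E _]]] := @extend T (fun=> True) (exist (fun v => node T v) _ nX) => //.
  by move=> y _; have [s ns] := tree_total y; exists (exist (fun v => node T v) _ ns) => //; exists s.
rewrite /= size_rcons size_pre preS in E; have [E1 E2] := rcons_inj E.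
by exists r', H'; split=> // i ik; apply: (pre_eq _ E1 ik); rewrite H'.1 r0.
Qed.

End MainBranch.
Lemma rowp_nx r a ps h j : rowp r a ps h -> j <= size ps ->
  nx r (nth h (a :: ps) j) (nth h ps j).
Proof.
elim: ps a j => [|c ps IH] a j /=; first by move=> [Na _]; case: j.
by move=> [Na _ R]; case: j => [|j] //= js; apply: IH.
Qed.

(** Entry [j] of [a :: ps] is the special token before cell [j], which is where [symok] and [headok]
    are evaluated. *)
Lemma content_ok r a ps (rw : seq (letter M)) h b ps' rw' h' d j :
    rowp r a ps h -> rowp r b ps' h' -> lets r ps rw -> lets r ps' rw' ->
    stepg d None rw rw' -> j < size ps' ->
  symok M r d (nth h (a :: ps) j) (nth h' ps' j) /\ headok M r d (nth h (a :: ps) j) (nth h' ps' j).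
Proof.
move=> R R' /lets_nth[sz L] /lets_nth[sz' L'] /stepgP[ss S] js.
have jr : j < size rw' by rewrite -sz'.
have jp : j < size ps by rewrite sz; lia.
have [cs ch] := S j jr.
have Ly : lett r (nth h' ps' j) (nth (l0 M) rw' j) by rewrite (set_nth_default 0) //; apply: L'.
have Lp i : i < size ps -> lett r (nth h ps i) (nth (l0 M) rw i).
  by move=> ip; rewrite (set_nth_default 0) //; apply: L.
have Lj := Lp j jp; have Nj := rowp_nx R (ltnW jp).
have [sy hy] := (proj1 (letisE _ _ _ _)) Ly; split.
  move: cs Lj; case: (nth _ rw j) => s [q|] /= cs Lj.
    by right; exists q, s, (nth h ps j); split=> //; rewrite -cs.
  by left; exists s, (nth h ps j); split=> //; rewrite -cs.
case: ch => [e|[q [s [A B]]]]; first by left; rewrite e in hy.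
right; exists q, s; split; last by rewrite B in hy.
have lnP i l : lnth rw i = Some l -> i < size ps /\ nth (l0 M) rw i = l.
  by rewrite /lnth -sz; case: ifP => // ii [].
case: (tri d q s).2 A => [/lnP[ip E]|].
  exists (nth h ps j), (nth h ps j.+1); split=> //; first exact: (rowp_nx R (ltnW ip)).
  by have := Lp _ ip; rewrite E.
case: j js jr jp cs Ly Lj Nj sy hy B => [|j] //= js jr jp cs Ly Lj Nj sy hy B /lnP[ip E].
by have := Lp _ ip; rewrite E.
Qed.

Definition sep (i j : nat) : seq bool :=
  nth [::] (addr i) (find (fun v => v \notin addr j) (addr i)).

Lemma sepP i j : i < N -> j < N -> i != j -> sep i j \in addr i /\ sep i j \notin addr j.
Proof.
move=> iN jN ij; have hs := addr_sep iN jN ij; split; last exact: (nth_find [::] hs).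
by apply: mem_nth; rewrite -has_find.
Qed.

Lemma br_inj : injective br. Proof. by case; case. Qed.

(** If the current cell and [y'] have distinct indices, sys wins by a word separating their
    addresses; if the ranks agree, [x] and [y] have the same address and [stepg] makes the letter
    correct. *)
Lemma coal r (H : branch T r) h t k d : main r ->
    gs r h = gstart addr t -> rvalid t -> lrb (r h) -> h <= k -> (k = h \/ r k = tC) ->
    (forall j, h < j <= k -> ~~ hdb (r j)) ->
  sat (tree_cgs T) (tn H k) (SCoal [set sys] (pbody M m d)).
Proof.
move=> mr E V lh hk kk nhk.
(* [cnt v] is one more than the index of [y], so the cell [y'] has index [cnt v - 2]; a current cell
   has index [cnt (pre r k) - 1]. Truncation at headers is harmless: a header against a cell
   violates [psame], and two headers do not need the word. *)
apply: (@sys_intro T r H k _ (fun v j => nth false (sep (cnt v - 2) (cnt (pre r k) - 1)) j)) => //.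
move=> c Hc agk out.
have [ant|nant] := classic (ev (ssb Hc) k (pand (prow d) psame)); last by apply/ev_imp.
move: (ant); rewrite ev_and /prow ev_X ev_until => -[[h1 [kh1]] + nh1] _.
rewrite ev_and (ev_pa (ssbA Hc)) => -[rh1]; rewrite ev_X ev_until => -[z [h1z]].
rewrite (ev_pa (ssbA Hc)) => Xz nhz.
have exX : exists i, c i == tX by exists z; rewrite Xz.
have [e [Xe ke fst]] : exists e, [/\ c e.+1 = tX, k <= e & forall i, i <= e -> c i != tX].
  case: (ex_minnP exX) => -[|e] /eqP Xe emin.
    by have := agk 0 isT; rewrite Xe => X0; have := mr 0; rewrite -X0.
  exists e; split=> //; last by move=> i ie; apply/negP => /emin; lia.
  rewrite leqNgt; apply/negP => ek; have := agk e.+1 ek.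
  by rewrite Xe => X0; have := mr e.+1; rewrite -X0.
have nsys i : i <= e -> ~~ sysst (c i).
  elim: i => [_|i IH ie]; first by rewrite Hc.1.
  have := branch_succ Hc i; rewrite (negbTE (IH (ltnW ie))); have := fst _ ie.
  by case: (c i.+1).
have after i : e.+1 < i -> zbit (c i).
  move=> pi; rewrite -(subnKC pi); elim: (i - _) => [|n IH].
    by rewrite addn0 -(branch_succ Hc) Xe.
  by rewrite addnS -(branch_succ Hc); case: (c _) IH.
have h1e : h1 <= e.
  rewrite leqNgt; apply/negP => eh; case: (ltngtP h1 e.+1) => K; [lia| |].
    by have := after _ K; rewrite rh1; case: (d).
  by rewrite K Xe in rh1; case: (d) rh1.
have zE : z = e.+1.
  case: (ltngtP z e.+1) => K //.
    by have := fst z K; rewrite Xz.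
  by have := after _ K; rewrite Xz.
subst z.
have [r2 [H2 [E2 m2]]] := gmain_ext Hc nsys.
have agr i : i <= e -> c i = r2 i by move=> ie; rewrite E2.
have agr' i : i <= k -> r2 i = r i by move=> ik; rewrite -agr ?agk //; lia.
have E' : gs r2 h = gstart addr t.
  by rewrite -E; apply: gs_agr => i ih; apply: agr'; lia.
have [ps [h' [C hh' _ K]]] := row_at H2 m2 E' V.
have [szp hlt] := cells_size C.
have lh2 : lrb (r2 h) by rewrite agr'.
have R : rowp r2 h ps h' by apply: (cells_rowp C) => // j jj; lia.
have kh' : k < h'.
  rewrite ltnNge; apply/negP => K'; have := nhk h'; rewrite hlt K' -agr' // hh'.
  by move/(_ isT).
have h1E : h1 = h'.
  case: (ltngtP h1 h') => K' //.
    have := rowp_nohd R (j := h1); rewrite K' -agr // rh1.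
    by move=> F; have : false by have := F ltac:(lia); case: (d).
  have := nh1 h'; rewrite ev_N (ev_hd (ssbA Hc)) agr; last lia.
  by rewrite hh' => F; case: F => //; lia.
subst h1; have rh' : r2 h' = br d by rewrite -agr.
case: K => [[_ [A _]]|[b [t1 [ch]]]]; first by rewrite A in rh'; case: (d) rh'.
rewrite rh' => /br_inj bd E1; subst b.
have [V1 S] := rvalid_child V ch.
have [ps' [h'' [C' hh'' _ _]]] := row_at H2 m2 E1 V1.
have [szp' hlt'] := cells_size C'.
have R' : rowp r2 h' ps' h'' by apply: (cells_rowp C') => // j jj; lia.
have eh'' : e < h''.
  rewrite ltnNge; apply/negP => K; have := nhz h''; rewrite ev_N (ev_hd (ssbA Hc)) agr //.
  by rewrite hh'' => F; case: F => //; lia.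
have fe : gflag addr t0 r2 e.
  have := gflag_X Hc Xe; rewrite /gflag (@gs_agr M addr t0 c r2 e) //.
have h'e : h' < e.
  rewrite ltn_neqAle h1e andbT; apply/eqP => K.
  by move: fe; rewrite -K /gflag E1.
have hee : h' < e < h'' by rewrite h'e eh''.
have [j [b [js cc yb bh]]] := cells_cover C' hee.
move: cc; rewrite add0n => cc.
set y := nth h'' ps' j in cc yb; pose y' := nth h'' (h' :: ps') j.
have [yltb Cy Ly nby [c1 c2 c3]] := cc.
have [p [yp Bp pe]] := c3 e yb fe.
have N1 : nx r2 y' y by apply: (rowp_nx R'); apply: ltnW.
have ip : inC r2 y p by split=> // i ii; apply: nby; lia.
have blk : blocky m r2 by apply: g_blocky H2 m2 H2.1.
have hd0 : cnt (pre r2 h) = 0 by apply: cnt_hd; case: (r2 h) lh2.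
have hd1 : cnt (pre r2 h') = 0 by apply: cnt_hd.
have [ik [iks kE cntk]] : exists ik, [/\ ik <= size ps, k = nth h' (h :: ps) ik & cnt (pre r2 k) = ik].
  case: kk => [->|Ck]; first by exists 0.
  have kps : k \in ps.
    apply: (rowp_mem R); last by rewrite agr'.
    rewrite kh' andbT ltn_neqAle hk andbT; apply/eqP => K.
    by rewrite -K in Ck; rewrite Ck in lh.
  have ki : index k ps < size ps by rewrite index_mem.
  exists (index k ps).+1; split=> //=; first by rewrite nth_index.
  by have := cnt_cells C hd0 ki; rewrite nth_index.
have cnte : cnt (pre c e.+1) = j.+1.
  rewrite cnt_pre Xe /= (@eq_pre c r2 e) // (cnt_cell cc) //.
  by have := cnt_cells C' hd1 js.
have wE : pre r k = pre r2 k by apply: eq_pre => i ik'; rewrite agr'.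
have hy' : h' <= y'.
  rewrite /y'; case: (j) js => [|j'] //= js.
  by have [/andP[]] := rowp_nth R' (ltnW js); rewrite (set_nth_default h'') //; lia.
have Cy' : 0 < j -> r2 y' = tC.
  rewrite /y'; case: (j) js => // j' /= js _.
  by have [_] := rowp_nth R' (ltnW js); rewrite (set_nth_default h'') // ltnW.
have sy' : spb (r2 y').
  case: (posnP j) => [j0|/Cy' -> //]; rewrite /y' j0 /=.
  by case: (r2 h') hh'.
have sk : spb (r2 k).
  case: kk => [->|Ck]; first by case: (r2 h) lh2.
  by rewrite agr' // Ck.
have nh2 i : h' < i <= e -> ~~ hdb (r2 i) by move=> ii; apply: (rowp_nohd R'); lia.
have nh3 i : k < i < h' -> ~~ hdb (r2 i) by move=> ii; apply: (rowp_nohd R); lia.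
apply/(@ev_body M m r2 c e _ (ssbT Hc) (ssbA Hc) agr Xe after m2 blk k h' y' y p d
  sk kh' nh3 rh' hy' nh2 sy' N1 Cy ip pe) => same.
have sN : size ps = N by rewrite szp rvalid_size.
have sN' : size ps' = N by rewrite szp' rvalid_size.
have Ckk i : i < size ps -> r2 (nth h' ps i) = tC.
  by move=> ii; have [_] := rowp_nth R ii; rewrite (set_nth_default h').
(* [ik] and [j] are the ranks of the current token and of [y'] in their rows, headers having rank 0;
   the cells [x] and [y] that follow thus have indices [ik] and [j]. *)
case: (eqVneq ik j) => [ikj|nij]; [right|left].
  have [so ho] := content_ok R R' (cells_lets C) (cells_lets C') S js.
  rewrite -ikj -kE ikj -/y in so ho.
  have jp : j < size ps by rewrite sN -sN'.
  split=> //; exists (nth h' ps j).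
  have Nx : nx r2 k (nth h' ps j) by rewrite kE ikj; apply: (rowp_nx R); apply: ltnW.
  split=> //; first exact: Ckk.
  have [_ _ [v va hv]] := c1 p ltac:(lia) Bp.
  have [b' [cc' _ _ _ _]] := cells_nth C hh' jp.
  have [_ _ _ nb' [_ d2 _]] := cc'; have [p2 [q1 q2 q3 q4]] := d2 v va.
  exists p2; first by split=> // i ii; apply: nb'; lia.
  by move=> i im; rewrite q4 // hv.
have [i iE] : exists i, ik = i.+1.
  case: (ik) nij kE => [|i]; last by exists i.
  move=> nj kE; exfalso; rewrite /= in kE.
  have Ch : r2 h = tC by rewrite -kE; apply/same/Cy'; lia.
  by rewrite Ch in lh2.
have ii : i < size ps by rewrite iE in iks.
have kE' : k = nth h' ps i by rewrite kE iE.
have [j' jE] : exists j', j = j'.+1.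
  case: (posnP j) => [j0|]; last by case: (j) => // j'; exists j'.
  have : r2 h' = tC by rewrite -[h']/(nth h'' (h' :: ps') 0) -j0; apply/same; rewrite kE'; apply: Ckk.
  by move=> K; rewrite K in hh'.
have jj' : j' < size ps' by rewrite jE in js; apply: ltnW.
have j'N : j' < N by rewrite -sN'.
have iN : i < N by rewrite -sN.
have nji : j' != i by move: nij; rewrite jE iE eqSS eq_sym.
have [uj ui] := sepP j'N iN nji; set u := sep j' i in uj ui.
have cu jx : c (e.+1 + jx.+1) = if nth false u jx then z1 else z0.
  rewrite (out e.+1 jx Xe _ (fun i ie => fst i ie)) ?ltnS // cnte wE cntk iE jE.
  by rewrite !subSS !subn0.
have vvE p1 : (forall jx, jx < m -> (r2 (p1 + jx.+1) = b1 <-> nth false u jx)) <-> vv m r2 c e p1.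
  split=> K jx jm; have := K jx jm; rewrite cu; case: (nth false u jx) => // -[K1 K2].
  - by split=> // _; apply: K2.
  - by split=> // /K1.
  - by split=> // _; apply: K2.
  - by split=> // /K1.
have y'E : y' = nth h'' ps' j' by rewrite /y' jE.
split.
  have [b' [cc' _ _ _ _]] := cells_nth C' hh'' jj'.
  rewrite -y'E in cc'; have [_ _ _ nb' [_ d2 _]] := cc'.
  have [p1 [q1 q2 q3 q4]] := d2 u uj.
  exists p1; first by split=> // x xx; apply: nb'; lia.
  by apply/vvE => jx jm; rewrite q4 //; case: (nth false u jx).
move=> [p2 i2 /vvE v2].
have [b' [cc' _ bE _ Nk]] := cells_nth C hh' ii; rewrite -kE' in cc' Nk.
have [_ _ _ nb' [d1 _ _]] := cc'; have [kp2 Bp2 np2] := i2.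
have p2b : p2 <= b'.
  have := inC_le blk i2 (_ : spb (r2 b'.+1)).
  rewrite bE; case: Nk => K1 K2 _ => /(_ K2 K1); lia.
have [_ _ [v va hv]] := d1 p2 ltac:(lia) Bp2.
case/negP: ui; suff -> : u = v by [].
apply: (@eq_from_nth _ false); first by rewrite (addr_size uj) (addr_size va).
move=> x; rewrite (addr_size uj) => xm; have := v2 x xm; rewrite hv //.
by case: (nth false u x); case: (nth false v x) => //= -[]; [move=> _ /(_ isT) | move=> /(_ erefl)].
Qed.

End Verify.

Section TreeSatisfies.
Variables (M : ATM) (m N : nat) (addr : nat -> seq (seq bool)).
Hypothesis m0 : 0 < m.
Hypothesis N0 : 0 < N.
Hypothesis addr_size : forall i v, v \in addr i -> size v = m.
Hypothesis addr_ne : forall i, i < N -> addr i != [::].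
Hypothesis addr_sep : forall i j, i < N -> j < N -> i != j ->
  has (fun v => v \notin addr j) (addr i).
Variable t0 : rtree M.
Hypothesis t0v : rvalid N t0.
Notation T := (gtree addr t0).
Notation gs := (gs addr t0).
Variable w : seq (sym M).

Definition blanks (n : nat) : seq (letter M) := nseq n (l0 M).
Definition wrow (n n' : nat) : seq (letter M) :=
  blanks n ++ (head (blank M) w, Some (start M)) :: [seq (s, None) | s <- behead w] ++ blanks n'.
Hypothesis t0w : exists n n', rrow t0 = wrow n n'.

Lemma sys_mono r (H : branch T r) i j : i <= j -> sysst (r i) -> sysst (r j).
Proof.
move=> ij si; rewrite -(subnKC ij); elim: (j - i) => [|n IH]; first by rewrite addn0.
by rewrite addnS; move: IH; rewrite (branch_succ H); case: (r _.+1).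
Qed.

Lemma blanks_to r a ps h n : rowp r a ps h -> lets r ps (blanks n) -> @blankto M r a h.
Proof.
move=> R L j jj; split; first exact: (rowp_nohd R).
move=> Cj; have jp := rowp_mem R jj Cj; have [sz Ln] := lets_nth L.
have ji : index j ps < size ps by rewrite index_mem.
by have := Ln _ ji; rewrite nth_index // nth_nseq; case: ifP.
Qed.

Section InitialRow.
Variables (r : nat -> tok) (H : branch T r).

Lemma ev_ini ws a ps h n : rowp r a ps h ->
  lets r ps ([seq (s, None) | s <- ws] ++ blanks n) -> ev (ssb H) a (pini ws).
Proof.
elim: ws a ps => [|s ws IH] a ps R.
  move=> L; rewrite -[pini _]/(ptail M) /ptail ev_X ev_until; exists h.
  split; [exact: rowp_lt R|by rewrite (ev_hd (ssbA H)); apply: rowp_hd R|].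
  by move=> j jj; apply/ev_pblank; apply: (blanks_to R L).
case: ps R => [_ []|c ps [N1 Cc R] [Lc L]].
rewrite -[pini _]/(pnx (pand (plet (rk s) 0) (pini ws))) (ev_pnx (ssbA H)).
exists c => //; rewrite ev_and (ev_let (ssbT H) (ssbA H)); split=> //.
exact: IH R L.
Qed.

Lemma ev_init0 ws a ps h n n' s q : rowp r a ps h ->
  lets r ps (blanks n ++ (s, Some q) :: [seq (s, None) | s <- ws] ++ blanks n') ->
  exists i, [/\ a < i, blankto M r a i, lett r i (s, Some q) & ev (ssb H) i (pini ws)].
Proof.
elim: n a ps => [|n IH] a [|c ps] //= [[ac sc np] Cc R] [Lc L].
  exists c; split=> //; last exact: ev_ini R L.
  move=> j jj; have := np j jj; split; last by move=> Cj; rewrite Cj in H0.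
  by case: (r j) H0.
have [i [ci bl li ini]] := IH c ps R L; exists i; split=> //; first lia.
move=> j jj; case: (ltngtP j c) => jc; [|by apply: bl; lia|].
  have J : a < j < c by lia.
  by have := np j J; split; [case: (r j) H0|move=> Cj; rewrite Cj in H0].
by rewrite jc Cc; split.
Qed.
End InitialRow.

Lemma verify_main r (H : branch T r) : main r -> ev (ssb H) 0 (pmain m w).
Proof.
move=> mr; have r0 := H.1.
have [cov fin] := cover0 m0 addr_size addr_ne t0v H mr r0.
have gblk := g_blocky m0 addr_size addr_ne t0v H mr r0.
have rowP h t := @row_at M m N addr m0 addr_size addr_ne t0 r H mr h t.
have lr_row k : lrb (r k) -> exists t ps h', [/\ gs r k = gstart addr t, rvalid N t,
    cells m addr t0 r k ps (rrow t) 0 h' /\ rowp r k ps h', (exists fl, gs r h'.-1 = GM fl [::] t) &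
    (rleaf t /\ r h' = tA) \/ exists b t1, rchild t b = Some t1 /\ r h' = br b].
  move=> lk; have [|A] := cov k; last by rewrite A in lk.
  move=> [h [t [ps [h' [hk E V lh [C hh]]]]]].
  have Ek : k = h.
    apply/eqP; rewrite eqn_leq; case/andP: hk => hk kh; rewrite hk andbT leqNgt.
    apply/negP => K; have R : rowp r h ps h' by apply: (cells_rowp C) => // j; lia.
    by have := rowp_nohd R (j := k); rewrite K kh; case: (r k) lk => // _ /(_ isT).
  subst k; have [ps1 [h1 [C1 hh1 fl K]]] := rowP _ _ E V.
  exists t, ps1, h1; split=> //.
    by split=> //; apply: (cells_rowp C1) => // j; lia.
  by case: K => [[A [B _]]|[b [t1 [A B _]]]]; [left|right; exists b, t1].
have C_row k : r k = tC -> exists h t ps h' j b, [/\ gs r h = gstart addr t, rvalid N t, lrb (r h),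
    rowp r h ps h' & [/\ h < k < h', j < N & cellat m addr t0 r k b j (nth (l0 M) (rrow t) j)]].
  move=> Ck; have [|A] := cov k; last by rewrite A in Ck.
  move=> [h [t [ps [h' [hk E V lh [C hh]]]]]].
  have R : rowp r h ps h' by apply: (cells_rowp C) => // j; lia.
  have hk' : h < k < h'.
    case/andP: hk; rewrite leq_eqVlt => /orP[/eqP e|-> -> //].
    by rewrite e Ck in lh.
  have [j [b [js cc kb bh]]] := cells_cover C hk'; rewrite add0n in cc.
  have [_ _ _ nb _] := cc.
  have kE : k = nth h' ps j.
    case/andP: kb; rewrite leq_eqVlt => /orP[/eqP //|K1 K2].
    by have := nb k; rewrite K1 K2 Ck => /(_ isT).
  exists h, t, ps, h', j, b; split=> //; rewrite kE in hk' *; split=> //.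
  by have [sz _] := cells_size C; rewrite -(rvalid_size V) -sz.
rewrite /pmain ev_and; split.
  have [t [ps [h [E V [C R] _ _]]]] := lr_row 0 ltac:(by rewrite r0).
  have Et : rrow t = rrow t0.
    have := gs0 addr t0 r; rewrite E => E0.
    by move: E0; rewrite /gstart => -[_ ->].
  have [n [n' Ew]] := t0w; have L := cells_lets C; rewrite Et Ew in L.
  have [i [i0 bl li ini]] := ev_init0 H R L.
  rewrite /pinit ev_X ev_until; exists i; split=> //.
    by rewrite ev_and (ev_let (ssbT H) (ssbA H)); split.
  by move=> j jj; apply/ev_pblank/bl.
rewrite ev_and; split; first by have [f Af] := fin; rewrite (ev_F (ssbT H)); exists f; rewrite ?(ev_pa (ssbA H)).
rewrite ev_and; split.
  rewrite (ev_G (ssbT H)) => p _; rewrite /pblk ev_imp (ev_pa (ssbA H)) => Bp.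
  rewrite ev_and (ev_ands (ssbT H)) ev_next; split.
    move=> j jm; rewrite ev_next ev_or !(ev_pa (ssbA H)).
    by have := gblk p Bp j jm; case: (r _) => //; [left|right].
  apply/sat_pEX; apply: (X_child H r0).
  exact: (g_flag m0 addr_size addr_ne t0v H mr r0).
rewrite ev_and; split.
  rewrite (ev_G (ssbT H)) => k _; rewrite ev_imp (ev_pa (ssbA H)) (ev_phas (ssbA H)) => Ck.
  have [h [t [ps [h' [j [b [_ _ _ _ [_ jN [_ _ _ nb [_ c2 _]]]]]]]]]] := C_row k Ck.
  case E: (addr j) (addr_ne jN) => [|v vs] // _.
  have [|p [p1 p2 p3 _]] := c2 v; first by rewrite E mem_head.
  by exists p => //; split=> // x xx; apply: nb; lia.
have lrE k : ev (ssb H) k plr <-> lrb (r k).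
  rewrite /plr ev_or !(ev_pa (ssbA H)); split=> [[->|->]|] //.
  by case: (r k) => // _; [left|right].
have heads ps (rw : seq (letter M)) c q : lets r ps rw -> c \in ps -> headis r c (rk q).+1 ->
    exists2 i, i < size rw & (nth (l0 M) rw i).2 = Some q.
  move=> /lets_nth[sz L] cp hq; have ci : index c ps < size ps by rewrite index_mem.
  exists (index c ps); first by rewrite -sz.
  have := L _ ci; rewrite nth_index // => /letisE[_ hq'].
  by apply: (@lcode_inj M _ (Some q)); apply: headis_fun hq' hq.
rewrite ev_and; split.
  rewrite (ev_G (ssbT H)) => h _; rewrite ev_imp lrE => lh.
  have [t [ps [h' [E V [C R] [fl Efl] K]]]] := lr_row h lh.
  have [szp hh'] := cells_size C; have L := cells_lets C.
  have hdh' := rowp_hd R.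
  rewrite ev_and ev_X (ev_pa (ssbA H)); split.
    have sN := rvalid_size V; case: (ps) (rrow t) C szp sN => [|c ps1] [|l rw] //=.
      by move=> _ _ e; by move: N0; rewrite -e.
    by move=> [cE [b [_ Cc _ _ _] _]] _ _; rewrite -cE.
  rewrite ev_and; split.
    rewrite /pfin ev_imp ev_X ev_until => -[i [hi]]; rewrite (ev_pa (ssbA H)) => Ai nh.
    have ih' : i = h'.
      case: (ltngtP i h') => K' //.
        by have := rowp_nohd R (j := i); rewrite hi K' Ai => /(_ isT).
      by have := nh h'; rewrite hh' K' ev_N (ev_hd (ssbA H)) hdh' => /(_ isT) F; case: F.
    case: K => [[lf _]|[b [t1 [_ bE]]]]; last by rewrite -ih' Ai in bE; case: (b) bE.
    case: t lf V {E Efl C} szp L => // rw _ [sN [j [q [jN jq qF]]]] szp L.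
    have [_ Ln] := lets_nth L; have jp : j < size ps by rewrite szp sN.
    have [hc Cc] := rowp_nth R jp.
    rewrite ev_rowhas; exists (nth 0 ps j); split=> //; first by case/andP: hc.
      by move=> x xx; apply: (rowp_nohd R); lia.
    rewrite ev_pstate //; exists q => //.
    by have := Ln j jp; rewrite /lett jq => /letisE[].
  rewrite /puni ev_imp ev_rowhas => -[c [hc Cc nh]]; rewrite ev_pstate // => -[q qU hq].
  have ch' : c < h'.
    case: (ltngtP c h') => K' //; last by rewrite -K' Cc in hdh'.
    by have := nh h'; rewrite hh' K' hdh' => /(_ isT).
  have cp : c \in ps by apply: (rowp_mem R) => //; lia.
  have [i ii iq] := heads _ _ _ _ L cp hq.
  rewrite /pbranch ev_until; exists h'.-1; split; first lia; last first.
    move=> j jj; rewrite ev_X ev_N (ev_hd (ssbA H)); apply/negP; apply: (rowp_nohd R); lia.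
  have hpK : h'.-1.+1 = h' by lia.
  rewrite ev_and ev_X (ev_hd (ssbA H)) hpK; split=> //; rewrite ev_or ev_X (ev_pa (ssbA H)) hpK.
  case: K => [[_ A]|[b [t1 [tc bE]]]]; [by left|right].
  have chd b' : rchild t b' -> ev (ssb H) h'.-1 (pEX (br b')).
    move=> cb; apply/sat_pEX.
    have nX : node T (rcons (pre r h'.-1) (br b')).
      rewrite /= /gnode grun_rcons (gsE H) /= Efl /=.
      by case: b' cb => /=; case: (rchild t _).
    have [||r' [H' [E' _]]] := @extend T (fun=> True) (exist (fun v => node T v) _ nX) => //.
      by move=> y _; have [s ns] := tree_total y; exists (exist (fun v => node T v) _ ns) => //; exists s.
    rewrite /= size_rcons size_pre preS in E'; have [E1 E2] := rcons_inj E'.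
    by exists r', H'; split=> // x xk; apply: (pre_eq _ E1 xk); rewrite H'.1 r0.
  (* A universal state in the row rules out a node with one child, so both headers are possible. *)
  case: t tc V chd iq ii {E Efl C L} szp => [rw //|rw b' t' _ [sN [nU _ _]]|rw t' t'' _ _] chd iq ii szp.
    by have := nU i q; rewrite -sN => /(_ ii iq); rewrite qU.
  by rewrite ev_and; split; [apply: (chd false isT)|apply: (chd true isT)].
rewrite (ev_G (ssbT H)) => k _; rewrite ev_imp ev_or lrE (ev_pa (ssbA H)) ev_and => K.
have co d : sat (tree_cgs T) (tn H k) (SCoal [set sys] (pbody M m d)).
  case: K => [Ck|lk].
    have [h [t [ps [h' [j [b [E V lh R [hk _ _]]]]]]]] := C_row k Ck.
    apply: (coal m0 addr_size addr_ne addr_sep t0v H d mr E V lh); [lia|by right|].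
    by move=> x xx; apply: (rowp_nohd R); lia.
  have [t [ps [h' [E V _ _ _]]]] := lr_row k lk.
  by apply: (coal m0 addr_size addr_ne addr_sep t0v H d mr E V lk) => //; [left|move=> x; lia].
by split; apply: co.
Qed.

Lemma verify : sat (tree_cgs T) (s0 (tree_cgs T)) (SCoal set0 (pall m w)).
Proof.
have [|r0 [H0 _]] := @extend T (fun=> True) (exist (fun v => node T v) [::] (node_root T)) I.
  by move=> y _; have [s ns] := tree_total y; exists (exist (fun v => node T v) _ ns) => //; exists s.
have -> : s0 (tree_cgs T) = tn H0 0 by apply: val_inj.
apply/all_paths => r H _; rewrite /pall ev_and; split.
  rewrite (ev_G (ssbT H)) => i _; rewrite ev_or.
  case E: (sysst (r i)); [left|right].
    rewrite /psys !ev_or !(ev_pa (ssbA H)); case: (r i) E => //; tauto.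
  have [|r' [H' [E' mr']]] := gmain_ext H (k := i).
    by move=> j ji; apply/negP => /(sys_mono H ji); rewrite E.
  by apply/sat_pEXnX; exists r', H'; split=> // X; have := mr' i.+1; rewrite X.
rewrite ev_imp (ev_G (ssbT H)) => nX; apply: verify_main.
have nX' i : r i <> tX by move=> X; have := nX i isT; rewrite ev_N (ev_pa (ssbA H)).
elim=> [|i IH]; first by rewrite H.1.
by have := branch_succ H i; rewrite (negbTE IH); have := nX' i.+1; case: (r i.+1).
Qed.

End TreeSatisfies.

(** * Doubly exponentially many incomparable addresses *)

Section Addresses.
Variable n : nat.
Notation fT := {ffun n.-tuple bool -> bool}.
Notation addr_fun p := (nth [ffun=> false] (enum fT) p).

(* Sets of this form, one word per index [t], are incomparable for inclusion. *)
Definition addr (p : nat) : seq (seq bool) :=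
  [seq rcons (tval t) (addr_fun p t) | t : n.-tuple bool].

Lemma addr_size p v : v \in addr p -> size v = n.+1.
Proof. by move=> /mapP[t _ ->]; rewrite size_rcons size_tuple. Qed.

Lemma addr_ne p : addr p != [::].
Proof.
rewrite -size_eq0 size_map -cardE card_tuple card_bool -lt0n.
by rewrite expn_gt0.
Qed.

Lemma addr_sep p q : p < 2 ^ 2 ^ n -> q < 2 ^ 2 ^ n -> p != q ->
  has (fun v => v \notin addr q) (addr p).
Proof.
have sz : size (enum fT) = 2 ^ 2 ^ n by rewrite -cardE card_ffun card_tuple !card_bool.
move=> pN qN pq; have : addr_fun p != addr_fun q.
  by rewrite nth_uniq ?sz ?enum_uniq.
move=> /eqP Fpq; apply/hasP.
have [t tP] : exists t, addr_fun p t != addr_fun q t.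
  apply/existsP; apply: contraT => /existsPn K; case: Fpq; apply/ffunP => t.
  by have := K t; rewrite negbK => /eqP.
exists (rcons t (addr_fun p t)); first by apply: map_f; rewrite mem_enum.
apply/mapP => -[t' _ /rcons_inj[/val_inj <- E]].
by rewrite E eqxx in tP.
Qed.
End Addresses.

(** * Writing a computation tree in a window of twice the space bound *)

Section Convert.
Variables (M : ATM) (w : seq (sym M)) (B N : nat).
Hypothesis N2 : 2 * B <= N.
Hypothesis bnd : forall C, reachable (init_config w) C -> clen C <= B.
Implicit Types C : config M.

Definition hs C (b : bool) (h : nat) : nat :=
  if (tri b (cstate C) (csym C)).2 is R then h.+1 else h.-1.

Definition crow C h : seq (letter M) := mkseq (rowl C h) N.

(** When the two successors coincide, the direction recorded is the left one. *)
Fixpoint conv (t : ctree M) (h : nat) : rtree M :=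
  match t with
  | CLeaf C => RLeaf (crow C h)
  | CNode1 C t1 => let b := croot t1 != succb false C in
                   RNode1 (crow C h) b (conv t1 (hs C b h))
  | CNode2 C t1 t2 =>
      RNode2 (crow C h) (conv t1 (hs C false h)) (conv t2 (hs C true h))
  end.

(* [h - size C.1.1] is the leftmost position visited so far; it decreases only
   when the length of the configuration increases. *)
Definition inv C h : Prop :=
  [/\ size C.1.1 <= h, h - size C.1.1 <= B & B < h - size C.1.1 + clen C].

(** The word of [C] always covers the starting position [B] and has at most [B] letters; so it lies
    strictly to the right of 0 and ends before [2 * B]. *)
Lemma inv_lt C h : inv C h -> clen C <= B -> 0 < h < N.
Proof. by rewrite /inv /clen => -[? ? ?] ?; lia. Qed.

Lemma inv_step C b h : inv C h -> clen C <= B -> clen (succb b C) <= B ->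
  inv (succb b C) (hs C b h).
Proof.
move=> I cB; rewrite /inv /hs /succb; case: (tri _ _ _) => -[q s] d; move: I cB.
case: C => -[eta x] eta'; rewrite /inv /clen /=; case: d => /=.
  rewrite size_take; case: (size eta) => [|k] /=.
    by move=> [? ? ?] ? ?; split; lia.
  by move=> [? ? ?] ? ?; rewrite ltnSn; split; lia.
by rewrite size_rcons size_behead => -[? ? ?] ? ?; split; lia.
Qed.

Lemma reach_succb C b : reachable (init_config w) C -> reachable (init_config w) (succb b C).
Proof. by case: b => rC; [apply: (reach_r rC)|apply: (reach_l rC)]. Qed.

Lemma rrow_conv t h : rrow (conv t h) = crow (croot t) h.
Proof. by case: t. Qed.

Lemma crow_nth C h i : i < N -> nth (l0 M) (crow C h) i = rowl C h i.
Proof. by move=> iN; rewrite nth_mkseq. Qed.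

Lemma conv_step C b h : reachable (init_config w) C -> inv C h ->
  [/\ inv (succb b C) (hs C b h), reachable (init_config w) (succb b C) &
      stepg b None (crow C h) (crow (succb b C) (hs C b h))].
Proof.
move=> rC I; have rC' := reach_succb b rC.
have I' := inv_step I (bnd rC) (bnd rC').
have := inv_lt I (bnd rC); have := inv_lt I' (bnd rC'); rewrite /hs => H1 H2.
split=> //; apply: step_row; first by lia.
by case: (tri _ _ _).2 H1; lia.
Qed.

Lemma rvalid_conv t h : reachable (init_config w) (croot t) -> inv (croot t) h ->
  computation t -> accepting t -> rvalid N (conv t h).
Proof.
elim: t h => [C|C t1 IH|C t1 IH1 t2 IH2] h /= rC I.
- move=> _ fC; rewrite size_mkseq; split=> //; exists h, (cstate C); split=> //.
    by have := inv_lt I (bnd rC); lia.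
  rewrite crow_nth; last by have := inv_lt I (bnd rC); lia.
  by rewrite /rowl eqxx.
- move=> [ex E1 comp] acc; rewrite size_mkseq; split=> //.
  set b := _ != _; have Eb : croot t1 = succb b C.
    by rewrite /b; case: eqP => // nE; case: E1 => // E; case: nE.
  have [I' rC' S] := conv_step b rC I; split.
  + move=> i q iN; rewrite crow_nth // /rowl; case: eqP => //= _ [<-].
    by move: ex; rewrite inE.
  + by rewrite rrow_conv Eb.
  + by apply: IH => //; rewrite Eb.
move=> [un E1 E2 c1 c2] [a1 a2]; rewrite size_mkseq; split=> //.
have [I1 rC1 S1] := conv_step false rC I; have [I2 rC2 S2] := conv_step true rC I.
split; rewrite ?rrow_conv ?E1 ?E2 //; first by apply: IH1 => //; rewrite E1.
by apply: IH2 => //; rewrite E2.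
Qed.

Lemma crow_init : exists n n', crow (init_config w) B = wrow w n n'.
Proof.
have := bnd (reach_refl _); rewrite /clen /= size_behead => sB.
exists B, (N - (B.+1 + size (behead w))); apply: (@eq_from_nth _ (l0 M)).
  by rewrite size_mkseq size_cat /= size_cat !size_nseq size_map size_behead; lia.
rewrite size_mkseq => i iN; rewrite crow_nth // /rowl /tp /wrow nth_cat size_nseq nth_nseq /=.
case: (ltngtP i B) => iB; first by rewrite nth_nil.
  have -> : i - B = (i - B).-1.+1 by lia.
  rewrite /= nth_cat size_map nth_nseq; case: ltnP => ws.
    by rewrite (nth_map (blank M)).
  by rewrite nth_default //; case: ifP.
by rewrite iB subnn.
Qed.
End Convert.

Lemma completeness (M : ATM) (w : seq (sym M)) :
    space_bounded M (fun n => 2 ^ (2 ^ n)) -> accepts w ->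
  exists T : strategy_tree tok_ocgs, models (tree_cgs T) (sall w).
Proof.
move=> sb [t [tr tc ta]].
pose n := (size w).+1; pose B := 2 ^ 2 ^ size w; pose N := 2 ^ 2 ^ n.
have BN : 2 * B <= N.
  have -> : N = B * B by rewrite /N /B -expnD addnn -mul2n -expnS.
  by apply: leq_mul => //; rewrite -{1}(expn1 2) leq_exp2l // expn_gt0.
have B0 : 0 < B by rewrite expn_gt0.
have N0 : 0 < N by rewrite expn_gt0.
have bnd C : reachable (init_config w) C -> clen C <= B by apply: sb.
have r0 := reach_refl (init_config w).
have I0 : inv B (init_config w) B.
  by rewrite /inv /clen /= subn0; split=> //; lia.
have V : rvalid N (conv N t B).
  by apply: (rvalid_conv BN bnd) => //; rewrite tr.
have W : exists k k', rrow (conv N t B) = wrow w k k'.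
  by rewrite rrow_conv tr; apply: (crow_init BN bnd).
exists (gtree (addr n) (conv N t B)).
exact: (verify (ltn0Sn n) N0 (@addr_size n) (fun i _ => addr_ne n i) (@addr_sep n) V W).
Qed.

(** * Polynomial-time functions on trees *)

Notation Cons := Defs.Cons.
Notation Nil := Defs.Nil.

(** The base is at least 2, so a larger exponent absorbs constants and sums. *)
Definition pbound (f : nat -> nat) : Prop := exists k, forall n, f n <= n.+2 ^ k.

Lemma leq_expr a b k : a <= b -> a ^ k <= b ^ k.
Proof. by case: k => // k; rewrite leq_exp2r. Qed.

Lemma leq_expS2 n k l : k <= l -> n.+2 ^ k <= n.+2 ^ l.
Proof. by move=> kl; rewrite leq_exp2l. Qed.

Lemma pb_const c : pbound (fun=> c).
Proof.
exists c => n; apply: leq_trans (leq_expr c (_ : 2 <= n.+2)) => //.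
by apply: ltnW; apply: ltn_expl.
Qed.

Lemma pb_id : pbound (fun n => n).
Proof. by exists 1 => n; rewrite expn1; lia. Qed.

Lemma pb_add f g : pbound f -> pbound g -> pbound (fun n => f n + g n).
Proof.
move=> [k fk] [l gl]; exists (maxn k l).+1 => n.
have A := leq_trans (fk n) (leq_expS2 n (leq_maxl k l)).
have B := leq_trans (gl n) (leq_expS2 n (leq_maxr k l)).
by rewrite expnS; nia.
Qed.

Lemma pb_mul f g : pbound f -> pbound g -> pbound (fun n => f n * g n).
Proof. by move=> [k fk] [l gl]; exists (k + l) => n; rewrite expnD leq_mul. Qed.

Lemma pb_exp f k : pbound f -> pbound (fun n => f n ^ k).
Proof. by move=> [l fl]; exists (l * k) => n; rewrite expnM leq_expr. Qed.

Lemma pb_succ f : pbound f -> pbound (fun n => (f n).+1).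
Proof.
move=> fb; have [k fk] := pb_add fb (pb_const 1).
by exists k => n; rewrite -addn1.
Qed.

Ltac pb := repeat first [exact: pb_id | apply: pb_const | apply: pb_succ | apply: pb_add
  | apply: pb_mul | apply: pb_exp].

Lemma dsize_gt0 x : 0 < dsize x. Proof. by case: x. Qed.

Fixpoint quote (d : data) : expr :=
  if d is Cons a b then ECons (quote a) (quote b) else ENil.

Lemma eval_quote m d : eval m (quote d) = d.
Proof. by elim: d => //= a -> b ->. Qed.

Lemma cost_quote m m' d : cost m (quote d) = cost m' (quote d).
Proof. by elim: d => //= a -> b ->; rewrite !eval_quote. Qed.

Lemma updE m x t : upd m x t x = t. Proof. by rewrite /upd eqxx. Qed.
Lemma updN m x t y : y != x -> upd m x t y = m y.
Proof. by rewrite /upd => /negbTE ->. Qed.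

(* [c i] replaces the contents of variable [i] by its image, keeps the variables
   below [i], and may overwrite those above. *)
Definition realizes (F : data -> data) (k : nat) (c : nat -> cmd) : Prop :=
  forall i m, exists t m',
    [/\ run (c i) m t m', m' i = F (m i), forall j, j < i -> m' j = m j,
        t <= (dsize (m i)).+2 ^ k & dsize (F (m i)) <= (dsize (m i)).+2 ^ k].

Definition ptime (F : data -> data) : Prop := exists k c, realizes F k c.

Lemma ptime_bound F c (f : nat -> nat) : pbound f ->
  (forall i m, exists t m',
    [/\ run (c i) m t m', m' i = F (m i), forall j, j < i -> m' j = m j &
        t + dsize (F (m i)) <= f (dsize (m i))]) -> ptime F.
Proof.
move=> [k fk] H; exists k, c => i m; have [t [m' [r e p b]]] := H i m.
by exists t, m'; split=> //; apply: leq_trans (fk _); apply: leq_trans b; lia.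
Qed.

Lemma pt_id : ptime (fun x => x).
Proof.
apply: (@ptime_bound _ (fun=> Skip) (fun n => n.+1)); first by pb.
by move=> i m; exists 1, m; split=> //; apply: run_skip.
Qed.

Lemma pt_const d : ptime (fun=> d).
Proof.
apply: (@ptime_bound _ (fun i => Assign i (quote d))
  (fun=> cost (fun=> Nil) (quote d) + dsize d)); first by pb.
move=> i m; exists (cost m (quote d)), (upd m i (eval m (quote d))); split=> //.
- exact: run_assign.
- by rewrite updE eval_quote.
- by move=> j ji; rewrite updN //; lia.
- by rewrite (cost_quote m (fun=> Nil)).
Qed.

Lemma pt_comp F G : ptime F -> ptime G -> ptime (fun x => G (F x)).
Proof.
move=> [k [c H]] [l [d K]].
apply: (@ptime_bound _ (fun i => Seq (c i) (d i))
  (fun n => n.+2 ^ k + (n.+2 ^ k).+2 ^ l + (n.+2 ^ k).+2 ^ l)); first by pb.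
move=> i m; have [t [m1 [r1 e1 p1 b1 s1]]] := H i m.
have [u [m2 [r2 e2 p2 b2 s2]]] := K i m1; exists (t + u), m2; split.
- exact: run_seq r1 r2.
- by rewrite e2 e1.
- by move=> j ji; rewrite p2 ?p1.
rewrite e1 in b2 s2.
have L : (dsize (F (m i))).+2 ^ l <= ((dsize (m i)).+2 ^ k).+2 ^ l by apply: leq_expr; lia.
by apply: leq_add; [apply: leq_add => //; apply: leq_trans L | apply: leq_trans L].
Qed.

Lemma pt_hd F : ptime F -> ptime (fun x => dhd (F x)).
Proof.
move=> pF; apply: (pt_comp pF (G := dhd)).
apply: (@ptime_bound _ (fun i => Assign i (EHd (EVar i))) (fun n => n + n + n)); first by pb.
move=> i m; exists (cost m (EHd (EVar i))), (upd m i (dhd (m i))); split.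
- exact: run_assign.
- by rewrite updE.
- by move=> j ji; rewrite updN //; lia.
by rewrite /=; case: (m i) => //= a b; lia.
Qed.

Lemma pt_tl F : ptime F -> ptime (fun x => dtl (F x)).
Proof.
move=> pF; apply: (pt_comp pF (G := dtl)).
apply: (@ptime_bound _ (fun i => Assign i (ETl (EVar i))) (fun n => n + n + n)); first by pb.
move=> i m; exists (cost m (ETl (EVar i))), (upd m i (dtl (m i))); split.
- exact: run_assign.
- by rewrite updE.
- by move=> j ji; rewrite updN //; lia.
by rewrite /=; case: (m i) => //= a b; lia.
Qed.

Definition copyrun (c : nat -> cmd) (i j : nat) : cmd := Seq (Assign j (EVar i)) (c j).

Lemma copyrunP F k c i j m : realizes F k c -> exists t m',
  [/\ run (copyrun c i j) m t m', m' j = F (m i), forall x, x < j -> m' x = m x,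
      t <= dsize (m i) + (dsize (m i)).+2 ^ k & dsize (F (m i)) <= (dsize (m i)).+2 ^ k].
Proof.
move=> H; have [t [m' [r e p b s]]] := H j (upd m j (m i)).
rewrite updE in e b s; exists (cost m (EVar i) + t), m'; split=> //.
- by apply: run_seq r; apply: run_assign.
- by move=> x xj; rewrite p // updN //; lia.
by rewrite /= addn0 leq_add2l.
Qed.

Lemma pt_cons F G : ptime F -> ptime G -> ptime (fun x => Cons (F x) (G x)).
Proof.
move=> [k [c H]] [l [d K]].
apply: (@ptime_bound _ (fun i => Seq (copyrun c i i.+1) (Seq (copyrun d i i.+2)
    (Assign i (ECons (EVar i.+1) (EVar i.+2)))))
  (fun n => n + n + 4 * n.+2 ^ k + 4 * n.+2 ^ l + 2)); first by pb.
move=> i m; have [t [m1 [r1 e1 p1 b1 s1]]] := copyrunP i i.+1 m H.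
have [u [m2 [r2 e2 p2 b2 s2]]] := copyrunP i i.+2 m1 K.
have E1 : m1 i = m i by apply: p1.
have E2 : m2 i.+1 = F (m i) by rewrite p2.
rewrite E1 in e2 b2 s2.
exists (t + (u + cost m2 (ECons (EVar i.+1) (EVar i.+2)))), (upd m2 i (Cons (m2 i.+1) (m2 i.+2))).
split.
- by apply: run_seq r1 _; apply: run_seq r2 _; apply: run_assign.
- by rewrite updE E2 e2.
- by move=> j ji; rewrite updN ?p2 ?p1 //; lia.
rewrite /= E2 e2; lia.
Qed.

Lemma pt_if F G H : ptime F -> ptime G -> ptime H ->
  ptime (fun x => if dtrue (F x) then G x else H x).
Proof.
move=> [k [c cP]] [l [d dP]] [p [e eP]].
apply: (@ptime_bound _ (fun i => Seq (copyrun c i i.+1) (If (EVar i.+1) (d i) (e i)))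
  (fun n => n + 2 * n.+2 ^ k + 2 * n.+2 ^ l + 2 * n.+2 ^ p)); first by pb.
move=> i m; have [t [m1 [r1 e1 p1 b1 s1]]] := copyrunP i i.+1 m cP.
have E1 : m1 i = m i by apply: p1.
case E : (dtrue (F (m i))).
  have [u [m2 [r2 e2 p2 b2 s2]]] := dP i m1.
  exists (t + (cost m1 (EVar i.+1) + u)), m2; split.
  - by apply: run_seq r1 _; apply: run_if; rewrite /= e1 E.
  - by rewrite e2 E1.
  - by move=> j ji; rewrite p2 ?p1 //; lia.
  by rewrite /= e1; rewrite E1 in b2 s2; lia.
have [u [m2 [r2 e2 p2 b2 s2]]] := eP i m1.
exists (t + (cost m1 (EVar i.+1) + u)), m2; split.
- by apply: run_seq r1 _; apply: run_if; rewrite /= e1 E.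
- by rewrite e2 E1.
- by move=> j ji; rewrite p2 ?p1 //; lia.
by rewrite /= e1; rewrite E1 in b2 s2; lia.
Qed.

(* Steps of folds: the accumulator is copied exactly once, so that iterating a
   step lets it grow by polynomially bounded increments only. *)
Definition linrun (S : data -> data -> data) (k : nat) (c : nat -> cmd) : Prop :=
  forall i m, exists t m',
    [/\ run (c i) m t m', m' i.+1 = S (m i) (m i.+1), forall j, j <= i -> m' j = m j,
        t <= (dsize (m i) + dsize (m i.+1)).+2 ^ k &
        dsize (S (m i) (m i.+1)) <= dsize (m i.+1) + (dsize (m i)).+2 ^ k].

Definition linear (S : data -> data -> data) : Prop := exists k c, linrun S k c.

Lemma lin_acc : linear (fun _ acc => acc).
Proof.
exists 0, (fun=> Skip) => i m; exists 1, m; split=> //; first exact: run_skip.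
by rewrite leq_addr.
Qed.

(** Only one side contains the accumulator; the other is a function of [v] and accounts for the
    polynomial increment. *)
Lemma lin_cons_gen F S (b : bool) : ptime F -> linear S ->
  linear (fun v acc => if b then Cons (F v) (S v acc) else Cons (S v acc) (F v)).
Proof.
move=> [k [c H]] [l [d K]].
pose e i := if b then ECons (EVar i.+2) (EVar i.+1) else ECons (EVar i.+1) (EVar i.+2).
have [p pP] : pbound (fun n => n + 4 * n.+2 ^ k + 4 * n.+2 ^ l + 2 * n + 2) by pb.
exists p, (fun i => Seq (d i) (Seq (copyrun c i i.+2) (Assign i.+1 (e i)))) => i m.
have [t [m1 [r1 e1 p1 b1 s1]]] := K i m.
have [u [m2 [r2 e2 p2 b2 s2]]] := copyrunP i i.+2 m1 H.
have E1 : m1 i = m i by apply: p1.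
have E2 : m2 i.+1 = S (m i) (m i.+1) by rewrite p2.
rewrite E1 in e2 b2 s2.
exists (t + (u + cost m2 (e i))), (upd m2 i.+1 (eval m2 (e i))); split.
- by apply: run_seq r1 _; apply: run_seq r2 _; apply: run_assign.
- by rewrite updE /e; case: (b) => /=; rewrite E2 e2.
- by move=> j ji; rewrite updN ?p2 ?p1 //; lia.
- apply: leq_trans (pP _); set X := dsize (m i) + dsize (m i.+1) in b1 *.
  have A1 : (dsize (m i)).+2 ^ k <= X.+2 ^ k by apply: leq_expr; lia.
  have A2 : (dsize (m i)).+2 ^ l <= X.+2 ^ l by apply: leq_expr; lia.
  have -> : cost m2 (e i) = (dsize (F (m i)) + dsize (S (m i) (m i.+1))).*2.+1.
    by rewrite /e; case: (b) => /=; rewrite E2 e2; lia.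
  by lia.
have P := pP (dsize (m i)).
by case: (b) => /=; lia.
Qed.

Lemma lin_consl F S : ptime F -> linear S -> linear (fun v acc => Cons (F v) (S v acc)).
Proof. exact: (@lin_cons_gen F S true). Qed.
Lemma lin_consr F S : ptime F -> linear S -> linear (fun v acc => Cons (S v acc) (F v)).
Proof. exact: (@lin_cons_gen F S false). Qed.

Fixpoint drev (l acc : data) : data := if l is Cons a l' then drev l' (Cons a acc) else acc.

Fixpoint dloop (S : data -> data -> data) (e r acc : data) : data :=
  if r is Cons a r' then dloop S e r' (S (Cons e (Cons a r')) acc) else acc.

(* A right fold in which the step also gets the environment [e] and the reversed
   list of the preceding elements, whose length is the current index. *)
Definition dfold (S : data -> data -> data) (e l init : data) : data :=
  dloop S e (drev l Nil) init.

Lemma dsize_drev l acc : dsize (drev l acc) < dsize l + dsize acc.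
Proof. by elim: l acc => //= a _ l IH acc; have := IH (Cons a acc) => /=; lia. Qed.

Definition revcmd (x y : nat) : cmd :=
  While (EVar x) (Seq (Assign y (ECons (EHd (EVar x)) (EVar y))) (Assign x (ETl (EVar x)))).

Lemma revcmdP x y l m : x != y -> m x = l -> exists t m',
  [/\ run (revcmd x y) m t m', m' y = drev l (m y),
      forall j, j != x -> j != y -> m' j = m j &
      t <= dsize l * (8 * (dsize l + dsize (m y)))].
Proof.
move=> xy; elim: l m => [|a _ l IH] m mx.
  exists (cost m (EVar x)), m; split=> //.
    by apply: run_while_false; rewrite /= mx.
  by rewrite /= mx /=; lia.
set m1 := upd m y (Cons a (m y)); set m2 := upd m1 x l.
have m1x : m1 x = Cons a l by rewrite /m1 updN.
have [|t [m' [r e p b]]] := IH m2; first by rewrite /m2 updE.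
have m2y : m2 y = Cons a (m y) by rewrite /m2 updN 1?eq_sym // /m1 updE.
pose t1 := cost m (ECons (EHd (EVar x)) (EVar y)); pose t2 := cost m1 (ETl (EVar x)).
exists (cost m (EVar x) + (t1 + t2) + t), m'; split.
- apply: run_while_true r; first by rewrite /= mx.
  apply: (run_seq (m' := m1)); first by have := run_assign m y (ECons (EHd (EVar x)) (EVar y)); rewrite [eval _ _]/= mx.
  by have := run_assign m1 x (ETl (EVar x)); rewrite [eval _ _]/= m1x.
- by rewrite e m2y.
- by move=> j jx jy; rewrite p // /m2 updN // /m1 updN.
rewrite m2y /= in b.
rewrite /t1 /t2 /= mx m1x /=; nia.
Qed.

(** Layout: [i.+1] holds the environment, [i.+3] the reversed list still to be read, [i.+4] the
    argument of the step and [i.+4.+1] the accumulator. *)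
Definition foldbody (c : nat -> cmd) (i : nat) : cmd :=
  Seq (Assign i.+4 (ECons (EVar i.+1) (ECons (EHd (EVar i.+3)) (ETl (EVar i.+3)))))
    (Seq (c i.+4) (Assign i.+3 (ETl (EVar i.+3)))).

(** A potential argument: every unit of the size of [r] reserves [V.+3 ^ k] for the growth of the
    accumulator, which thus stays below [A] throughout. *)
Lemma dloopP S k c i e r m V A : linrun S k c -> m i.+1 = e -> m i.+3 = r ->
    dsize e + dsize r <= V -> dsize (m i.+4.+1) + dsize r * V.+3 ^ k <= A ->
  exists t m',
  [/\ run (While (EVar i.+3) (foldbody c i)) m t m',
      m' i.+4.+1 = dloop S e r (m i.+4.+1),
      forall j, j <= i.+1 -> m' j = m j,
      t <= dsize r * (9 * V + 9 + (V + A + 1).+2 ^ k) & dsize (m' i.+4.+1) <= A].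
Proof.
move=> H; elim: r m => [|a _ r IH] m me mr eV rA.
  exists (cost m (EVar i.+3)), m; split=> //.
  - by apply: run_while_false; rewrite /= mr.
  - by rewrite /= mr /=; lia.
  - by lia.
set v := Cons e (Cons a r).
set m1 := upd m i.+4 v.
have [t [m2 [r2 e2 p2 b2 s2]]] := H i.+4 m1.
have m1v : m1 i.+4 = v by rewrite /m1 updE.
have m1a : m1 i.+4.+1 = m i.+4.+1 by rewrite /m1 updN //; lia.
rewrite m1v m1a in e2 b2 s2.
have m2r : m2 i.+3 = Cons a r by rewrite p2 // /m1 updN //; lia.
set m3 := upd m2 i.+3 r.
have m3a : m3 i.+4.+1 = S v (m i.+4.+1) by rewrite /m3 updN ?e2 //; lia.
have m3e : m3 i.+1 = e.
  by rewrite /m3 updN ?p2 ?/m1 ?updN //; lia.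
have vV : dsize v <= V + 1 by move: eV => /=; lia.
have pw : (dsize v).+2 ^ k <= V.+3 ^ k by apply: leq_expr; lia.
have rA' : dsize (m i.+4.+1) + (dsize r).+1 * V.+3 ^ k <= A.
  apply: leq_trans rA; rewrite leq_add2l leq_mul2r /=; lia.
have pA : (dsize v + dsize (m i.+4.+1)).+2 ^ k <= (V + A + 1).+2 ^ k by apply: leq_expr; lia.
have [||||u [m4 [r4 e4 p4 b4 s4]]] := IH m3.
- exact: m3e.
- by rewrite /m3 updE.
- by move: eV => /=; lia.
- by rewrite m3a; rewrite mulSn in rA'; lia.
pose e1 := ECons (EVar i.+1) (ECons (EHd (EVar i.+3)) (ETl (EVar i.+3))).
pose t1 := cost m e1; pose t3 := cost m2 (ETl (EVar i.+3)).
exists (cost m (EVar i.+3) + (t1 + (t + t3)) + u), m4; split=> //.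
- apply: run_while_true r4; first by rewrite /= mr.
  apply: (run_seq (m' := m1)).
    by have := run_assign m i.+4 e1; rewrite [eval _ _]/= me mr.
  apply: run_seq r2 _.
  by have := run_assign m2 i.+3 (ETl (EVar i.+3)); rewrite [eval _ _]/= m2r.
- by rewrite e4 m3a.
- move=> j ji; rewrite p4 // /m3 updN; last lia.
  by rewrite p2 ?/m1 ?updN //; lia.
rewrite /t1 /t3 /= me mr m2r /=; move: eV => /= eV.
set W := (V + A + 1).+2 ^ k in pA b4 *; set W' := 9 * V + 9 + W in b4 *.
have tW : t <= W := leq_trans b2 pA.
rewrite mulSn mulnDl; have : W' <= dsize a * W' by rewrite leq_pmull // dsize_gt0.
rewrite {1 2}/W'; lia.
Qed.

Lemma pt_fold E L I S : ptime E -> ptime L -> ptime I -> linear S ->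
  ptime (fun x => dfold S (E x) (L x) (I x)).
Proof.
move=> [ke [ce He]] [kl [cl Hl]] [ki [ci Hi]] [k [c H]].
pose prog i := Seq (copyrun ce i i.+1) (Seq (copyrun cl i i.+2) (Seq (copyrun ci i i.+4.+1)
  (Seq (Assign i.+3 ENil) (Seq (revcmd i.+2 i.+3)
  (Seq (While (EVar i.+3) (foldbody c i)) (Assign i (EVar i.+4.+1))))))).
pose e n := n.+2 ^ ke; pose l n := n.+2 ^ kl; pose j n := n.+2 ^ ki.
(* [V] bounds the environment together with the list, and [A] the initial accumulator plus all its
   increments. *)
pose V n := e n + l n + 1; pose A n := j n + (l n + 1) * (V n).+3 ^ k.
apply: (@ptime_bound _ prog (fun n => (n + e n) + (n + l n) + (n + j n) + 1 +
  l n * (8 * (l n + 1)) + (l n + 1) * (9 * V n + 9 + (V n + A n + 1).+2 ^ k) + A n + A n)).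
  by rewrite /A /V /e /l /j; pb.
move=> i m; set x := m i.
have [t1 [m1 [r1 e1 p1 b1 s1]]] := copyrunP i i.+1 m He.
rewrite -/x in e1 b1 s1.
have [t2 [m2 [r2 e2 p2 b2 s2]]] := copyrunP i i.+2 m1 Hl.
have E1 : m1 i = x by apply: p1.
have [t3 [m3 [r3 e3 p3 b3 s3]]] := copyrunP i i.+4.+1 m2 Hi.
have E2 : m2 i = x by rewrite p2.
rewrite E1 in e2 b2 s2; rewrite E2 in e3 b3 s3.
set m4 := upd m3 i.+3 Nil.
have m4l : m4 i.+2 = L x by rewrite /m4 updN ?p3 ?e2 //; lia.
have [|t5 [m5 [r5 e5 p5 b5]]] := @revcmdP i.+2 i.+3 (L x) m4 _ m4l; first lia.
have m4r : m4 i.+3 = Nil by rewrite /m4 updE.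
rewrite m4r in e5 b5.
have m5e : m5 i.+1 = E x.
  rewrite p5 /m4 ?updN ?p3 ?p2 ?e1 //; lia.
have m5i : m5 i.+4.+1 = I x by rewrite p5 /m4 ?updN ?e3 //; lia.
have szr : dsize (drev (L x) Nil) <= dsize (L x) by have := dsize_drev (L x) Nil => /=; lia.
have [||t6 [m6 [r6 e6 p6 b6 s6]]] := @dloopP S k c i (E x) (drev (L x) Nil) m5 (V (dsize x)) (A (dsize x)) H m5e e5.
- by rewrite /V /e /l; lia.
- rewrite m5i /A leq_add //; apply: leq_mul => //; rewrite /l; lia.
exists (t1 + (t2 + (t3 + (1 + (t5 + (t6 + cost m6 (EVar i.+4.+1))))))), (upd m6 i (m6 i.+4.+1)).
split.
- apply: run_seq r1 _; apply: run_seq r2 _; apply: run_seq r3 _.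
  apply: (run_seq (m' := m4)); first exact: (run_assign m3 i.+3 ENil).
  by apply: run_seq r5 _; apply: run_seq r6 _; apply: run_assign.
- by rewrite updE e6 m5i.
- move=> y yi; rewrite updN; last lia.
  by rewrite p6 ?p5 /m4 ?updN ?p3 ?p2 ?p1 //; lia.
have -> : dsize (dfold S (E x) (L x) (I x)) = dsize (m6 i.+4.+1) by rewrite e6 m5i.
have B5 : t5 <= l (dsize x) * (8 * (l (dsize x) + 1)).
  by apply: leq_trans b5 _; apply: leq_mul => //; rewrite leq_mul2l /= leq_add2r.
set W := 9 * _ + 9 + _ in b6 *.
have B6 : t6 <= (l (dsize x) + 1) * W.
  by apply: leq_trans b6 _; rewrite leq_mul2r; apply/orP; right; rewrite /l; lia.
rewrite /= /e /l /j in B5 B6 *; lia.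
Qed.

(** * Computing the formula *)

(** Any list of the right length stands for a number; in particular the list of preceding elements
    in a fold is the current index. *)
Fixpoint dlen (d : data) : nat := if d is Cons _ d' then (dlen d').+1 else 0.
Fixpoint dseq (d : data) : seq data := if d is Cons a d' then a :: dseq d' else [::].

Lemma dseqK d : enc_seq (dseq d) = d. Proof. by elim: d => //= a _ d ->. Qed.
Lemma size_dseq d : size (dseq d) = dlen d. Proof. by elim: d => //= a _ d ->. Qed.
Lemma dlen_seq s : dlen (enc_seq s) = size s. Proof. by elim: s => //= a s ->. Qed.
Lemma dlen_nat n : dlen (enc_nat n) = n. Proof. by rewrite dlen_seq size_nseq. Qed.

Lemma dfoldE S e xs init : dfold S e (enc_seq xs) init =
  foldr (fun i acc => S (Cons e (Cons (nth Nil xs i) (enc_seq (rev (take i xs))))) acc)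
    init (iota 0 (size xs)).
Proof.
have revE ys : drev (enc_seq xs) (enc_seq ys) = enc_seq (catrev xs ys).
  by elim: xs ys => //= x xs IH ys; rewrite -(IH (x :: ys)).
rewrite /dfold (revE [::]) -/(rev xs) {revE}.
elim/last_ind: xs init => [|xs x IH] init //.
rewrite rev_rcons /= IH size_rcons -addn1 iotaD foldr_cat /= add0n nth_rcons ltnn eqxx.
rewrite -cats1 take_size_cat //.
set z := S _ init; have: all (fun i => i < size xs) (iota 0 (size xs)).
  by apply/allP => i; rewrite mem_iota.
elim: (iota 0 (size xs)) => //= i s IHs /andP[ii /IHs ->].
by rewrite nth_cat ii takel_cat // ltnW.
Qed.

Lemma dfold_iter (f : data -> data) e l init :
  dfold (fun _ acc => f acc) e l init = iter (dlen l) f init.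
Proof.
rewrite -{1}(dseqK l) dfoldE size_dseq.
by elim: (dlen l) 0 => //= n IH k; rewrite IH.
Qed.

Lemma dfold_elem G e xs init :
  dfold (fun v acc => G (dhd (dtl v)) acc) e (enc_seq xs) init = foldr G init xs.
Proof.
rewrite dfoldE -[in RHS](mkseq_nth Nil xs) /mkseq foldr_map.
by elim: (iota _ _) => //= i s ->.
Qed.

Lemma rk_nth (T : finType) (x0 : T) i : i < #|T| -> rk (nth x0 (enum T) i) = i.
Proof.
move=> iT; rewrite /rk; have -> : nth x0 (enum T) i = enum_val (Ordinal iT).
  by rewrite (enum_val_nth x0).
by rewrite enum_valK.
Qed.

Lemma dfold_enum (T : finType) (g : T -> data) S e init (S' : T -> data -> data) :
    (forall x p acc, dlen p = rk x -> S (Cons e (Cons (g x) p)) acc = S' x acc) ->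
  dfold S e (enc_seq [seq g x | x <- enum T]) init = foldr S' init (enum T).
Proof.
move=> SE; rewrite dfoldE size_map -cardE.
case: (pickP T) => [x0 _|T0]; last first.
  have -> : #|T| = 0 by apply: eq_card0.
  have -> : enum T = [::] by apply/eqP; rewrite -size_eq0 -cardE; apply/eqP/eq_card0.
  by [].
rewrite -[in RHS](mkseq_nth x0 (enum T)) /mkseq foldr_map -cardE.
have: all (fun i => i < #|T|) (iota 0 #|T|) by apply/allP => i; rewrite mem_iota.
elim: (iota 0 _) => //= i s IH /andP[ii /IH ->].
rewrite (nth_map x0) -?cardE // SE // dlen_seq size_rev size_takel ?size_map -?cardE ?rk_nth //.
by rewrite -enumT -cardE ltnW.
Qed.

Notation eP := (@enc_pform tok).

(** These functions mirror on encodings the formulas named with [p] instead of [d]; their arguments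
    are encoded formulas, parts of the encoded input, or lists standing for numbers. *)
Definition dnot a := Cons (enc_nat 1) a.
Definition dor a b := Cons (enc_nat 2) (Cons a b).
Definition dnext a := Cons (enc_nat 3) a.
Definition duntil a b := Cons (enc_nat 4) (Cons a b).
Definition dand a b := dnot (dor (dnot a) (dnot b)).
Definition dimp a b := dor (dnot a) b.
Definition diff a b := dand (dimp a b) (dimp b a).
Definition dF a := duntil (eP ptt) a.
Definition dG a := dnot (dF (dnot a)).
Definition dnx a := dnext (duntil (eP (PNot psp)) (dand (eP psp) a)).
Definition dhas a := dnext (duntil (eP (PNot psp)) (dand (eP (pa tB)) a)).
Definition dskip a := dnext (duntil (eP (pa b0)) (dand (eP (pa b1)) a)).
Definition dun l a := dfold (fun _ acc => dnext (dand (eP (pa b0)) acc)) Nil l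
  (dnext (dand (eP (pa b1)) a)).
Definition dnxt l a := dfold (fun _ acc => dnext acc) Nil l a.
Definition dsym s := dand (eP (pa tC)) (dun s (eP ptt)).
Definition dhead j := dand (eP (pa tC)) (dskip (dun j (eP ptt))).
Definition dlet s j := dand (eP (pa tC)) (dun s (dun j (eP ptt))).
Definition dY a := dF (dand (dand (eP (pa tC)) a) (eP (pnx (pa tX)))).
Definition dY' a := dF (dand (dand (eP psp) a) (eP (pnx (pand (pa tC) (pnx (pa tX)))))).
Definition dlast l := dand (eP (pa tB)) (dnxt (Cons Nil l) (eP (pa tX))).
(** In a step argument [v], [dhd v] is the environment, [dhd (dtl v)] the element and [dtl (dtl v)]
    a list whose length is its index; [Cons Nil] adds one. *)
Definition dequ l := dfold (fun v acc => dand
  (diff (dnxt (Cons Nil (dtl (dtl v))) (eP (pa b1)))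
        (dF (dand (dlast (dhd v)) (dnxt (Cons Nil (dtl (dtl v))) (eP (pa b1)))))) acc)
  l l (eP ptt).
Definition deqv l := dfold (fun v acc => dand
  (diff (dnxt (Cons Nil (dtl (dtl v))) (eP (pa b1)))
        (dF (dand (eP (pa tX)) (dnxt (Cons Nil (dtl (dtl v))) (eP (pa z1)))))) acc)
  Nil l (eP ptt).
Definition dmis l := dand (dY' (dhas (deqv l))) (dnot (dhas (deqv l))).
Definition dinx l := dnx (dand (eP (pa tC)) (dhas (dequ l))).

Definition dtri (b : bool) en := if b then dtl en else dhd en.
(** The index of the state is passed as environment to the inner fold, so that [F] sees both ranks
    beside the table entry. *)
Definition dors2 (F : data -> data) tab :=
  dfold (fun v acc => dor (dfold (fun u acc' => dor (F u) acc') (dtl (dtl v)) (dhd (dtl v))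
    (eP pff)) acc) Nil tab (eP pff).
Definition dentry (b : bool) v :=
  dand (dnx (dlet (dtl (dtl v)) (Cons Nil (dhd v))))
       (dY (dsym (dhd (dtl (dtri b (dhd (dtl v))))))).
Definition dhentry (b : bool) v :=
  dand (if dtrue (dhd (dtl (dtl (dtri b (dhd (dtl v)))))) then dlet (dtl (dtl v)) (Cons Nil (dhd v))
        else dnx (dnx (dlet (dtl (dtl v)) (Cons Nil (dhd v)))))
       (dY (dhead (Cons Nil (dhd (dtri b (dhd (dtl v))))))).
Definition dsymok (b : bool) ns tab :=
  dor (dfold (fun v acc => dor (dand (dnx (dlet (dtl (dtl v)) Nil)) (dY (dsym (dtl (dtl v))))) acc)
         Nil ns (eP pff))
      (dors2 (dentry b) tab).
Definition dheadok (b : bool) tab := dor (eP (pY (phead 0))) (dors2 (dhentry b) tab).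
Definition dbody (b : bool) l ns tab :=
  dimp (eP (pand (prow b) psame))
    (dor (dmis l) (dand (dinx l) (dand (dsymok b ns tab) (dheadok b tab)))).
Definition dcoal (b : bool) l ns tab :=
  Cons (enc_nat 0) (Cons (enc_nat 4) (Cons (enc_coal [set sys]) (dbody b l ns tab))).

Definition dstate s := dskip (dfold (fun v acc =>
  dor (if dtrue (dhd (dtl v)) then dun (Cons Nil (dtl (dtl v))) (eP ptt) else eP pff) acc)
  Nil s (eP pff)).
Definition dblank bl := dand (eP (PNot phd)) (dimp (eP (pa tC)) (dlet bl Nil)).
Definition dtail bl := dnext (duntil (dblank bl) (eP phd)).
Definition dini bl ws := dfold (fun v acc => dnx (dand (dlet (dhd (dtl v)) Nil) acc))
  Nil ws (dtail bl).
Definition dinit bl st ws :=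
  dnext (duntil (dblank bl) (dand (dlet (if dtrue ws then dhd ws else bl) (Cons Nil st))
    (dini bl (dtl ws)))).
Definition dblk l := dimp (eP (pa tB))
  (dand (dfold (fun v acc => dand (dnxt (Cons Nil (dtl (dtl v))) (eP (POr (pa b0) (pa b1)))) acc)
           Nil l (eP ptt))
        (dnxt l (eP (pEX tX)))).
Definition drowhas a := dnext (duntil (eP (PNot phd)) (dand (eP (pa tC)) a)).
Definition dfin f := dimp (eP (PNext (PUntil (PNot phd) (pa tA)))) (drowhas (dstate f)).
Definition duni u := dimp (drowhas (dstate u)) (eP pbranch).

Definition dmain l ns bl un st tab fi ws :=
  dand (dinit bl st ws)
  (dand (eP (pF (pa tA)))
  (dand (dG (dblk l))
  (dand (eP (pG (pimp (pa tC) (phas ptt))))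
  (dand (dG (dimp (eP plr) (dand (eP (PNext (pa tC))) (dand (dfin fi) (duni un)))))
        (dG (dimp (eP (POr (pa tC) plr))
           (dand (dcoal false l ns tab) (dcoal true l ns tab)))))))).

(** [Cons Nil (Cons Nil ws)] has length [size w + 2], the number of bits of a word; the other
    arguments of [dmain] are the fields of [enc_atm] and the word [ws]. *)
Definition dout (x : data) : data :=
  let a := dhd x in let ws := dtl x in
  Cons (enc_cgs tok_cgs) (Cons (enc_nat 4) (Cons (enc_coal set0)
    (dand (eP (pG (POr psys pEXnX))) (dimp (eP (pG (PNot (pa tX))))
      (dmain (Cons Nil (Cons Nil ws)) (dhd a) (dhd (dtl a)) (dhd (dtl (dtl (dtl a))))
        (dhd (dtl (dtl (dtl (dtl a))))) (dhd (dtl (dtl (dtl (dtl (dtl a))))))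
        (dhd (dtl (dtl (dtl (dtl (dtl (dtl a)))))))
        ws))))).

Section Correct.

Lemma dunE l a : dun l (eP a) = eP (pun (dlen l) a).
Proof. by rewrite /dun dfold_iter /pun; elim: (dlen l) => //= n ->. Qed.

Lemma dnxtE l a : dnxt l (eP a) = eP (pnext (dlen l) a).
Proof. by rewrite /dnxt dfold_iter /pnext; elim: (dlen l) => //= n ->. Qed.

Lemma dsymE s : dsym s = eP (psym (dlen s)).
Proof. by rewrite /dsym dunE. Qed.
Lemma dheadE s : dhead s = eP (phead (dlen s)).
Proof. by rewrite /dhead dunE. Qed.
Lemma dletE s j : dlet s j = eP (plet (dlen s) (dlen j)).
Proof. by rewrite /dlet !dunE. Qed.

Lemma dandsE F e l f :
    (forall a p, F (Cons e (Cons a p)) = eP (f (dlen p))) ->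
  dfold (fun v acc => dand (F v) acc) e l (eP ptt) = eP (pands (dlen l) f).
Proof.
move=> FE; rewrite -{1}(dseqK l) dfoldE size_dseq /pands.
have: all (fun i => i <= size (dseq l)) (iota 0 (dlen l)).
  by apply/allP => i; rewrite mem_iota size_dseq => /andP[_ /ltnW].
elim: (iota 0 _) => //= i s IH /andP[ii /IH ->].
by rewrite FE dlen_seq size_rev size_takel.
Qed.

Lemma dorsE (T : finType) (g : T -> data) F e (f : T -> pf) :
    (forall x p, dlen p = rk x -> F (Cons e (Cons (g x) p)) = eP (f x)) ->
  dfold (fun v acc => dor (F v) acc) e (enc_seq [seq g x | x <- enum T]) (eP pff) = eP (pors f).
Proof.
move=> FE; rewrite (dfold_enum _ (S' := fun x acc => dor (eP (f x)) acc)).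
  by rewrite /pors; elim: (enum T) => //= x s ->.
by move=> x p acc px; rewrite FE.
Qed.

Lemma dequE l : dequ l = eP (pequ (dlen l)).
Proof.
rewrite /dequ (@dandsE _ _ _ (fun j => piff (pnext j.+1 (pa b1))
  (pF (pand (plast (dlen l)) (pnext j.+1 (pa b1)))))) // => a p.
by rewrite /dlast [dhd _]/= !dnxtE.
Qed.

Lemma deqvE l : deqv l = eP (peqv (dlen l)).
Proof.
rewrite /deqv (@dandsE _ _ _ (fun j => piff (pnext j.+1 (pa b1))
  (pF (pand (pa tX) (pnext j.+1 (pa z1)))))) // => a p.
by rewrite !dnxtE.
Qed.

Variable M : ATM.

Definition entry_data (q : st M) (s : sym M) : data :=
  Cons (enc_triple (delta q s).1) (enc_triple (delta q s).2).
Definition table_data : data :=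
  enc_seq [seq enc_seq [seq entry_data q s | s <- enum (sym M)] | q <- enum (st M)].

Lemma dors2E F (f : st M -> sym M -> pf) :
    (forall q s pq ps, dlen pq = rk q -> dlen ps = rk s ->
       F (Cons pq (Cons (entry_data q s) ps)) = eP (f q s)) ->
  dors2 F table_data = eP (pors (fun q => pors (f q))).
Proof.
move=> FE; rewrite /dors2 /table_data.
rewrite (@dorsE _ _ (fun v => dfold (fun u acc' => dor (F u) acc') (dtl (dtl v)) (dhd (dtl v)) (eP pff))
   Nil (fun q => pors (f q))) // => q p qp /=.
by rewrite (@dorsE _ _ F p (f q)) // => s p' sp; apply: FE.
Qed.

Lemma dtriE b q s : dtri b (entry_data q s) = enc_triple (tri b q s).
Proof. by case: b. Qed.

Lemma dlen_fin (T : finType) (x : T) : dlen (enc_fin x) = rk x.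
Proof. by rewrite dlen_nat. Qed.

Lemma dsymokE b : dsymok b (enc_nat #|sym M|) table_data = eP (psymok M b).
Proof.
rewrite /dsymok (dors2E (f := fun q s => pentry b q s)); last first.
  move=> q s pq ps eq es; rewrite /dentry [dhd (dtl (Cons _ _))]/= dtriE.
  by rewrite dletE dsymE /= dlen_fin eq es.
have -> : enc_nat #|sym M| = enc_seq [seq (fun=> Nil) s | s <- enum (sym M)].
  by rewrite /enc_nat cardE; congr enc_seq; elim: (enum _) => //= x s ->.
rewrite (@dorsE _ _ (fun v => dand (dnx (dlet (dtl (dtl v)) Nil)) (dY (dsym (dtl (dtl v)))))
  Nil (fun s => pand (pnx (plet (rk s) 0)) (pY (psym (rk s))))) // => s p sp.
by rewrite dletE dsymE /= sp.
Qed.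

Lemma dheadokE b : dheadok b table_data = eP (pheadok M b).
Proof.
rewrite /dheadok (dors2E (f := fun q s => phentry b q s)) // => q s pq ps eq es.
rewrite /dhentry [dhd (dtl (Cons _ _))]/= dtriE.
rewrite dletE dheadE /= dlen_fin eq es /phentry.
by case: (tri b q s) => -[q' s'] [].
Qed.

Lemma dbodyE b l : dbody b l (enc_nat #|sym M|) table_data = eP (pbody M (dlen l) b).
Proof. by rewrite /dbody dsymokE dheadokE /dmis /dinx dequE deqvE. Qed.

Lemma dstateE (A : {set st M}) : dstate (enc_set A) = eP (pstate A).
Proof.
rewrite /dstate /enc_set (@dorsE _ _ (fun v => if dtrue (dhd (dtl v)) then dun (Cons Nil (dtl (dtl v))) (eP ptt) else eP pff)
  Nil (fun q => if q \in A then pun (rk q).+1 ptt else pff)) // => q p qp.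
case: (q \in A) => //; rewrite [dtrue _]/=.
by rewrite dunE [dlen _]/= qp.
Qed.

Lemma dblankE : dblank (enc_fin (blank M)) = eP (pblank M).
Proof. by rewrite /dblank dletE dlen_fin. Qed.

Lemma diniE (w : seq (sym M)) :
  dini (enc_fin (blank M)) (enc_seq [seq enc_fin s | s <- w]) = eP (pini w).
Proof.
rewrite /dini (dfold_elem (fun a acc => dnx (dand (dlet a Nil) acc))) foldr_map.
rewrite /dtail dblankE; elim: w => //= s w ->.
by rewrite dletE dlen_fin.
Qed.

Lemma dinitE (w : seq (sym M)) :
  dinit (enc_fin (blank M)) (enc_fin (start M)) (enc_seq [seq enc_fin s | s <- w]) = eP (pinit w).
Proof.
rewrite /dinit dblankE.
have -> : (if dtrue (enc_seq [seq enc_fin s | s <- w])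
  then dhd (enc_seq [seq enc_fin s | s <- w]) else enc_fin (blank M)) = enc_fin (head (blank M) w).
  by case: w.
have -> : dtl (enc_seq [seq enc_fin s | s <- w]) = enc_seq [seq enc_fin s | s <- behead w].
  by case: w.
by rewrite diniE dletE [dlen (Cons _ _)]/= !dlen_fin.
Qed.

Lemma dblkE l : dblk l = eP (pblk (dlen l)).
Proof.
rewrite /dblk dnxtE (@dandsE _ _ _ (fun j => pnext j.+1 (POr (pa b0) (pa b1)))) // => a p.
by rewrite dnxtE.
Qed.

Lemma doutE (w : seq (sym M)) : dout (enc_input w) = enc_output tok_cgs (sall w).
Proof.
rewrite /dout /enc_output; congr Cons.
rewrite /enc_input [dhd (Cons _ _)]/= [dtl (Cons _ _)]/= /enc_atm.
set l := Cons Nil _; have ll : dlen l = (size w).+2 by rewrite /= dlen_seq size_map.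
rewrite -[dhd (enc_seq _)]/(enc_nat #|sym M|) -[dhd (dtl (enc_seq _))]/(enc_fin (blank M)).
rewrite -[dhd (dtl (dtl (dtl (enc_seq _))))]/(enc_set (universal M)).
rewrite -[dhd (dtl (dtl (dtl (dtl (enc_seq _)))))]/(enc_fin (start M)).
rewrite -[dhd (dtl (dtl (dtl (dtl (dtl (enc_seq _))))))]/table_data.
rewrite -[dhd (dtl (dtl (dtl (dtl (dtl (dtl (enc_seq _)))))))]/(enc_set (final M)).
by rewrite /dmain dinitE dblkE /dcoal !dbodyE /dfin /duni !dstateE ll.
Qed.
End Correct.

(** Applicable because each fold step contains the accumulator once, as [lin_acc], [lin_consl] and
    [lin_consr] demand. *)
Ltac pt := repeat first
  [ assumption | exact: pt_id | apply: pt_const | apply: lin_acc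
  | apply: pt_cons | apply: pt_hd | apply: pt_tl | apply: pt_if | apply: pt_fold
  | apply: lin_consl | apply: lin_consr ].

Lemma pt_dentry b : ptime (dentry b).
Proof. by rewrite /dentry; case: b; pt. Qed.
Lemma pt_dhentry b : ptime (dhentry b).
Proof. by rewrite /dhentry; case: b; pt. Qed.
Lemma pt_dequ L : ptime L -> ptime (fun x => dequ (L x)).
Proof. by move=> pL; rewrite /dequ; pt. Qed.
Lemma pt_deqv L : ptime L -> ptime (fun x => deqv (L x)).
Proof. by move=> pL; rewrite /deqv; pt. Qed.
Lemma pt_dbody b L N T : ptime L -> ptime N -> ptime T -> ptime (fun x => dbody b (L x) (N x) (T x)).
Proof.
move=> pL pN pT; have pe := pt_dequ pL; have pv := pt_deqv pL.
have p2 F : ptime F -> ptime (fun x => dors2 F (T x)) by move=> pF; rewrite /dors2; pt.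
have pE := p2 _ (pt_dentry b); have pH := p2 _ (pt_dhentry b).
rewrite /dbody; pt.
Qed.
Lemma pt_dstate A : ptime A -> ptime (fun x => dstate (A x)).
Proof. by move=> pA; rewrite /dstate; pt. Qed.
Lemma pt_dout : ptime dout.
Proof.
pose l x := Cons Nil (Cons Nil (dtl x)); have pl : ptime l by rewrite /l; pt.
pose ns x := dhd (dhd x); pose tab x := dhd (dtl (dtl (dtl (dtl (dtl (dhd x)))))).
have pns : ptime ns by rewrite /ns; pt.
have ptab : ptime tab by rewrite /tab; pt.
pose un x := dhd (dtl (dtl (dtl (dhd x)))); pose fi x := dhd (dtl (dtl (dtl (dtl (dtl (dtl (dhd x))))))).
have pb b : ptime (fun x => dbody b (l x) (ns x) (tab x)) by apply: pt_dbody.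
have pb0 := pb false; have pb1 := pb true.
have pu : ptime (fun x => dstate (un x)) by apply: pt_dstate; rewrite /un; pt.
have pf : ptime (fun x => dstate (fi x)) by apply: pt_dstate; rewrite /fi; pt.
rewrite /dout /dmain /dcoal /dfin /duni.
rewrite -/(l _).
pt.
Qed.

(** * Size of the encoded input, and conclusion *)

Lemma dsize_seq (s : seq data) b :
  (forall x, dsize (nth Nil s x) <= b) -> dsize (enc_seq s) <= size s * b.+1 + 1.
Proof.
elim: s => //= x s IH H; have := H 0; have := IH (fun i => H i.+1) => /=.
by rewrite mulSn; lia.
Qed.

Lemma dsize_map (T : Type) (f : T -> data) (s : seq T) b : 0 < b ->
  (forall x, dsize (f x) <= b) -> dsize (enc_seq [seq f x | x <- s]) <= size s * b.+1 + 1.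
Proof.
move=> b0 H; rewrite -(size_map f); apply: dsize_seq => i.
case: (ltnP i (size s)) => si; last by rewrite nth_default ?size_map.
by case: s si => // x0 s si; rewrite (nth_map x0).
Qed.

Lemma dsize_nat n : dsize (enc_nat n) = n.*2.+1.
Proof. by elim: n => //= n ->; rewrite doubleS. Qed.

Lemma dsize_fin (T : finType) (x : T) : dsize (enc_fin x) <= #|T|.*2.+1.
Proof. by rewrite dsize_nat ltnS leq_double ltnW. Qed.

Lemma dsize_set (T : finType) (A : {set T}) : dsize (enc_set A) <= #|T| * 4 + 1.
Proof.
rewrite /enc_set [in X in _ <= X]cardE; apply: (@dsize_map _ (fun x => dbool (x \in A)) (enum T) 3) => //.
by move=> x; case: (x \in A).
Qed.

(** The square comes from unary notation: the transition table has at most [n] entries, each of size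
    linear in [n], and so has the input word. *)
Lemma dsize_input (M : ATM) (w : seq (sym M)) (n := size w + atm_size M + 1) :
  (dsize (enc_input w)).+2 <= 100 * n ^ 2.
Proof.
have n1 : 0 < n by rewrite /n addn1.
have : #|sym M| <= n /\ #|st M| <= n /\ #|st M| * #|sym M| <= n /\ size w <= n.
  by rewrite /n /atm_size; lia.
set a := #|sym M|; set b := #|st M|; move=> [an [bn [abn wn]]].
have nn : n <= n ^ 2 by rewrite leq_pmulr.
have fs (s : sym M) : dsize (enc_fin s) <= 3 * n by have := dsize_fin s; lia.
have fq (q : st M) : dsize (enc_fin q) <= 3 * n by have := dsize_fin q; lia.
have tr (t : st M * sym M * dir) : dsize (enc_triple t) <= 13 * n.
  by have := fq t.1.1; have := fs t.1.2; rewrite /=; case: (t.2) => /=; lia.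
have row q : dsize (enc_seq [seq entry_data q s | s <- enum (sym M)]) <= a * (28 * n) + 1.
  have en s : dsize (entry_data q s) <= 27 * n.
    by have := tr (delta q s).1; have := tr (delta q s).2 => /=; lia.
  have := @dsize_map _ (entry_data q) (enum (sym M)) _ (_ : 0 < 27 * n) en.
  rewrite -cardE -/a => K; apply: leq_trans (K _) _; first by lia.
  by rewrite leq_add2r leq_mul2l; apply/orP; right; lia.
have tab : dsize (table_data M) <= 31 * n ^ 2.
  have := @dsize_map _ _ (enum (st M)) _ (_ : 0 < a * (28 * n) + 1) row.
  rewrite -cardE -/b => K; apply: leq_trans (K _) _; first by lia.
  rewrite -[n ^ 2]/(n * n); nia.
have inp : dsize (enc_seq [seq enc_fin s | s <- w]) <= 5 * n ^ 2.
  have := @dsize_map _ _ w _ (_ : 0 < 3 * n) fs.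
  move=> K; apply: leq_trans (K _) _; first by lia.
  rewrite -[n ^ 2]/(n * n); nia.
have := dsize_set (universal M); have := dsize_set (final M); have := fs (blank M); have := fq (start M).
have := dsize_nat a; have := dsize_nat b.
rewrite /enc_input /enc_atm [dsize (Cons _ _)]/= -/a -/b -/(table_data M) -/a -/b; lia.
Qed.

(* The program [c] is the construction, and it runs in time polynomial in
   [size w] and [atm_size M]; [f] expresses the size of G from that of M. *)
Theorem theorem6 :
  exists (c : cmd) (k : nat) (f : nat -> nat),
  forall M : ATM, space_bounded M (fun n => 2 ^ (2 ^ n)) ->
  forall w : seq (sym M),
  exists (AP Ac S : finType) (G : openCGS AP Ac env S) (phi : sform AP agent)
         (t : nat),
    [/\ computes c (enc_input w) t (enc_output G phi)
          /\ t <= k * (size w + atm_size M + 1) ^ k,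
        turn_based G,
        accepts w <-> exists T : strategy_tree G, models (tree_cgs T) phi,
        (exists T : strategy_tree G, models (tree_cgs T) phi) <->
          ~ reactively_models G (SNot phi)
      & cgs_size G = f (atm_size M)].
Proof.
have [e [c H]] := pt_dout.
(* The bound comes from [(100 * n ^ 2) ^ e = 100 ^ e * n ^ (2 * e)]; the structure is the same for
   all machines, so [f] is constant. *)
exists (c 0), (100 ^ e + 2 * e), (fun=> cgs_size tok_cgs) => M sb w.
have [t [m' [r0 e0 _ b0 _]]] := H 0 (upd (fun=> Nil) 0 (enc_input w)).
rewrite updE in e0 b0.
exists tok, tok, tok, tok_ocgs, (sall w), t; split=> //.
- split; first by exists m'; rewrite e0 doutE.
  set n := size w + _ + 1; apply: leq_trans b0 _.
  have n1 : 0 < n by rewrite /n addn1.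
  apply: leq_trans (leq_expr e (dsize_input w)) _; rewrite -/n expnMn -expnM.
  apply: leq_mul; first exact: leq_addr.
  by rewrite leq_pexp2l // leq_addl.
- exact: tok_turn_based.
- by split; [apply: completeness | case=> T; apply: soundness].
split=> [[T mT] all|nall]; first exact: all T mT.
by apply: NNPP => nex; apply: nall => T mT; apply: nex; exists T.
Qed.
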